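(* Let $C_r=[a_1^r,b_1^r]\times[a_2^r,b_2^r]\subseteq\mathbb{R}^2$ with $-\infty\le a_j^r\le b_j^r\le\infty$ ($r,j=1,2$), and let $\mathcal{F}_O$ be the solution set of the ortho-disjunctive system $g(x)\le0$, $h(x)=0$, $(G_i(x),H_i(x))\in C_1\cup C_2$ ($i=1,\dots,p$), where $g:\mathbb{R}^d\to\mathbb{R}^n$ is locally Lipschitz continuous. Suppose that $g$ is subdifferentially regular and that $h:\mathbb{R}^d\to\mathbb{R}^m$ and $G_i,H_i:\mathbb{R}^d\to\mathbb{R}$ are smooth. Assume that MPODC-PRCPLD holds at $\bar x\in\mathcal{F}_O$. Then $\bar x$ satisfies the error bound property, i.e. there exist $\alpha\ge0$ and $\varepsilon>0$ such that $$d_{\mathcal{F}_O}(x)\le\alpha\Big(\|g^+(x)\|+\|h(x)\|+\sum_{i=1}^pd_{C_1\cup C_2}(G_i(x),H_i(x))\Big)\qquad\forall x\in\mathbb{B}_\varepsilon(\bar x).$$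
   Context: Notation. $g^+(x)$ has components $\max\{0,g_i(x)\}$; $\|\cdot\|$ is any norm; $d_S$ is the distance to $S$. $\partial$ and $\widehat\partial$ are the limiting (Mordukhovich) and regular (Fréchet) subdifferentials. A Lipschitz function $\phi$ is subdifferentially regular at $x$ if $\partial\phi(x)=\widehat\partial\phi(x)$; $g$ is subdifferentially regular if each component $g_i$ is so (at every point). $\mathcal{N}_{C_r}$ is the normal cone of the convex set $C_r$ (empty at points outside $C_r$). Intervals with infinite endpoints are read as closed intervals of $\mathbb{R}$. $\bar I_g:=\{i:g_i(\bar x)=0\}$. Smooth means continuously differentiable. MPODC-PRCPLD (piecewise RCPLD for the ortho-disjunctive system) holds at $\bar x\in\mathcal F_O$ if: (i) $\{\nabla h_i(x)\}_{i=1}^m$ has constant rank for all $x$ in a neighborhood of $\bar x$. (ii) Let $\mathcal{I}_1\subseteq\{1,\dots,m\}$ be such that $\{\nabla h_i(\bar x)\}_{i\in\mathcal{I}_1}$ is a basis of $\mathrm{span}\{\nabla h_i(\bar x)\}_{i=1}^m$. Whenever there exist $\mathcal{I}_2\subseteq\bar I_g$, a nonzero vector $(\lambda^h,\lambda^g,\bar\eta^1,\bar\eta^2)\in\mathbb{R}^m\times\mathbb{R}^n\times\mathbb{R}^{2p}$ (with $\lambda_i^h=0$ for $i\notin\mathcal{I}_1$ and $\lambda_i^g=0$ for $i\notin\mathcal{I}_2$) and $v_i\in\partial g_i(\bar x)$, $\lambda_i^g\ge0$ $(i\in\mathcal{I}_2)$ such that $$0=\sum_{i\in\mathcal{I}_2}\lambda_i^gv_i+\sum_{i\in\mathcal{I}_1}\lambda_i^h\nabla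 h_i(\bar x)+\sum_{i=1}^p\big(\nabla G_i(\bar x)\bar\eta_i^1+\nabla H_i(\bar x)\bar\eta_i^2\big),$$ $$(\bar\eta_i^1,\bar\eta_i^2)\in\mathcal{N}_{C_1}(G_i(\bar x),H_i(\bar x))\cup\mathcal{N}_{C_2}(G_i(\bar x),H_i(\bar x)),\quad i=1,\dots,p,$$ then for all sufficiently large $k$ the family $$\{v_i^k\}_{i\in\mathcal{I}_2}\cup\{\nabla h_i(x^k)\}_{i\in\mathcal{I}_1}\cup\{\nabla G_i(x^k)\}_{i\in\mathcal{I}_3}\cup\{\nabla H_i(x^k)\}_{i\in\mathcal{I}_4}$$ is linearly dependent, for any sequences $x^k\to\bar x$, $x^k\ne\bar x$, $v_i^k\in\partial g_i(x^k)$, $v_i^k\to v_i$, where $\mathcal{I}_3:=\{i:\bar\eta_i^1\ne0\}$ and $\mathcal{I}_4:=\{i:\bar\eta_i^2\ne0\}$. *)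

(* Defs.v *)
From HB Require Import structures.
From mathcomp Require Import all_boot all_order all_algebra.
From mathcomp Require Import all_classical all_reals all_analysis.
Import Order.TTheory GRing.Theory Num.Theory.
Import numFieldNormedType.Exports.

Set Implicit Arguments.
Unset Strict Implicit.
Unset Printing Implicit Defensive.

Local Open Scope classical_set_scope.
Local Open Scope ring_scope.

(** ** Norms and distances *)

(* A norm given as a function rather than by a canonical structure, so that it
   can be quantified over; the topology on ['rV[R]_d] stays the library's one,
   which every such norm induces. *)
Definition is_norm (R : realType) (V : lmodType R) (N : V -> R) : Prop :=
  [/\ forall x y, N (x + y) <= N x + N y,
      forall c x, N (c *: x) = `|c| * N x
    & forall x, N x = 0 -> x = 0].

(* [inf set0 = 0] in the library, so this is the distance to [S] only for a
   nonempty [S]. *)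
Definition dist (R : realType) (V : lmodType R) (N : V -> R) (S : set V)
    (x : V) : R :=
  inf [set N (x - s) | s in S].

(** ** Differential calculus *)

Definition component (R : realType) (d n : nat) (f : 'rV[R]_d -> 'rV[R]_n)
    (i : 'I_n) : 'rV[R]_d -> R :=
  fun x => f x 0 i.

Definition grad (R : realType) (d : nat) (f : 'rV[R]_d -> R) (x : 'rV[R]_d) :
    'rV[R]_d :=
  \row_j 'D_(delta_mx 0 j) f x.

Definition smooth (R : realType) (d : nat) (W : normedModType R)
    (f : 'rV[R]_d -> W) : Prop :=
  (forall x, differentiable f x) /\
  (forall j : 'I_d, continuous (fun x => 'D_(delta_mx 0 j) f x)).

(* The library's [[locally [lipschitz f x | x in setT]]] also quantifies over
   neighbourhoods of the pairs [(x, y)] with [x != y]. *)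
Definition locally_lipschitz (R : realType) (V W : normedModType R)
    (f : V -> W) : Prop :=
  forall x : V, exists2 U : set V, nbhs x U & [lipschitz f y | y in U].

Definition dotv (R : realType) (d : nat) (u v : 'rV[R]_d) : R :=
  \sum_j u 0 j * v 0 j.

(* [v] such that [f y >= f x + <v, y - x> + o(|y - x|)] as [y] tends to [x]. *)
Definition regular_subdiff (R : realType) (d : nat) (f : 'rV[R]_d -> R)
    (x : 'rV[R]_d) : set 'rV[R]_d :=
  [set v | forall e : R, 0 < e ->
     \forall y \near x, f x + dotv v (y - x) - e * `|y - x| <= f y].

Definition limiting_subdiff (R : realType) (d : nat) (f : 'rV[R]_d -> R)
    (x : 'rV[R]_d) : set 'rV[R]_d :=
  [set v | exists (xs vs : nat -> 'rV[R]_d),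
     [/\ xs @ \oo --> x, (f \o xs) @ \oo --> f x,
         forall k, regular_subdiff f (xs k) (vs k)
       & vs @ \oo --> v]].

Definition subdiff_regular (R : realType) (d : nat) (f : 'rV[R]_d -> R) : Prop :=
  forall x, limiting_subdiff f x = regular_subdiff f x.

(** ** The ortho-disjunctive system *)

(* The box with lower corner [a] and upper corner [b]: the closed intervals
   [[a.1, b.1]] and [[a.2, b.2]] are intersected with the real line. *)
Definition box (R : realType) (a b : \bar R * \bar R) : set (R * R) :=
  [set z | (a.1 <= z.1%:E <= b.1)%E /\ (a.2 <= z.2%:E <= b.2)%E].

Definition normal_cone (R : realType) (C : set (R * R)) (z : R * R) :
    set (R * R) :=
  [set eta | C z /\
     forall y, C y -> eta.1 * (y.1 - z.1) + eta.2 * (y.2 - z.2) <= 0].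

Definition feasible (R : realType) (d n m p : nat)
    (g : 'rV[R]_d -> 'rV[R]_n) (h : 'rV[R]_d -> 'rV[R]_m)
    (G H : 'I_p -> 'rV[R]_d -> R) (C : set (R * R)) : set 'rV[R]_d :=
  [set x | [/\ forall i, g x 0 i <= 0, h x = 0
             & forall i, C (G i x, H i x)]].

Definition pos_part (R : realType) (n : nat) (u : 'rV[R]_n) : 'rV[R]_n :=
  \row_i Num.max 0 (u 0 i).

Definition active (R : realType) (d n : nat) (g : 'rV[R]_d -> 'rV[R]_n)
    (x : 'rV[R]_d) : {set 'I_n} :=
  [set i : 'I_n | g x 0 i == 0].

(** ** MPODC-PRCPLD *)

Definition MPODC_PRCPLD (R : realType) (d n m p : nat)
    (g : 'rV[R]_d -> 'rV[R]_n) (h : 'rV[R]_d -> 'rV[R]_m)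
    (G H : 'I_p -> 'rV[R]_d -> R) (C1 C2 : set (R * R))
    (xbar : 'rV[R]_d) : Prop :=
  let gradh i x := grad (component h i) x in
  (\forall x \near xbar,
     \rank (\matrix_(i < m) gradh i x) = \rank (\matrix_(i < m) gradh i xbar)) /\
  (forall I1 : {set 'I_m},
     basis_of <<[seq gradh i xbar | i : 'I_m]>>%VS
              [seq gradh i xbar | i in I1] ->
   forall I2 : {set 'I_n}, I2 \subset active g xbar ->
   forall (lh : 'rV[R]_m) (lg : 'rV[R]_n) (eta1 eta2 : 'rV[R]_p)
          (v : 'I_n -> 'rV[R]_d),
     (lh, lg, eta1, eta2) != 0 ->
     (forall i, i \notin I1 -> lh 0 i = 0) ->
     (forall i, i \notin I2 -> lg 0 i = 0) ->
     (forall i, i \in I2 -> limiting_subdiff (component g i) xbar (v i)) ->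
     (forall i, i \in I2 -> 0 <= lg 0 i) ->
     0 = \sum_(i in I2) lg 0 i *: v i
         + \sum_(i in I1) lh 0 i *: gradh i xbar
         + \sum_i (eta1 0 i *: grad (G i) xbar + eta2 0 i *: grad (H i) xbar) ->
     (forall i, (normal_cone C1 (G i xbar, H i xbar)
                 `|` normal_cone C2 (G i xbar, H i xbar))
                (eta1 0 i, eta2 0 i)) ->
   forall (xs : nat -> 'rV[R]_d) (vs : nat -> 'I_n -> 'rV[R]_d),
     xs @ \oo --> xbar ->
     (forall k, xs k != xbar) ->
     (forall k i, i \in I2 -> limiting_subdiff (component g i) (xs k) (vs k i)) ->
     (forall i, i \in I2 -> (fun k => vs k i) @ \oo --> v i) ->
   \forall k \near \oo,
     ~~ free ([seq vs k i | i in I2]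
              ++ [seq gradh i (xs k) | i in I1]
              ++ [seq grad (G i) (xs k) | i in [set i | eta1 0 i != 0]%SET]
              ++ [seq grad (H i) (xs k) | i in [set i | eta2 0 i != 0]%SET])).

(* Main.v *)
(* Choosing, for every i, one of the boxes containing (G_i, H_i)(xbar) reduces
   the claim to finitely many systems f_l <= 0, h_j = 0 whose constraints are
   all active at xbar. For such a system, call subgradients v_l of f_l at x,
   l in S, a circuit if together with the gradients of the basis part of h they
   are dependent and every nontrivial relation has, up to a global sign, only
   positive coefficients on S. The constraint qualification makes circuits
   stable: a choice of subgradients close to a circuit, at points x <> xbar
   close to xbar, is again a circuit, and so is a limit of circuits.

   Suppose the error bound fails. Minimizing the infeasibility, suitably
   penalized, along a sequence of witnesses gives nonnegative relations between
   subgradients, hence in the limit a circuit with S the support of a minimal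
   relation. As a punctured ball is connected in dimension at least 2, all
   choices of subgradients of f_S near xbar are then circuits, which forces
   every subgradient of f_l at xbar, l in S, to vanish on a direction u
   orthogonal to the gradients of h as soon as each f_l, l in S, has some
   subgradient w with <w, u> >= 0. Projecting the sequence onto
   {f_S <= 0, h = 0} produces a unit direction u of this kind lying in the span
   of the very gradients it is orthogonal to, a contradiction. Dimension 1 is
   handled directly. *)

Require Import Defs.
From HB Require Import structures.
From mathcomp Require Import all_boot all_order all_algebra.
From mathcomp Require Import all_classical all_reals all_analysis ring lra.
Import Order.TTheory GRing.Theory Num.Theory.
Import numFieldNormedType.Exports.

Set Implicit Arguments.
Unset Strict Implicit.
Unset Printing Implicit Defensive.

Local Open Scope classical_set_scope.
Local Open Scope ring_scope.

(** * Scalar products and limits along an ultrafilter *)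

(** The constraint qualification speaks only of points other than [xbar], and it returns a bare
    dependence, without signs. Minimality of the support restores the signs. Convexity of the
    subdifferentials is what lets the circuit property pass between all choices of subgradients, and
    a limit brings it back to [xbar]. That limit must have the largest slope along [u] for all of
    [S] at once: this comes from a mean value inequality for the sum of the [f l], on a segment that
    stops short of [xbar]. A positive relation among subgradients of largest slope, paired with [u],
    is then a vanishing sum of nonnegative terms. Membership of [u] in the limiting span needs
    bounded coefficients, which hold because a circuit minus one element of [S] is independent.
    Multipliers are read off from minimizers of quadratically penalized problems, which exist by
    compactness; they replace Ekeland's principle and exact projections. The equations are settled
    before the inequalities, so that the sequence of witnesses can be taken on [h = 0]. *)

Section dotv_theory.
Variables (R : realType) (d : nat).
Implicit Types (u v w : 'rV[R]_d) (a : R).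

Lemma dotvC u v : dotv u v = dotv v u.
Proof. by apply: eq_bigr => j _; rewrite mulrC. Qed.

Lemma dotvDl u v w : dotv (u + v) w = dotv u w + dotv v w.
Proof. by rewrite -big_split; apply: eq_bigr => j _; rewrite mxE mulrDl. Qed.

Lemma dotvZl a u v : dotv (a *: u) v = a * dotv u v.
Proof. by rewrite /dotv mulr_sumr; apply: eq_bigr => j _; rewrite mxE mulrA. Qed.

Lemma dotvDr u v w : dotv w (u + v) = dotv w u + dotv w v.
Proof. by rewrite dotvC dotvDl !(dotvC w). Qed.

Lemma dotvZr a u v : dotv u (a *: v) = a * dotv u v.
Proof. by rewrite dotvC dotvZl dotvC. Qed.

Lemma dotvNl u v : dotv (- u) v = - dotv u v.
Proof. by rewrite -scaleN1r dotvZl mulN1r. Qed.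

Lemma dotvNr u v : dotv u (- v) = - dotv u v.
Proof. by rewrite dotvC dotvNl dotvC. Qed.

Lemma dotvBl u v w : dotv (u - v) w = dotv u w - dotv v w.
Proof. by rewrite dotvDl dotvNl. Qed.

Lemma dotvBr u v w : dotv w (u - v) = dotv w u - dotv w v.
Proof. by rewrite dotvDr dotvNr. Qed.

Lemma dotv0l u : dotv 0 u = 0.
Proof. by rewrite -(scale0r 0) dotvZl mul0r. Qed.

Lemma dotv0r u : dotv u 0 = 0.
Proof. by rewrite dotvC dotv0l. Qed.

Lemma dotv_suml (I : Type) (r : seq I) (P : pred I) (F : I -> 'rV[R]_d) u :
  dotv (\sum_(i <- r | P i) F i) u = \sum_(i <- r | P i) dotv (F i) u.
Proof.
exact: (big_morph (fun x => dotv x u) (fun x y => dotvDl x y u) (dotv0l u)).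
Qed.

Lemma ler_coord_norm u j : `|u 0 j| <= `|u|.
Proof.
rewrite [leRHS]/Num.norm /= mx_normrE.
by apply/bigmax_geP; right; exists (0, j).
Qed.

Lemma norm_le_coord u a : 0 <= a -> (forall j, `|u 0 j| <= a) -> `|u| <= a.
Proof.
move=> a0 H; rewrite [leLHS]/Num.norm /= mx_normrE.
by apply/bigmax_leP; split => // -[i j] _ /=; rewrite ord1.
Qed.

Lemma ler_dotv u v : `|dotv u v| <= d%:R * (`|u| * `|v|).
Proof.
apply: le_trans (ler_norm_sum _ _ _) _.
apply: (@le_trans _ _ (\sum_(j < d) `|u| * `|v|)).
  apply: ler_sum => j _; rewrite normrM.
  by apply: ler_pM => //; exact: ler_coord_norm.
by rewrite sumr_const card_ord mulr_natl.
Qed.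

Lemma dotvv_ge0 u : 0 <= dotv u u.
Proof. by apply: sumr_ge0 => j _; rewrite -expr2 sqr_ge0. Qed.

(** The norm of ['rV[R]_d] is the maximum norm, so [dotv u u] is only equivalent to its square, with
    the constants 1 here and [d] in [dotvv_le]. *)
Lemma sqr_norm_le_dotv u : `|u| ^+ 2 <= dotv u u.
Proof.
rewrite -[leRHS]sqr_sqrtr ?dotvv_ge0// ler_sqr ?nnegrE ?sqrtr_ge0//.
apply: norm_le_coord; first exact: sqrtr_ge0.
move=> j; rewrite -sqrtr_sqr ler_wsqrtr// /dotv (bigD1 j)//= -expr2 lerDl.
by apply: sumr_ge0 => i _; rewrite -expr2 sqr_ge0.
Qed.

Lemma dotvv_le u : dotv u u <= d%:R * `|u| ^+ 2.
Proof. by rewrite expr2; apply: le_trans (ler_norm _) (ler_dotv _ _). Qed.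

Lemma dotvv_eq0 u : dotv u u = 0 -> u = 0.
Proof.
move=> u0; have := sqr_norm_le_dotv u; rewrite u0 => H.
by apply/eqP; rewrite -normr_eq0 -sqrf_eq0 eq_le H sqr_ge0.
Qed.

Lemma cvg_bigsum (V : normedModType R) (T I : Type) (F : set_system T)
    {FF : Filter F} (r : seq I) (P : pred I) (a : I -> T -> V) (l : I -> V) :
  (forall i, P i -> a i @ F --> l i) ->
  (fun t => \sum_(i <- r | P i) a i t) @ F --> \sum_(i <- r | P i) l i.
Proof.
move=> al; elim: r => [|i r IH].
  rewrite big_nil; under eq_fun do rewrite big_nil; exact: cvg_cst.
rewrite big_cons; under eq_fun do rewrite big_cons.
by case: ifPn => // Pi; apply: cvgD => //; exact: al.
Qed.

Lemma cvg_coord (T : Type) (F : set_system T) {FF : Filter F}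
    (a : T -> 'rV[R]_d) u j : a @ F --> u -> (fun t => a t 0 j) @ F --> u 0 j.
Proof. by move=> au; apply: (continuous_cvg _ (@coord_continuous R _ _ 0 j _)). Qed.

Lemma cvg_dotv (T : Type) (F : set_system T) {FF : Filter F}
    (a b : T -> 'rV[R]_d) u v :
  a @ F --> u -> b @ F --> v -> (fun t => dotv (a t) (b t)) @ F --> dotv u v.
Proof.
move=> au bv; apply: cvg_bigsum => j _.
by apply: cvgM; exact: cvg_coord.
Qed.

End dotv_theory.

(** * Limits along an ultrafilter on the natural numbers *)

Section ultra.

(* A fixed nonprincipal ultrafilter on [nat]: bounded sequences converge along
   it, which replaces extracting (and renaming) convergent subsequences. *)
Definition ultraN : set_system nat :=
  projT1 (cid (ultraFilterLemma (eventually_filter))).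

#[global] Instance ultraN_ultra : UltraFilter ultraN.
Proof. by case: (projT2 (cid (ultraFilterLemma (eventually_filter)))). Qed.

Lemma ultraN_oo (P : set nat) : (\forall k \near \oo, P k) -> ultraN P.
Proof.
by case: (projT2 (cid (ultraFilterLemma (eventually_filter)))) => _; exact.
Qed.

#[global] Opaque ultraN.

Lemma ultraN_all (P : set nat) : (forall k, P k) -> ultraN P.
Proof. by move=> HP; apply: filterE. Qed.

Lemma cvg_ultraN (T : topologicalType) (a : nat -> T) (l : T) :
  a @ \oo --> l -> a @ ultraN --> l.
Proof. by move=> al A /al aA; apply: ultraN_oo. Qed.

Lemma ultraN_not (P : set nat) : ~ ultraN P -> ultraN (~` P).
Proof. by case: (in_ultra_setVsetC P ultraN_ultra). Qed.

Lemma ultraN_ex (P : set nat) : ultraN P -> exists k, P k.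
Proof. by move=> /filter_ex. Qed.

Lemma ultraN_choice (X : Type) (Q : nat -> X -> Prop) :
  (\forall n \near ultraN, exists x, Q n x) ->
  exists c, \forall n \near ultraN, Q n (c n).
Proof.
move=> H; have [_ [x0 _]] := ultraN_ex H.
have /choice [c Hc] : forall n, exists x, (exists x, Q n x) -> Q n x.
  move=> n; have [[x Qx]|nQ] := pselect (exists x, Q n x); first by exists x.
  by exists x0 => /nQ.
by exists c; apply: filterS H => n; exact: Hc.
Qed.

(** Pigeonhole: otherwise the finitely many complements, and so their intersection, would belong to
    [ultraN]. *)
Lemma ultraN_fin (I : finType) (P : nat -> pred I) :
  (\forall k \near ultraN, exists i, P k i) ->
  exists i, \forall k \near ultraN, P k i.
Proof.
move=> H; apply: contrapT => /forallNP H2.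
have : \forall k \near ultraN, forall i, ~ P k i.
  by apply: filter_forall => i; exact: ultraN_not (H2 i).
by move=> H3; have [k [[i Pi] nP]] := ultraN_ex (filterI H H3); exact: nP Pi.
Qed.

Lemma compact_ultraN (T : topologicalType) (A : set T) (a : nat -> T) :
  compact A -> (\forall k \near ultraN, A (a k)) ->
  exists2 l, A l & a @ ultraN --> l.
Proof.
move=> cA Aa; have aU : UltraFilter (a @ ultraN).
  split; first exact: fmap_proper_filter.
  move=> G GF sub; apply/seteqP; split => // B GB.
  have [//|nB] := in_ultra_setVsetC (a @^-1` B) ultraN_ultra.
  have : G (~` B) by apply: sub.
  by move=> /(filterI GB); rewrite setICr => /filter_not_empty.
move: cA; rewrite compact_ultra => /(_ _ aU Aa) [l [Al al]]; by exists l.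
Qed.

Lemma ultraN_rV (R : realType) d (a : nat -> 'rV[R]_d) (C : R) :
  (\forall k \near ultraN, `|a k| <= C) ->
  exists2 l, `|l| <= C & a @ ultraN --> l.
Proof.
move=> aC; apply: (@compact_ultraN _ [set x : 'rV[R]_d | `|x| <= C]) => //.
apply: bounded_closed_compact.
  by exists C; split; [exact: num_real|move=> x Cx y /= /le_trans; apply; exact: ltW].
rewrite (_ : [set _ | _] = (fun x : 'rV[R]_d => `|x|) @^-1` [set t | t <= C])//.
by apply: closed_comp => [x _|]; [exact: norm_continuous|exact: closed_le].
Qed.

Lemma ultraN_R (R : realType) (a : nat -> R) (C : R) :
  (\forall k \near ultraN, `|a k| <= C) ->
  exists2 l, `|l| <= C & a @ ultraN --> l.
Proof.
move=> aC; have [||l] := @compact_ultraN _ [set` `[- C, C]] a.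
- exact: segment_compact.
- by apply: filterS aC => k; rewrite /= in_itv /= ler_norml.
- by rewrite /= in_itv /= -ler_norml => lC al; exists l.
Qed.

Lemma ultraN_Rs (R : realType) (I : finType) (a : nat -> I -> R) (C : R) :
  (\forall k \near ultraN, forall i, `|a k i| <= C) ->
  exists l : I -> R, forall i, (fun k => a k i) @ ultraN --> l i.
Proof.
move=> aC; suff : forall i, exists l : R, (fun k => a k i) @ ultraN --> l.
  by move=> /choice [l Hl]; exists l.
move=> i; have [|l _ al] := @ultraN_R R (fun k => a k i) C; last by exists l.
by apply: filterS aC => k; exact.
Qed.

Lemma ultraN_rVs (R : realType) d (I : Type) (a : nat -> I -> 'rV[R]_d) (C : R) :
  (forall i, \forall k \near ultraN, `|a k i| <= C) ->
  exists l : I -> 'rV[R]_d, forall i, (fun k => a k i) @ ultraN --> l i.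
Proof.
move=> aC; suff : forall i, exists l : 'rV[R]_d, (fun k => a k i) @ ultraN --> l.
  by move=> /choice [l Hl]; exists l.
by move=> i; have [l _ al] := ultraN_rV (aC i); exists l.
Qed.

Lemma ultraN_inv (R : realType) (e : R) : 0 < e ->
  \forall k \near ultraN, k.+1%:R^-1 < e.
Proof. by move=> e0; apply: ultraN_oo; exact: near_infty_natSinv_lt (PosNum e0). Qed.

Lemma ultraN_big (R : realType) (C : R) : \forall k \near ultraN, C < k%:R.
Proof.
apply: ultraN_oo; exact: nbhs_infty_gtr.
Qed.

Lemma cvg_ultraN_inv (R : realType) : (fun k => k.+1%:R^-1 : R) @ ultraN --> (0 : R).
Proof.
apply/cvgrPdist_lt => e e0; near=> k.
rewrite sub0r normrN ger0_norm ?invr_ge0//; near: k; exact: ultraN_inv.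
Unshelve. all: by end_near. Qed.

(* Minimizing sequences converge along [ultraN] as soon as the domain is
   compact for the abstract convergence [conv]. *)
Lemma ultraN_min (R : realType) (X : Type) (D : set X)
    (conv : (nat -> X) -> X -> Prop) (phi : X -> R) :
  D !=set0 ->
  (forall Y, (forall k, D (Y k)) -> exists2 y, D y & conv Y y) ->
  (forall Y y, (forall k, D (Y k)) -> conv Y y -> phi \o Y @ ultraN --> phi y) ->
  exists2 y, D y & forall x, D x -> phi y <= phi x.
Proof.
move=> [x0 Dx0] cD cphi.
have [[m mlb]|nlb] := pselect (has_lbound (phi @` D)).
  have hi : has_inf (phi @` D) by split; [exists (phi x0); exists x0|exists m].
  have : forall k : nat, exists x, D x /\ phi x < inf (phi @` D) + k.+1%:R^-1.
    move=> k; have [|_ [x Dx <-] xk] := @inf_adherent _ (phi @` D) k.+1%:R^-1 _ hi.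
      by rewrite invr_gt0.
    by exists x.
  move=> /choice [Y HY].
  have [|y Dy Yy] := cD Y; first by move=> k; case: (HY k).
  exists y => // x Dx; apply: (@le_trans _ _ (inf (phi @` D))).
    have c2 : (fun k => inf (phi @` D) + k.+1%:R^-1) @ ultraN -->
        inf (phi @` D) + 0.
      by apply: cvgD; [exact: cvg_cst|exact: cvg_ultraN_inv].
    rewrite -[leRHS]addr0; apply: ler_cvg_to (cphi _ _ _ Yy) c2 _.
      by move=> k; case: (HY k).
    by apply: ultraN_all => k; apply/ltW; case: (HY k).
  by apply: ge_inf; [exists m|exists x].
(* If [phi] were unbounded below, a sequence with values under [- k%:R] would still converge in [D],
   against the finite value at its limit. *)
have : forall k : nat, exists x, D x /\ phi x < - k%:R.
  move=> k; apply: contrapT => /forallNP H; apply: nlb; exists (- k%:R).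
  by move=> _ [x Dx <-]; rewrite leNgt; apply/negP => xk; apply: (H x).
move=> /choice [Y HY].
have [|y Dy Yy] := cD Y; first by move=> k; case: (HY k).
have cY : phi \o Y @ ultraN --> phi y by apply: cphi => // k; case: (HY k).
have : \forall k \near ultraN, False.
  near=> k.
  have h1 : `|phi y - phi (Y k)| < 1.
    by near: k; exact: cvgr_dist_lt cY _ ltr01.
  have h2 : `|phi y| + 1 < k%:R by near: k; exact: ultraN_big.
  have [_ h3] := HY k.
  move: h1; rewrite ltr_norml => /andP[_ h1].
  have := ler_norm (- phi y); rewrite normrN => h4.
  lra.
by move=> /ultraN_ex [].
Unshelve. all: by end_near. Qed.

End ultra.

(** * Subgradients: mean value and multiplier rule *)

Section subgradients.
Variables (R : realType) (d : nat).
Implicit Types (f : 'rV[R]_d -> R) (x y z u v w q : 'rV[R]_d) (e r t C L N : R).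

(** Minimizing with a quadratic penalty yields subgradients of this kind; they are regular
    subgradients with an explicit error term. *)
Definition proximal_subgrad f z q := exists C r, 0 < r /\
  forall y, `|y - z| < r -> f z + dotv q (y - z) - C * `|y - z| ^+ 2 <= f y.

Lemma near_rVP (P : set 'rV[R]_d) x : (\forall y \near x, P y) <->
  exists2 r, 0 < r & forall y, `|y - x| < r -> P y.
Proof.
split=> [/nbhs_ballP [r /= r0 Hr]|[r r0 Hr]]; last apply/nbhs_ballP; exists r => //.
  by move=> y yr; apply: Hr; rewrite mx_norm_ball /ball_ /= distrC.
by move=> y; rewrite mx_norm_ball /ball_ /= distrC; exact: Hr.
Qed.

Lemma proximal_regular f z q : proximal_subgrad f z q -> regular_subdiff f z q.
Proof.
move=> [C [r [r0 H]]] e e0.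
have s0 : 0 < Num.min r (e / (`|C| + 1)).
  by rewrite lt_min r0 divr_gt0// ltr_wpDl.
apply/near_rVP; exists (Num.min r (e / (`|C| + 1))) => // y.
rewrite lt_min ltr_pdivlMr ?ltr_wpDl// => /andP[yr ye].
apply: le_trans (H _ yr); rewrite lerB// expr2 mulrA ler_wpM2r//.
have := ler_norm C; have := normr_ge0 (y - z); have := normr_ge0 C.
nra.
Qed.

Lemma regular_subdiffP f x v : regular_subdiff f x v <->
  forall e, 0 < e -> exists2 r, 0 < r & forall y, `|y - x| < r ->
    f x + dotv v (y - x) - e * `|y - x| <= f y.
Proof.
by split=> H e /H /near_rVP. Qed.

(** All that is used of a constraint function: local Lipschitz continuity and a closed graph of the
    regular subdifferential. Subdifferential regularity or continuous differentiability provides the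
    second clause. *)
Definition nice f :=
  (forall x, exists r L, [/\ 0 < r, 0 <= L &
     forall y z, `|y - x| < r -> `|z - x| < r -> `|f y - f z| <= L * `|y - z|]) /\
  (forall x v, (forall e, 0 < e -> exists y w,
     [/\ `|y - x| < e, `|w - v| < e & regular_subdiff f y w]) ->
   regular_subdiff f x v).

Lemma nice_continuous f : nice f -> continuous f.
Proof.
move=> [lip _] x; have [r [L [r0 L0 H]]] := lip x.
apply/(@cvgrPdist_lt _ _ _ (nbhs x)) => e e0; apply/near_rVP.
exists (Num.min r (e / (L + 1))) => [|y].
  by rewrite lt_min r0 divr_gt0// ltr_wpDl.
rewrite lt_min => /andP[yr]; rewrite ltr_pdivlMr ?ltr_wpDl// => ye.
apply: le_lt_trans (H x y _ _) _; rewrite ?subrr ?normr0//.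
by have := normr_ge0 (x - y); rewrite (distrC y x) in ye *; nra.
Qed.

Lemma nice_closed f (xs vs : nat -> 'rV[R]_d) x v : nice f ->
  xs @ ultraN --> x -> vs @ ultraN --> v ->
  (\forall k \near ultraN, regular_subdiff f (xs k) (vs k)) ->
  regular_subdiff f x v.
Proof.
move=> [_ cg] xx vv H; apply: cg => e e0.
have : \forall k \near ultraN, [/\ `|xs k - x| < e, `|vs k - v| < e &
    regular_subdiff f (xs k) (vs k)].
  near=> k; split.
  - by rewrite distrC; near: k; exact: cvgr_dist_lt.
  - by rewrite distrC; near: k; exact: cvgr_dist_lt.
  - by near: k.
by move=> /ultraN_ex [k Hk]; exists (xs k), (vs k).
Unshelve. all: by end_near. Qed.

Lemma regular_subdiff_dir f x v : regular_subdiff f x v -> forall u e, 0 < e ->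
  exists2 r, 0 < r & forall t, 0 < t < r ->
    f x + t * dotv v u - e * t <= f (x + t *: u).
Proof.
move=> /regular_subdiffP H u e e0.
have e1 : 0 < e / (`|u| + 1) by rewrite divr_gt0// ltr_wpDl.
have [r r0 Hr] := H _ e1.
exists (r / (`|u| + 1)); first by rewrite divr_gt0// ltr_wpDl.
move=> t /andP[t0]; rewrite ltr_pdivlMr ?ltr_wpDl// => tr.
have := Hr (x + t *: u); rewrite addrAC subrr add0r dotvZr.
rewrite normrZ gtr0_norm// => Hy; apply: le_trans (Hy _); last first.
  by have := normr_ge0 u; nra.
have : e / (`|u| + 1) * `|u| <= e.
  by rewrite mulrAC ler_pdivrMr ?ltr_wpDl// ler_pM2l// lerDl.
nra.
Qed.

(** For the maximum norm it suffices to compare with difference quotients along plus and minus the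
    coordinate directions. *)
Lemma regular_subdiff_bound f x r L y v : 
  (forall y z, `|y - x| < r -> `|z - x| < r -> `|f y - f z| <= L * `|y - z|) ->
  0 <= L -> `|y - x| < r -> regular_subdiff f y v -> `|v| <= L.
Proof.
move=> lip L0 yr vy; apply: norm_le_coord => // j.
have key : forall u, `|u| <= 1 -> dotv v u <= L.
  move=> u u1; apply/ler_addgt0Pr => e e0.
  have [s s0 Hs] := regular_subdiff_dir vy u e0.
  pose t := Num.min s (r - `|y - x|) / 2.
  have m0 : 0 < Num.min s (r - `|y - x|) by rewrite lt_min s0 subr_gt0.
  have t0 : 0 < t by rewrite divr_gt0.
  have [ts tr] : t < s /\ t < r - `|y - x|.
    have := le_refl (Num.min s (r - `|y - x|)).
    rewrite le_min => /andP[h1 h2]; split; rewrite /t; lra.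
  have tu : `|t *: u| <= t by rewrite normrZ gtr0_norm// ler_piMr// ltW.
  have Hl := lip (y + t *: u) y.
  have h1 : `|y + t *: u - x| < r.
    by rewrite addrAC; have := ler_normD (y - x) (t *: u); lra.
  have := Hl h1 yr; rewrite addrAC subrr add0r => h2.
  have h3 := Hs t; rewrite t0 ts in h3; have {}h3 := h3 isT.
  have h4 := ler_norm (f (y + t *: u) - f y).
  have h5 : L * `|t *: u| <= L * t by rewrite ler_wpM2l.
  have : t * dotv v u <= t * (L + e) by lra.
  by rewrite ler_pM2l.
have dj s : dotv v (s *: delta_mx 0 j) = s * v 0 j.
  rewrite dotvZr /dotv (bigD1 j)//= mxE !eqxx mulr1 big1 ?addr0// => i ij.
  by rewrite mxE (negPf ij) andbF mulr0.
have nj s : `|s| <= 1 -> `|s *: delta_mx 0 j : 'rV[R]_d| <= 1.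
  move=> s1; apply: norm_le_coord => // i; rewrite mxE mxE eqxx /=.
  by case: eqP => _; rewrite ?mulr1// mulr0 normr0.
have [v0|v0] := leP 0 (v 0 j).
  rewrite ger0_norm//; have := key (1 *: delta_mx 0 j).
  by rewrite dj mul1r; apply; apply: nj; rewrite normr1.
rewrite ltr0_norm//; have := key (-1 *: delta_mx 0 j).
by rewrite dj mulN1r; apply; apply: nj; rewrite normrN normr1.
Qed.

Lemma nice_bound f x : nice f -> exists r L, [/\ 0 < r, 0 <= L &
  forall y v, `|y - x| < r -> regular_subdiff f y v -> `|v| <= L].
Proof.
move=> [lip _]; have [r [L [r0 L0 H]]] := lip x.
by exists r, L; split => // y v yr; apply: regular_subdiff_bound H L0 yr.
Qed.

(** Fermat's rule: along [- t *: g] the decrease [t * dotv g g] beats the quadratic term as soon as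
    [K * t < 1]. *)
Lemma quadratic_stationary (g : 'rV[R]_d) (K r : R) : 0 < r ->
  (forall h, `|h| < r -> 0 <= dotv g h + K * dotv h h) -> g = 0.
Proof.
move=> r0 H; apply: dotvv_eq0; apply/eqP; rewrite eq_le dotvv_ge0 andbT.
pose t := Num.min (r / (`|g| + 1)) (1 / (`|K| + 1)) / 2.
have m0 : 0 < Num.min (r / (`|g| + 1)) (1 / (`|K| + 1)).
  by rewrite lt_min !divr_gt0 ?ltr_wpDl.
have t0 : 0 < t by rewrite divr_gt0.
have [tr tk] : t < r / (`|g| + 1) /\ t < 1 / (`|K| + 1).
  have := le_refl (Num.min (r / (`|g| + 1)) (1 / (`|K| + 1))).
  by rewrite le_min => /andP[h1 h2]; split; rewrite /t; lra.
move: tr tk; rewrite !ltr_pdivlMr ?ltr_wpDl// => tr tk.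
have := H (- t *: g); rewrite normrZ normrN gtr0_norm// => Hg.
have {}Hg : 0 <= dotv g (- t *: g) + K * dotv (- t *: g) (- t *: g).
  by apply: Hg; have := normr_ge0 g; nra.
rewrite !dotvZl !dotvZr in Hg.
have h1 : 0 <= t * ((K * t - 1) * dotv g g) by lra.
have h2 : 0 <= (K * t - 1) * dotv g g by rewrite -(pmulr_rge0 _ t0).
have h3 : K * t - 1 < 0 by have := ler_norm K; nra.
by have := dotvv_ge0 g; nra.
Qed.

(* Minimize [f (a + s (b - a) + e) - s k + N |e|^2] over small [e] and
   [s] in [0, 1], where [k] is slightly less than [f b - f a]. *)
Lemma approx_mean_value f a b e1 e2 : continuous f -> 0 < e1 -> 0 < e2 ->
  exists s y q, [/\ 0 <= s <= 1, `|y - (a + s *: (b - a))| < e2,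
    proximal_subgrad f y q & f b - f a - e1 <= dotv q (b - a)].
Proof.
move=> cf e10 e20.
(* The margin [e1] built into [k] absorbs the oscillation of [f] on this ball around [b]; this is
   what excludes [s = 1] below. *)
have [eta [eta0 etae Heta]] : exists eta, [/\ 0 < eta, eta <= e2 &
    forall u, `|u| <= eta -> `|f (b + u) - f b| < e1 / 2].
  have /cvgrPdist_lt /(_ (e1 / 2)) := cf b.
  rewrite divr_gt0// => /(_ isT) /nbhs_ballP [r /= r0 Hr].
  exists (Num.min e2 (r / 2)); split.
  - by rewrite lt_min e20 divr_gt0.
  - by rewrite ge_min lexx.
  - move=> u; rewrite le_min => /andP[_ ur].
    rewrite distrC; apply: Hr.
    rewrite mx_norm_ball /ball_ /= opprD addrA subrr add0r normrN; lra.
pose k := f b - f a - e1.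
pose P (p : 'rV[R]_d * R) := a + p.2 *: (b - a) + p.1.
pose phi N (p : 'rV[R]_d * R) := f (P p) - p.2 * k + N * dotv p.1 p.1.
pose D := [set p : 'rV[R]_d * R | `|p.1| <= eta /\ 0 <= p.2 <= 1].
have min N : exists2 p, D p & forall p', D p' -> phi N p <= phi N p'.
  apply: (@ultraN_min R _ D (fun Y p => (fst \o Y) @ ultraN --> p.1 /\
                                       (snd \o Y) @ ultraN --> p.2)).
  - by exists (0, 0); rewrite /D /= normr0 lexx ler01 (ltW eta0).
  - move=> Y YD.
    have [|y1 y1e Y1] := @ultraN_rV R d (fst \o Y) eta.
      by apply: ultraN_all => i; case: (YD i).
    have [||y2 y2s Y2] := @compact_ultraN R [set` `[(0:R), 1]] (snd \o Y).
    + exact: segment_compact.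
    + by apply: ultraN_all => i; rewrite /= in_itv /=; have [_ ->] := YD i.
    + exists (y1, y2) => //=; split => //; by rewrite /= in_itv in y2s.
  - move=> Y [y1 y2] _ /= [Y1 Y2]; apply: cvgD; first apply: cvgB.
    + apply: continuous_cvg; first exact: cf.
      apply: cvgD => //; apply: cvgD; first exact: cvg_cst.
      by apply: cvgZ => //; exact: cvg_cst.
    + by apply: cvgM => //; exact: cvg_cst.
    + by apply: cvgM; [exact: cvg_cst|exact: cvg_dotv].
(* The minimum without penalty is a lower bound that calibrates [N]: a point with [|w| = eta] would
   have a value above [phi N (0, 0) = f a]. *)
have [p0 Dp0 Hp0] := min 0.
pose N := (`|f a - phi 0 p0| + 1) / eta ^+ 2.
have eta2 : 0 < eta ^+ 2 by rewrite exprn_gt0.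
have N0 : 0 < N by rewrite divr_gt0// ltr_wpDl.
have [[w s] [/= we /andP[s0 s1]] Hws] := min N.
have phi00 : phi N (0, 0) = f a.
  by rewrite /phi /P /= scale0r !addr0 mul0r subr0 dotv0l mulr0 addr0.
have Dphi : phi N (w, s) <= f a.
  by rewrite -phi00; apply: Hws; rewrite /D /= normr0 lexx ler01 (ltW eta0).
have wlt : `|w| < eta.
  rewrite -(ltr_pXn2r (n := 2)) ?nnegrE ?normr_ge0 ?(ltW eta0)//.
  rewrite -(ltr_pM2l N0); apply: le_lt_trans (_ : N * dotv w w < _).
    by rewrite ler_wpM2l ?(ltW N0)// sqr_norm_le_dotv.
  have : phi 0 p0 <= phi 0 (w, s) by apply: Hp0; rewrite /D /= we s0 s1.
  have NE : phi N (w, s) = phi 0 (w, s) + N * dotv w w.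
    by rewrite /phi mul0r addr0.
  move=> h; rewrite NE in Dphi; have -> : N * eta ^+ 2 = `|f a - phi 0 p0| + 1 by rewrite divfK ?gt_eqF.
  by have := ler_norm (f a - phi 0 p0); lra.
have slt : s < 1.
  rewrite lt_neqAle s1 andbT; apply/eqP => s1E.
  move: Dphi; rewrite /phi /P /= s1E scale1r mul1r [a + _]addrC subrK.
  have := Heta w we; rewrite ltr_norml /k => /andP[h _].
  have := dotvv_ge0 w => h2; have : 0 <= N * dotv w w by rewrite mulr_ge0// ltW.
  lra.
exists s, (P (w, s)), (- (2 * N) *: w); split.
- by rewrite s0 s1.
- by rewrite /P /= addrAC subrr add0r; apply: lt_le_trans etae.
(* With [s] fixed, varying [w] moves the argument of [f] freely, and the penalty supplies the
   subgradient [- (2 * N) *: w]. *)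
- exists (N * d%:R), (eta - `|w|); split; first by rewrite subr_gt0.
  move=> y; have [h hE] : exists h, h = y - P (w, s) by eexists.
  rewrite -hE => yP.
  have := Hws (w + h, s); have -> : phi N (w + h, s) =
      f y - s * k + N * (dotv w w + 2 * dotv w h + dotv h h).
    rewrite /phi /= (_ : P _ = y); last by rewrite /P /= addrA hE [LHS]addrC subrK.
    rewrite !dotvDl !dotvDr (dotvC h w); ring.
  rewrite {1}/phi /= => H1; have {}H1 := H1 _.
  have {H1} : f (P (w, s)) - s * k + N * dotv w w <=
      f y - s * k + N * (dotv w w + 2 * dotv w h + dotv h h).
    apply: H1; rewrite /D /= s0 s1; split => //.
    by apply: le_trans (ler_normD _ _) _; lra.
  have h3 : N * dotv h h <= N * (d%:R * `|h| ^+ 2).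
    by rewrite ler_wpM2l ?(ltW N0)// dotvv_le.
  rewrite dotvZl; lra.
(* Increasing [s] by [m] while subtracting [m *: c] from [w] leaves the argument of [f] fixed: only
   the linear and the penalty terms change. Such a move is possible because [s < 1] and
   [|w| < eta]. *)
- rewrite -/k; have [c cE] : exists c, c = b - a by eexists.
  rewrite -cE dotvZl; apply/ler_addgt0Pr => g g0.
  pose K := N * dotv c c + 1.
  have K0 : 0 < K by rewrite ltr_wpDl// mulr_ge0// ?dotvv_ge0// ltW.
  have c0 : 0 < `|c| + 1 by rewrite ltr_wpDl.
  pose m := Num.min (1 - s) (Num.min ((eta - `|w|) / (`|c| + 1)) (g / K)).
  have m0 : 0 < m by rewrite !lt_min subr_gt0 slt !divr_gt0// subr_gt0.
  have := le_refl m; rewrite {2}/m !le_min => /and3P[ms me mg].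
  move: me mg; rewrite !ler_pdivlMr// => me mg.
  have := Hws (w - m *: c, s + m); have -> : phi N (w - m *: c, s + m) =
      f (P (w, s)) - (s + m) * k +
      N * (dotv w w - 2 * m * dotv w c + m ^+ 2 * dotv c c).
    rewrite /phi /= (_ : P (_, s + m) = P (w, s)); last first.
      rewrite /P /= -cE scalerDl addrA -!addrA; congr (_ + (_ + _)).
      by rewrite addrCA subrr addr0.
    rewrite !(dotvDl, dotvDr, dotvNl, dotvNr, dotvZl, dotvZr) (dotvC c w); ring.
  rewrite {1}/phi /= => H1; have {}H1 := H1 _.
  have {H1} : f (P (w, s)) - s * k + N * dotv w w <= f (P (w, s)) - (s + m) * k +
      N * (dotv w w - 2 * m * dotv w c + m ^+ 2 * dotv c c).
    apply: H1; rewrite /D /=; split; last by apply/andP; split; lra.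
    apply: le_trans (ler_normB _ _) _; rewrite normrZ gtr0_norm//.
    by have := normr_ge0 c; nra.
  move=> H1.
  have h4 : m * k <= m * (- (2 * N) * dotv w c + m * (N * dotv c c)).
    by move: H1; rewrite expr2; lra.
  rewrite ler_pM2l// in h4.
  have : m * (N * dotv c c) <= g.
    by apply: le_trans mg; rewrite ler_wpM2l ?(ltW m0)// /K lerDl.
  lra.
Qed.

(** The mean value inequality with both end points at [x] produces bounded subgradients at points
    arbitrarily close to [x]; the graph is closed. *)
Lemma nice_subdiff_neq0 f x : nice f -> exists v, regular_subdiff f x v.
Proof.
move=> nf; have cf := nice_continuous nf.
have [r [L [r0 L0 H]]] := nice_bound x nf.
have : forall k : nat, exists p : 'rV[R]_d * 'rV[R]_d,
    `|p.1 - x| < k.+1%:R^-1 /\ regular_subdiff f p.1 p.2.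
  move=> k; have [||s [y [q [_ yx pq _]]]] :=
    @approx_mean_value f x x 1 (k.+1%:R^-1) cf; rewrite ?invr_gt0//.
  exists (y, q) => /=; split; last exact: proximal_regular.
  by move: yx; rewrite subrr scaler0 addr0.
move=> /choice [p Hp].
have px : (fst \o p) @ ultraN --> x.
  apply/cvgrPdist_lt => e e0; near=> k.
  have [/= h _] := Hp k; rewrite distrC; apply: lt_trans h _.
  by near: k; exact: ultraN_inv.
have [|v _ pv] := @ultraN_rV R d (snd \o p) L.
  near=> k; have [_ h] := Hp k; apply: H h.
  by rewrite distrC; near: k; exact: cvgr_dist_lt px _ r0.
exists v; apply: nice_closed nf px pv _.
by apply: ultraN_all => k; case: (Hp k).
Unshelve. all: by end_near. Qed.

End subgradients.

(** * Multipliers at a local minimum of a weighted sum *)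

Section multiplier_rule.
Variables (R : realType) (d : nat) (T : finType).
Variables (f : T -> 'rV[R]_d -> R) (c : T -> R) (p z : 'rV[R]_d) (C r : R).
Hypotheses (f_nice : forall l, nice (f l)) (c_ge0 : forall l, 0 <= c l).
Hypothesis (r_gt0 : 0 < r).
Hypothesis zmin : forall y : 'rV[R]_d, `|y - z| < r ->
  0 <= \sum_l c l * (f l y - f l z) + dotv p (y - z) + C * `|y - z| ^+ 2.

(* Every function gets its own copy of the variable and the penalty
   [N sum_l |Y_l - y|^2] forces the copies together. *)
Lemma decoupled_stationary (N : R) : 0 <= N ->
  exists (y : 'rV[R]_d) (Y : T -> 'rV[R]_d),
  [/\ `|y - z| <= r / 2, forall l, `|Y l - z| <= r / 2,
    \sum_l c l * (f l (Y l) - f l z) + dotv p (y - z) +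
      (`|C| + 1) * dotv (y - z) (y - z) +
      N * (\sum_l dotv (Y l - y) (Y l - y)) <= 0
  & forall (y' : 'rV[R]_d) (Y' : T -> 'rV[R]_d), `|y' - z| <= r / 2 -> (forall l, `|Y' l - z| <= r / 2) ->
    \sum_l c l * (f l (Y l) - f l z) + dotv p (y - z) +
      (`|C| + 1) * dotv (y - z) (y - z) +
      N * (\sum_l dotv (Y l - y) (Y l - y)) <=
    \sum_l c l * (f l (Y' l) - f l z) + dotv p (y' - z) +
      (`|C| + 1) * dotv (y' - z) (y' - z) +
      N * (\sum_l dotv (Y' l - y') (Y' l - y')) ].
Proof.
move=> N0.
pose X := ('rV[R]_d * (T -> 'rV[R]_d))%type.
pose D := [set q : X | `|q.1 - z| <= r / 2 /\ forall l, `|q.2 l - z| <= r / 2].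
(* The coefficient [|C| + 1], larger than [C], makes [z] the only possible limit of the minimizers
   as [N] grows. *)
pose phi (q : X) := \sum_l c l * (f l (q.2 l) - f l z) + dotv p (q.1 - z) +
      (`|C| + 1) * dotv (q.1 - z) (q.1 - z) +
      N * (\sum_l dotv (q.2 l - q.1) (q.2 l - q.1)).
have bnd (x : 'rV[R]_d) : `|x - z| <= r / 2 -> `|x| <= r / 2 + `|z|.
  by move=> h; rewrite -[x](subrK z); apply: le_trans (ler_normD _ _) _; rewrite lerD2r.
have cl (a : nat -> 'rV[R]_d) (l : 'rV[R]_d) : a @ ultraN --> l ->
    (forall k, `|a k - z| <= r / 2) -> `|l - z| <= r / 2.
  move=> al H; have c1 : (fun k => `|a k - z|) @ ultraN --> `|l - z|.
    by apply: cvg_norm; apply: cvgB => //; exact: cvg_cst.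
  by apply: ler_cvg_to c1 (cvg_cst _) _; exact: ultraN_all.
have [|||[y Y] [/= Dy DY] ymin] := @ultraN_min R X D
  (fun Q q => (fst \o Q) @ ultraN --> q.1 /\
              forall l, (fun k => (Q k).2 l) @ ultraN --> q.2 l) phi.
- by exists (z, fun=> z); rewrite /D /= subrr normr0; split => // *; rewrite divr_ge0// ltW.
- move=> Q QD; have [|y _ yQ] := @ultraN_rV R d (fst \o Q) (r / 2 + `|z|).
    by apply: ultraN_all => k; apply: bnd; case: (QD k).
  have [l|Y YQ] := @ultraN_rVs R d T (fun k => (Q k).2) (r / 2 + `|z|).
    by apply: ultraN_all => k; apply: bnd; case: (QD k).
  exists (y, Y) => //; split => /=; first by apply: cl yQ _ => k; case: (QD k).
  by move=> l; apply: cl (YQ l) _ => k; case: (QD k).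
- move=> Q [y Y] _ /= [yQ YQ].
  have yz : (fun k => (Q k).1 - z) @ ultraN --> y - z.
    by apply: cvgB => //; exact: cvg_cst.
  apply: cvgD; first apply: cvgD; first apply: cvgD.
  + apply: cvg_bigsum => l _; apply: cvgM; first exact: cvg_cst.
    apply: cvgB; last exact: cvg_cst.
    by apply: continuous_cvg; [exact: nice_continuous|exact: YQ].
  + by apply: cvg_dotv => //; exact: cvg_cst.
  + by apply: cvgM; [exact: cvg_cst|exact: cvg_dotv].
  + apply: cvgM; first exact: cvg_cst.
    by apply: cvg_bigsum => l _; apply: cvg_dotv; apply: cvgB => //; exact: YQ.
exists y, Y; split => //.
  apply: le_trans (ymin (z, fun=> z) _) _.
    by rewrite /D /= subrr normr0; split => // *; rewrite divr_ge0// ltW.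
  rewrite /phi /= subrr !dotv0r mulr0 !addr0 !big1 ?mulr0 ?addr0// => l _.
  by rewrite subrr mulr0.
by move=> y' Y' Dy' DY'; exact: (ymin (y', Y')).
Qed.

(** Optimality in one copy [Y l] balances the derivative of the penalty with [c l] times a
    subgradient; optimality in [y] adds these vectors up. For [c l = 0] no subgradient at [Y l] is
    obtained, which the second alternative records. *)
Lemma decoupled_subgrad : forall k : nat, exists (y : 'rV[R]_d) (Y W : T -> 'rV[R]_d),
  [/\ `|y - z| <= r / 2, forall l, `|Y l - z| <= r / 2,
    k%:R * (\sum_l dotv (Y l - y) (Y l - y)) <=
      - (\sum_l c l * (f l (Y l) - f l z) + dotv p (y - z) +
         (`|C| + 1) * dotv (y - z) (y - z)),
    (forall l, `|Y l - z| < r / 2 -> `|y - z| < r / 2 ->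
       exists2 v, regular_subdiff (f l) (Y l) v \/ c l = 0 & W l = c l *: v) &
    (`|y - z| < r / 2 ->
      \sum_l W l + p + 2 * (`|C| + 1) *: (y - z) = 0)].
Proof.
move=> k; have [y [Y [Dy DY le0 ymin]]] := decoupled_stationary (ler0n R k).
set N : R := k%:R in le0 ymin *; have N0 : 0 <= N by exact: ler0n.
exists y, Y, (fun l => - (2 * N) *: (Y l - y)); split => //; first lra.
- move=> l Yl yl.
  have up (x : 'rV[R]_d) : `|x - z| <= r / 2 -> c l * f l (Y l) + N * dotv (Y l - y) (Y l - y) <=
      c l * f l x + N * dotv (x - y) (x - y).
    move=> xr; have upd (F : T -> 'rV[R]_d -> R) (Z : T -> 'rV[R]_d) :
        \sum_j F j (Z j) = F l (Z l) + \sum_(j | j != l) F j (Z j) by rewrite (bigD1 l).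
    pose Y' j := if j == l then x else Y j.
    have updY (F : T -> 'rV[R]_d -> R) :
        \sum_(j | j != l) F j (Y' j) = \sum_(j | j != l) F j (Y j).
      by apply: eq_bigr => j /negPf jl; rewrite /Y' jl.
    have DY' j : `|Y' j - z| <= r / 2 by rewrite /Y'; case: ifP.
    have := ymin y Y' Dy DY'.
    rewrite !(upd (fun j u => c j * (f j u - f j z))) !(upd (fun j u => dotv (u - y) (u - y))).
    rewrite (updY (fun j u => c j * (f j u - f j z))) (updY (fun j u => dotv (u - y) (u - y))).
    have -> : Y' l = x by rewrite /Y' eqxx.
    lra.
  (* With weight zero, optimality of [Y l] makes the penalty term vanish, so [W l = 0]. *)
  have [c0|c0] := eqVneq (c l) 0.
    exists 0; [by right|rewrite scaler0].
    have := up y (ltW yl); rewrite c0 !mul0r !add0r subrr dotv0r mulr0 => h.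
    have {h} : N * dotv (Y l - y) (Y l - y) = 0.
      by apply/eqP; rewrite eq_le h mulr_ge0 ?dotvv_ge0.
    move/eqP; rewrite mulf_eq0 => /orP[/eqP ->|/eqP /dotvv_eq0 ->].
      by rewrite mulr0 oppr0 scale0r.
    by rewrite scaler0.
  have cp : 0 < c l by rewrite lt_neqAle eq_sym c0 c_ge0.
  exists ((c l)^-1 *: (- (2 * N) *: (Y l - y))); last first.
    by rewrite scalerA divff// scale1r.
  left; apply: proximal_regular.
  exists ((c l)^-1 * (N * d%:R)), (r / 2 - `|Y l - z|); split; first by rewrite subr_gt0.
  move=> x; have [h hE] : exists h, h = x - Y l by eexists.
  rewrite -hE => hr; have [g gE] : exists g, g = Y l - y by eexists.
  rewrite -gE.
  have xr : `|x - z| <= r / 2.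
    have -> : x - z = h + (Y l - z) by rewrite hE addrA subrK.
    by apply: le_trans (ler_normD _ _) _; lra.
  have := up x xr; have -> : x - y = h + g by rewrite hE gE addrA subrK.
  rewrite -gE !dotvDl !dotvDr (dotvC h g) !dotvZl => H.
  have h3 : N * dotv h h <= N * (d%:R * `|h| ^+ 2) by rewrite ler_wpM2l// dotvv_le.
  rewrite -(ler_pM2l cp); have ccK := mulfV c0.
  have -> : c l * (f l (Y l) + (c l)^-1 * (- (2 * N) * dotv g h) - (c l)^-1 *
     (N * d%:R) * `|h| ^+ 2) = c l * f l (Y l) + (- (2 * N) * dotv g h) - N * (d%:R * `|h| ^+ 2).
    by field.
  lra.
- move=> yr; pose g := p + (2 * (`|C| + 1)) *: (y - z) - (2 * N) *: \sum_l (Y l - y).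
  have -> : \sum_l - (2 * N) *: (Y l - y) + p + 2 * (`|C| + 1) *: (y - z) = g.
    by rewrite -scaler_sumr scaleNr /g [RHS]addrC addrA.
  apply: (@quadratic_stationary R d g (`|C| + 1 + N * #|T|%:R) (r / 2 - `|y - z|)).
    by rewrite subr_gt0.
  move=> h hr; have := ymin (y + h) Y _ DY.
  have -> : y + h - z = (y - z) + h by rewrite addrAC.
  have [w wE] : exists w, w = y - z by eexists.
  rewrite /g -wE in yr hr *.
  have e1 : \sum_l dotv (Y l - (y + h)) (Y l - (y + h)) =
     \sum_l dotv (Y l - y) (Y l - y) - 2 * dotv (\sum_l (Y l - y)) h + #|T|%:R * dotv h h.
    rewrite dotv_suml mulr_sumr -sumrB.
    have -> : #|T|%:R * dotv h h = \sum_(l : T) dotv h h by rewrite sumr_const mulr_natl.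
    rewrite -big_split /=; apply: eq_bigr => l _.
    have -> : Y l - (y + h) = (Y l - y) - h by rewrite opprD addrA.
    have [u uE] : exists u, u = Y l - y by eexists.
    rewrite -uE !dotvBl !dotvBr (dotvC h u); ring.
  rewrite e1 !dotvDl !dotvDr !dotvNl !dotvZl (dotvC h w) => H.
  have {}H := H _; have {H} := H _.
  set S1 := \sum_l _ * _; set S2 := \sum_l dotv _ _ => H.
  have {}H : `|w + h| <= r / 2 -> _ := H.
  have : `|w + h| <= r / 2 by apply: le_trans (ler_normD _ _) _; lra.
  move=> /H; lra.
Qed.

(** Fermat's rule and the sum rule in one: as the penalty grows the copies merge at [z], and the
    bounded vectors [W k l] converge to weighted subgradients at [z]. *)
Lemma multiplier_rule : exists v : T -> 'rV[R]_d,
  (forall l, regular_subdiff (f l) z (v l)) /\ \sum_l c l *: v l + p = 0.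
Proof.
(* The problem with [N = 0] attains its minimum, which bounds the objective below uniformly in the
   penalty. *)
have [m mlb] : exists m, forall (y : 'rV[R]_d) (Y : T -> 'rV[R]_d),
    `|y - z| <= r / 2 -> (forall l, `|Y l - z| <= r / 2) ->
    m <= \sum_l c l * (f l (Y l) - f l z) + dotv p (y - z) +
         (`|C| + 1) * dotv (y - z) (y - z).
  have [y [Y [_ _ _ h]]] := decoupled_stationary (lexx 0).
  eexists => y' Y' h1 h2; have := h y' Y' h1 h2.
  by rewrite !mul0r !addr0; exact.
have /choice [y /choice [Y /choice [W H]]] := decoupled_subgrad.
have bnd (x : 'rV[R]_d) : `|x - z| <= r / 2 -> `|x| <= r / 2 + `|z|.
  by move=> h; rewrite -[x](subrK z); apply: le_trans (ler_normD _ _) _; rewrite lerD2r.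
have [|y0 _ yy0] := @ultraN_rV R d y (r / 2 + `|z|).
  by apply: ultraN_all => k; apply: bnd; case: (H k).
have [l|Y0 YY0] := @ultraN_rVs R d T Y (r / 2 + `|z|).
  by apply: ultraN_all => k; apply: bnd; case: (H k).
have cD l : (fun k => dotv (Y k l - y k) (Y k l - y k)) @ ultraN -->
    dotv (Y0 l - y0) (Y0 l - y0).
  by apply: cvg_dotv; apply: cvgB => //; exact: YY0.
(* Distinct limits would make the penalty grow like [k%:R * (D / 2)], although it is bounded by
   [- m]. *)
have Y0E l : Y0 l = y0.
  apply/eqP; rewrite -subr_eq0; apply/eqP/dotvv_eq0.
  have [//|D0] : dotv (Y0 l - y0) (Y0 l - y0) = 0 \/ 0 < dotv (Y0 l - y0) (Y0 l - y0).
    by have := dotvv_ge0 (Y0 l - y0); rewrite le_eqVlt eq_sym => /orP[/eqP|]; [left|right].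
  set D := dotv _ _ in D0 cD *.
  have D2 : 0 < D / 2 by rewrite divr_gt0.
  have /ultraN_ex [k [h1 h2]] : \forall k \near ultraN,
      `|D - dotv (Y k l - y k) (Y k l - y k)| < D / 2 /\ - m / (D / 2) < k%:R.
    near=> k; split; first by near: k; exact: cvgr_dist_lt (cD l) _ D2.
    by near: k; exact: ultraN_big.
  have [yk Yk bk _ _] := H k.
  have h3 : m <= \sum_l c l * (f l (Y k l) - f l z) + dotv p (y k - z) +
         (`|C| + 1) * dotv (y k - z) (y k - z).
    exact: mlb.
  have h4 : k%:R * dotv (Y k l - y k) (Y k l - y k) <= - m.
    apply: le_trans (_ : _ <= k%:R * (\sum_l dotv (Y k l - y k) (Y k l - y k))) _; last by lra.
    rewrite ler_wpM2l// (bigD1 l)//= lerDl.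
    by apply: sumr_ge0 => *; exact: dotvv_ge0.
  move: h2; rewrite ltr_pdivrMr// => h2.
  move: h1; rewrite ltr_norml => /andP[_ h1].
  have : k%:R * (D / 2) <= k%:R * dotv (Y k l - y k) (Y k l - y k).
    by rewrite ler_wpM2l//; lra.
  lra.
(* In the limit the objective is at most 0, while [zmin] and the coefficient [|C| + 1] bound it
   below by [|y0 - z| ^+ 2]. *)
have y0z : y0 = z.
  have y0r : `|y0 - z| <= r / 2.
    have c1 : (fun k => `|y k - z|) @ ultraN --> `|y0 - z|.
      by apply: cvg_norm; apply: cvgB => //; exact: cvg_cst.
    by apply: ler_cvg_to c1 (cvg_cst _) _; apply: ultraN_all => k; case: (H k).
  have yz : (fun k => y k - z) @ ultraN --> y0 - z.
    by apply: cvgB => //; exact: cvg_cst.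
  have cE : (fun k => \sum_l c l * (f l (Y k l) - f l z) + dotv p (y k - z) +
      (`|C| + 1) * dotv (y k - z) (y k - z)) @ ultraN -->
      \sum_l c l * (f l (Y0 l) - f l z) + dotv p (y0 - z) +
      (`|C| + 1) * dotv (y0 - z) (y0 - z).
    apply: cvgD; first apply: cvgD.
    + apply: cvg_bigsum => l _; apply: cvgM; first exact: cvg_cst.
      apply: cvgB; last exact: cvg_cst.
      by apply: continuous_cvg; [exact: nice_continuous|exact: YY0].
    + by apply: cvg_dotv => //; exact: cvg_cst.
    + by apply: cvgM; [exact: cvg_cst|exact: cvg_dotv].
  have le0 : \sum_l c l * (f l (Y0 l) - f l z) + dotv p (y0 - z) +
      (`|C| + 1) * dotv (y0 - z) (y0 - z) <= 0.
    apply: ler_cvg_to cE (cvg_cst _) _; apply: ultraN_all => k.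
    have [_ _ bk _ _] := H k; rewrite -oppr_ge0; apply: le_trans bk.
    by rewrite mulr_ge0// sumr_ge0// => *; exact: dotvv_ge0.
  move: le0; under eq_bigr do rewrite Y0E.
  have /zmin : `|y0 - z| < r by have := r_gt0; lra.
  have := sqr_norm_le_dotv (y0 - z); set n2 := _ ^+ 2; set D := dotv _ _.
  move=> h1 h2 h3; have n0 : 0 <= n2 by exact: sqr_ge0.
  have h4 : n2 = 0.
    by apply/eqP; rewrite eq_le n0 andbT; have := ler_norm C; have := normr_ge0 C; nra.
  by apply/eqP; rewrite -subr_eq0 -normr_eq0 -sqrf_eq0 -/n2 h4.
rewrite y0z in yy0.
have {Y0E}YYz l : (fun k => Y k l) @ ultraN --> z by rewrite -y0z -(Y0E l); exact: YY0.
have r2 : 0 < r / 2 by rewrite divr_gt0.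
have ny : \forall k \near ultraN, `|y k - z| < r / 2.
  by near=> k; rewrite distrC; near: k; exact: cvgr_dist_lt yy0 _ r2.
have key l : exists v, regular_subdiff (f l) z v /\ (fun k => W k l) @ ultraN --> c l *: v.
  have nW : \forall k \near ultraN,
      exists2 v, regular_subdiff (f l) (Y k l) v \/ c l = 0 & W k l = c l *: v.
    near=> k; have [_ _ _ HW _] := H k; apply: HW; last by near: k.
    by rewrite distrC; near: k; exact: cvgr_dist_lt (YYz l) _ r2.
  have [c0|c0] := eqVneq (c l) 0.
    have [v vz] := nice_subdiff_neq0 z (f_nice l).
    exists v; split => //; rewrite c0 scale0r; apply: cvg_near_cst.
    by apply: filterS nW => k [w _ ->]; rewrite c0 scale0r.
  have nV : \forall k \near ultraN, regular_subdiff (f l) (Y k l) ((c l)^-1 *: W k l).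
    apply: filterS nW => k [w [wk|c0' _]]; last by rewrite c0' eqxx in c0.
    by move=> ->; rewrite scalerA mulVf// scale1r.
  have [s [L [s0 L0 HL]]] := nice_bound z (f_nice l).
  have [|v _ vv] := @ultraN_rV R d (fun k => (c l)^-1 *: W k l) L.
    near=> k; apply: (HL (Y k l)); last by near: k.
    by rewrite distrC; near: k; exact: cvgr_dist_lt (YYz l) _ s0.
  exists v; split; first exact: nice_closed (f_nice l) (YYz l) vv nV.
  rewrite (_ : (fun k => W k l) = (fun k => c l *: ((c l)^-1 *: W k l))).
    by apply: cvgZ => //; exact: cvg_cst.
  by apply/funext => k; rewrite scalerA divff// scale1r.
have [v Hv] := choice key.
exists v; split; first by move=> l; case: (Hv l).
have c1 : (fun k => \sum_l W k l + p + 2 * (`|C| + 1) *: (y k - z)) @ ultraN -->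
    \sum_l c l *: v l + p + 2 * (`|C| + 1) *: (z - z).
  apply: cvgD; first apply: cvgD; last apply: cvgZ.
  - by apply: cvg_bigsum => l _; case: (Hv l).
  - exact: cvg_cst.
  - exact: cvg_cst.
  - by apply: cvgB => //; exact: cvg_cst.
rewrite subrr scaler0 addr0 in c1.
apply: (cvg_unique _ c1) => //; apply: cvg_near_cst.
near=> k; have [_ _ _ _ Hk] := H k; apply: Hk.
by near: k.
Unshelve. all: by end_near. Qed.
End multiplier_rule.

(** * Circuits of subgradients *)

Section relations.
Variables (R : realType) (d : nat) (K : finType).
Implicit Types (A : {set K}) (c : K -> R) (V : K -> 'rV[R]_d).

Definition lincomb A c V := \sum_(k in A) c k *: V k.

Definition nontriv A c := exists2 k, k \in A & c k != 0.

Definition independent A V := forall c, nontriv A c -> lincomb A c V != 0.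

Lemma lincombN A c V : lincomb A (fun k => - c k) V = - lincomb A c V.
Proof. by rewrite /lincomb -sumrN; apply: eq_bigr => k _; rewrite scaleNr. Qed.

Lemma lincombB A c c' t V :
  lincomb A (fun k => c k - t * c' k) V = lincomb A c V - t *: lincomb A c' V.
Proof.
rewrite /lincomb scaler_sumr -sumrB; apply: eq_bigr => k _.
by rewrite scalerBl scalerA.
Qed.

Lemma lincombZ A c t V : lincomb A (fun k => t * c k) V = t *: lincomb A c V.
Proof. by rewrite /lincomb scaler_sumr; apply: eq_bigr => k _; rewrite scalerA. Qed.

Lemma lincomb_sub (A B : {set K}) c V : A \subset B ->
  lincomb B (fun k => if k \in A then c k else 0) V = lincomb A c V.
Proof.
move=> AB; rewrite /lincomb (big_setID A) /= (finset.setIidPr AB) [X in _ + X]big1 ?addr0.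
  by apply: eq_bigr => k ->.
by move=> k; rewrite inE => /andP[/negPf -> _]; rewrite scale0r.
Qed.

Lemma nontrivN A c : nontriv A c -> nontriv A (fun k => - c k).
Proof. by move=> [k kA ck]; exists k => //; rewrite oppr_eq0. Qed.

Lemma nontrivP A c : nontriv A c <-> 0 < \sum_(k in A) `|c k|.
Proof.
split=> [[k kA ck]|].
  rewrite (bigD1 k)//=; apply: ltr_pwDl; first by rewrite normr_gt0.
  by apply: sumr_ge0.
move=> s0; apply: contrapT => H; move: s0; rewrite big1 ?ltxx// => k kA.
by apply/eqP; rewrite normr_eq0; apply/negP => /negP ck; apply: H; exists k.
Qed.

(** Scaled to absolute sum 1, the coefficients are bounded and their limit keeps absolute sum 1,
    hence is nontrivial. *)
Lemma relation_limit A (V : nat -> K -> 'rV[R]_d)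
    (Vl : K -> 'rV[R]_d) (c : nat -> K -> R) :
  (forall k, k \in A -> (fun n => V n k) @ ultraN --> Vl k) ->
  (\forall n \near ultraN, nontriv A (c n)) ->
  (fun n => (\sum_(k in A) `|c n k|)^-1 *: lincomb A (c n) (V n)) @ ultraN --> (0 : 'rV[R]_d) ->
  exists cl : K -> R, [/\ nontriv A cl, lincomb A cl Vl = 0 & forall k, k \in A ->
    (fun n => (\sum_(k in A) `|c n k|)^-1 * c n k) @ ultraN --> cl k].
Proof.
move=> VV nt c0; pose s n := \sum_(k in A) `|c n k|.
have sp : \forall n \near ultraN, 0 < s n by apply: filterS nt => n /nontrivP.
pose b n k := if k \in A then (s n)^-1 * c n k else 0.
have [|cl Hcl] := @ultraN_Rs R K b 1.
  apply: filterS sp => n sn k; rewrite /b; case: ifPn => kA; last by rewrite normr0.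
  rewrite normrM normfV (gtr0_norm sn) mulrC ler_pdivrMr// mul1r /s (bigD1 k)//= lerDl.
  exact: sumr_ge0.
have clk k : k \in A -> (fun n => (s n)^-1 * c n k) @ ultraN --> cl k.
  move=> kA; have := Hcl k; rewrite /b kA; exact.
exists cl; split => //.
- apply/nontrivP; suff -> : \sum_(k in A) `|cl k| = 1 by [].
  have c1 : (fun n => \sum_(k in A) `|(s n)^-1 * c n k|) @ ultraN -->
      \sum_(k in A) `|cl k|.
    by apply: cvg_bigsum => k kA; apply: cvg_norm; exact: clk.
  apply: (cvg_unique _ c1) => //; apply: cvg_near_cst.
  apply: filterS sp => n sn; rewrite -[RHS](mulVf (lt0r_neq0 sn)) {3}/s mulr_sumr.
  by apply: eq_bigr => k _; rewrite normrM normfV (gtr0_norm sn).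
- have c1 : (fun n => lincomb A (fun k => (s n)^-1 * c n k) (V n)) @ ultraN -->
      lincomb A cl Vl.
    by apply: cvg_bigsum => k kA; apply: cvgZ; [exact: clk|exact: VV].
  apply: (cvg_unique _ c1) => //.
  rewrite (_ : (fun n => _) = (fun n => (s n)^-1 *: lincomb A (c n) (V n)))//.
  by apply/funext => n; rewrite lincombZ.
Qed.

Lemma relation_limit0 A (V : nat -> K -> 'rV[R]_d)
    (Vl : K -> 'rV[R]_d) (c : nat -> K -> R) :
  (forall k, k \in A -> (fun n => V n k) @ ultraN --> Vl k) ->
  (\forall n \near ultraN, nontriv A (c n) /\ lincomb A (c n) (V n) = 0) ->
  exists cl : K -> R, [/\ nontriv A cl, lincomb A cl Vl = 0 & forall k, k \in A ->
    ((\forall n \near ultraN, 0 <= c n k) -> 0 <= cl k) /\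
    ((\forall n \near ultraN, c n k <= 0) -> cl k <= 0)].
Proof.
move=> VV H; have [|||cl [n1 n2 n3]] := @relation_limit A V Vl c => //.
- by apply: filterS H => n [].
- by apply: cvg_near_cst; apply: filterS H => n [_ ->]; rewrite scaler0.
exists cl; split => // k kA.
have sp : \forall n \near ultraN, 0 < (\sum_(k in A) `|c n k|)^-1.
  by apply: filterS H => n [/nontrivP ? _]; rewrite invr_gt0.
split => ck.
  apply: ler_cvg_to (cvg_cst _) (n3 k kA) _.
  by apply: filterS2 sp ck => n s0 c0; rewrite mulr_ge0// ltW.
apply: ler_cvg_to (n3 k kA) (cvg_cst _) _.
by apply: filterS2 sp ck => n s0 c0; rewrite mulr_ge0_le0// ltW.
Qed.

(** If the coefficients were unbounded, dividing by their size would leave a nontrivial relation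
    between the independent limits. *)
Lemma coef_limit A (V : nat -> K -> 'rV[R]_d)
    (Vl : K -> 'rV[R]_d) (c : nat -> K -> R) (C : R) :
  (forall k, k \in A -> (fun n => V n k) @ ultraN --> Vl k) ->
  independent A Vl ->
  (\forall n \near ultraN, `|lincomb A (c n) (V n)| <= C) ->
  exists cl : K -> R, forall k, k \in A -> (fun n => c n k) @ ultraN --> cl k.
Proof.
move=> VV ind bd; pose s n := \sum_(k in A) `|c n k|.
have s0 n : 0 <= s n by exact: sumr_ge0.
have [[B sB]|nB] := pselect (exists B, \forall n \near ultraN, s n <= B).
  have [|cl Hcl] := @ultraN_Rs R K (fun n k => if k \in A then c n k else 0) B.
    apply: filterS sB => n sn k; case: ifPn => kA; last by rewrite normr0 (le_trans (s0 n)).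
    by apply: le_trans sn; rewrite /s (bigD1 k)//= lerDl; exact: sumr_ge0.
  by exists cl => k kA; have := Hcl k; rewrite kA.
have {}nB B : \forall n \near ultraN, B < s n.
  have /ultraN_not : ~ ultraN [set n | s n <= B] by move=> h; apply: nB; exists B.
  by apply: filterS => n /= /negP; rewrite -ltNge.
have [|||cl [n1 n2 _]] := @relation_limit A V Vl c => //.
- by apply: filterS (nB 0) => n sn; apply/nontrivP.
- apply/cvgrPdist_lt => e e0; near=> n.
  have h1 : 0 < s n by near: n; exact: nB.
  have h2 : C / e < s n by near: n; exact: nB.
  have h3 : `|lincomb A (c n) (V n)| <= C by near: n.
  rewrite sub0r normrN normrZ normfV (gtr0_norm h1) mulrC ltr_pdivrMr//.
  by apply: le_lt_trans h3 _; rewrite mulrC -ltr_pdivrMr.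
by have := ind _ n1; rewrite n2 eqxx.
Unshelve. all: by end_near. Qed.

End relations.

Section circuits.
Variables (R : realType) (d m : nat) (T : finType).
Variables (f : T -> 'rV[R]_d -> R) (gh : 'I_m -> 'rV[R]_d -> 'rV[R]_d).
Variables (xbar : 'rV[R]_d) (I1 : {set 'I_m}).
Implicit Types (S : {set T}) (x : 'rV[R]_d) (v vl : T -> 'rV[R]_d).
Implicit Types (c : T + 'I_m -> R) (e : R).
Implicit Types (xs : nat -> 'rV[R]_d) (vs : nat -> T -> 'rV[R]_d).

(** The gradients of the basis part [I1] belong to every family; sign conditions concern the
    coefficients on [S] only. *)
Definition idx (S : {set T}) : {set (T + 'I_m)%type} :=
  [set k | match k with inl l => l \in S | inr i => i \in I1 end].

Definition vec (x : 'rV[R]_d) (v : T -> 'rV[R]_d) (k : (T + 'I_m)%type) :=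
  match k with inl l => v l | inr i => gh i x end.

Definition subgrads (S : {set T}) x (v : T -> 'rV[R]_d) :=
  forall l, l \in S -> regular_subdiff (f l) x (v l).

(** For nonempty [S], removing one index of [S] from a circuit leaves an independent family, since a
    relation with a zero on [S] is trivial. *)
Definition circuit (S : {set T}) x v :=
  (exists2 c, nontriv (idx S) c & lincomb (idx S) c (vec x v) = 0) /\
  forall c, nontriv (idx S) c -> lincomb (idx S) c (vec x v) = 0 ->
    (forall l, l \in S -> 0 < c (inl l)) \/ (forall l, l \in S -> c (inl l) < 0).

Hypothesis f_nice : forall l, nice (f l).
Hypothesis gh_cont : forall i, continuous (gh i).
Hypothesis gh_indep : independent (idx finset.set0) (vec xbar (fun=> 0)).
(** The form in which the constraint qualification enters: from a positive relation at [xbar], a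
    dependence without signs, and only at points [x != xbar]. *)
Hypothesis rc : forall S v c, S != finset.set0 -> subgrads S xbar v ->
  (forall l, l \in S -> 0 < c (inl l)) -> lincomb (idx S) c (vec xbar v) = 0 ->
  exists2 e, 0 < e & forall x (v' : T -> 'rV[R]_d), x != xbar -> `|x - xbar| < e -> subgrads S x v' ->
    (forall l, l \in S -> `|v' l - v l| < e) ->
    exists2 c', nontriv (idx S) c' & lincomb (idx S) c' (vec x v') = 0.

Lemma subset_idx S (S' : {set T}) : S' \subset S -> idx S' \subset idx S.
Proof.
by move=> /fintype.subsetP SS; apply/fintype.subsetP => -[l|i]; rewrite !inE//; exact: SS.
Qed.

Lemma cvg_vec (S : {set T}) (xs : nat -> 'rV[R]_d) vs v :
  xs @ ultraN --> xbar -> (forall l, l \in S -> (fun n => vs n l) @ ultraN --> v l) ->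
  forall k, k \in idx S -> (fun n => vec (xs n) (vs n) k) @ ultraN --> vec xbar v k.
Proof.
move=> xx vv [l|i]; rewrite inE; first exact: vv.
by move=> _; apply: continuous_cvg => //; exact: gh_cont.
Qed.

Lemma lincomb_support S (S' : {set T}) c (V : T + 'I_m -> 'rV[R]_d) : S' \subset S ->
  (forall l, l \in S -> l \notin S' -> c (inl l) = 0) ->
  lincomb (idx S') c V = lincomb (idx S) c V.
Proof.
move=> S'S c0; rewrite -(lincomb_sub _ _ (subset_idx S'S)).
apply: eq_bigr => -[l|i]; rewrite !inE /=; last by move=> ->.
by move=> lS; case: ifPn => // ln; rewrite c0.
Qed.

Lemma near_rc S v c (xs : nat -> 'rV[R]_d) vs : S != finset.set0 ->
  subgrads S xbar v -> (forall l, l \in S -> 0 < c (inl l)) ->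
  lincomb (idx S) c (vec xbar v) = 0 ->
  xs @ ultraN --> xbar -> (\forall n \near ultraN, xs n != xbar) ->
  (\forall n \near ultraN, subgrads S (xs n) (vs n)) ->
  (forall l, l \in S -> (fun n => vs n l) @ ultraN --> v l) ->
  \forall n \near ultraN, exists2 c', nontriv (idx S) c' &
    lincomb (idx S) c' (vec (xs n) (vs n)) = 0.
Proof.
move=> S0 sv cp rel xx xn sx vv; have [e e0 H] := rc S0 sv cp rel.
have vn : \forall n \near ultraN, forall l, l \in S -> `|vs n l - v l| < e.
  apply: filter_forall => l; have [lS|lS] := boolP (l \in S); last exact: ultraN_all.
  by near=> n => _; rewrite distrC; near: n; exact: cvgr_dist_lt (vv l lS) _ e0.
near=> n; apply: H; [by near: n| |by near: n|by near: n].
by rewrite distrC; near: n; exact: cvgr_dist_lt.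
Unshelve. all: by end_near. Qed.

Lemma not_nontriv_h c (v : T -> 'rV[R]_d) S : (forall l, l \in S -> c (inl l) = 0) ->
  lincomb (idx S) c (vec xbar v) = 0 -> ~ nontriv (idx S) c.
Proof.
move=> c0 rel [k kS ck].
have : nontriv (idx finset.set0) c.
  exists k => //; case: k kS ck => [l|i]; rewrite !inE // => lS.
  by rewrite c0 ?eqxx.
move=> /gh_indep /negP; apply; apply/eqP.
rewrite -[RHS]rel -(lincomb_sub _ _ (subset_idx (finset.sub0set S))).
apply: eq_bigr => -[l|i]; rewrite !inE /=; last by move=> ->.
by move=> lS; rewrite c0// !scale0r.
Qed.

(** The ratio test of linear programming: subtracting from [cl] the largest multiple of [c] that
    keeps it nonnegative on [S] creates a zero there. The difference is therefore trivial, and [cl]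
    is a positive multiple of [c]. *)
Lemma circuit_of_nonneg S v cl : nontriv (idx S) cl ->
  lincomb (idx S) cl (vec xbar v) = 0 -> (forall l, l \in S -> 0 <= cl (inl l)) ->
  (forall c, nontriv (idx S) c -> lincomb (idx S) c (vec xbar v) = 0 ->
    (forall l, l \in S -> 0 <= c (inl l)) -> forall l, l \in S -> 0 < c (inl l)) ->
  circuit S xbar v.
Proof.
move=> ntl rell sgn pos; have clp := pos _ ntl rell sgn.
split; first by exists cl.
move=> c nt rel.
have [[l0 [l0S c0]]|ncp] := pselect (exists l, l \in S /\ 0 < c (inl l)); last first.
  right => l lS; rewrite -oppr_gt0.
  apply: (pos (fun k => - c k)) => //; [exact: nontrivN|by rewrite lincombN rel oppr0|].
  move=> k kS; rewrite oppr_ge0 leNgt; apply/negP => ck; apply: ncp; by exists k.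
left; pose P := [pred l | (l \in S) && (0 < c (inl l))].
have Pl0 : P l0 by rewrite /P /= l0S c0.
case: (@Order.TotalTheory.arg_minP _ R T l0 P (fun l => cl (inl l) / c (inl l)) Pl0).
move=> l1 /andP[l1S c1] l1min.
pose t := cl (inl l1) / c (inl l1).
have t0 : 0 < t by rewrite divr_gt0// clp.
pose e k := cl k - t * c k.
have rele : lincomb (idx S) e (vec xbar v) = 0.
  by rewrite lincombB rell rel scaler0 subrr.
have [nte|nte] := pselect (nontriv (idx S) e).
  have := pos e nte rele; have ege0 : forall l, l \in S -> 0 <= e (inl l).
    move=> l lS; rewrite /e subr_ge0; have [cl0|cl0] := ltP 0 (c (inl l)).
      by rewrite -ler_pdivlMr//; apply: l1min; rewrite /P /= lS cl0.
    by apply: (@le_trans _ _ 0); [rewrite mulr_ge0_le0// ltW|exact: sgn].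
  by move=> /(_ ege0 l1 l1S); rewrite /e /t divfK ?subrr ?ltxx// gt_eqF.
move=> l lS; have : e (inl l) = 0.
  apply/eqP; apply/negP => /negP el; apply: nte; exists (inl l) => //.
  by rewrite inE.
move=> /eqP; rewrite /e subr_eq0 => /eqP E.
by have := clp l lS; rewrite E pmulr_rgt0.
Qed.

(** By the qualification, a relation at [xbar] that is nonnegative on [S], with support [S'] there,
    makes the nearby subfamily [S'] dependent. In a nearby circuit on [S] such a dependence has no
    zero on [S], so [S' = S]: minimality passes to the limit. *)
Lemma circuit_limit S (xs : nat -> 'rV[R]_d) vs v : S != finset.set0 ->
  xs @ ultraN --> xbar -> (\forall n \near ultraN, xs n != xbar) ->
  (\forall n \near ultraN, subgrads S (xs n) (vs n)) ->
  (forall l, l \in S -> (fun n => vs n l) @ ultraN --> v l) ->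
  (\forall n \near ultraN, circuit S (xs n) (vs n)) ->
  subgrads S xbar v /\ circuit S xbar v.
Proof.
move=> S0 xx xn sx vv circ.
have sv : subgrads S xbar v.
  move=> l lS; apply: nice_closed (f_nice l) xx (vv l lS) _.
  by apply: filterS sx => n; exact.
split => //.
have cV := cvg_vec xx vv.
have pos c' : nontriv (idx S) c' -> lincomb (idx S) c' (vec xbar v) = 0 ->
    (forall l, l \in S -> 0 <= c' (inl l)) -> forall l, l \in S -> 0 < c' (inl l).
  move=> nt rel ge0; pose S' := [set l in S | 0 < c' (inl l)]%SET.
  have S'S : S' \subset S by apply/fintype.subsetP => l; rewrite inE => /andP[].
  have c'0 l : l \in S -> l \notin S' -> c' (inl l) = 0.
    move=> lS; rewrite inE lS /= -leNgt => h.
    by apply/eqP; rewrite eq_le h ge0.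
  have S'0 : S' != finset.set0.
    apply/negP => /eqP S'E; apply: (not_nontriv_h _ rel) nt => l lS.
    by apply: c'0 => //; rewrite S'E inE.
  have rel' : lincomb (idx S') c' (vec xbar v) = 0.
    by rewrite (lincomb_support _ S'S c'0).
  have := @near_rc S' v c' xs vs S'0 _ _ rel' xx xn.
  move=> /(_ (fun l lS => sv l (fintype.subsetP S'S l lS))) H.
  have /H {}H : forall l, l \in S' -> 0 < c' (inl l) by move=> l; rewrite inE => /andP[].
  have /H {}H : \forall n \near ultraN, subgrads S' (xs n) (vs n).
    by apply: filterS sx => n h l /(fintype.subsetP S'S); exact: h.
  have {}H := H (fun l lS => vv l (fintype.subsetP S'S l lS)).
  have [n [[_ cn] [c2 [k kS' ck] rel2]]] := ultraN_ex (filterI circ H).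
  pose c3 k := if k \in idx S' then c2 k else 0.
  have : nontriv (idx S) c3.
    by exists k; [exact: (fintype.subsetP (subset_idx S'S))|rewrite /c3 kS'].
  move=> /cn; rewrite (lincomb_sub _ _ (subset_idx S'S)) => /(_ rel2) H3.
  move=> l lS; have : l \in S'.
    case: H3 => /(_ l lS); rewrite /c3 inE; case: ifP => //; by rewrite ltxx.
  by rewrite inE => /andP[].
have [cl [ntl rell sgn]] : exists cl, [/\ nontriv (idx S) cl,
    lincomb (idx S) cl (vec xbar v) = 0 & forall l, l \in S -> 0 <= cl (inl l)].
  have /ultraN_choice [c Hc] : \forall n \near ultraN, exists c : T + 'I_m -> R,
     [/\ nontriv (idx S) c, lincomb (idx S) c (vec (xs n) (vs n)) = 0 &
         forall l, l \in S -> 0 <= c (inl l)].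
    apply: filterS circ => n [[c nt rel] sg].
    have [cp|cn] := sg c nt rel; first by exists c; split => // l /cp /ltW.
    exists (fun k => - c k); split; first exact: nontrivN.
      by rewrite lincombN rel oppr0.
    by move=> l /cn lc; rewrite oppr_ge0 ltW.
  have [|cl [n1 n2 n3]] := @relation_limit0 R d _ (idx S) _ _ c cV.
    by apply: filterS Hc => n [].
  exists cl; split => // l lS.
  have [|h _] := n3 (inl l); first by rewrite inE.
  by apply: h; apply: filterS Hc => n [_ _]; exact.
by apply: (@circuit_of_nonneg S v cl) => //; exact: pos.
Qed.

(** The qualification gives the relation. Relations of mixed or vanishing sign would converge, after
    normalization, to a nontrivial one with [cl (inl l1) <= 0 <= cl (inl l2)], which the circuit at
    [xbar] excludes. *)
Lemma circuit_open S (xs : nat -> 'rV[R]_d) vs v : S != finset.set0 ->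
  subgrads S xbar v -> circuit S xbar v ->
  xs @ ultraN --> xbar -> (\forall n \near ultraN, xs n != xbar) ->
  (\forall n \near ultraN, subgrads S (xs n) (vs n)) ->
  (forall l, l \in S -> (fun n => vs n l) @ ultraN --> v l) ->
  \forall n \near ultraN, circuit S (xs n) (vs n).
Proof.
move=> S0 sv [[c nt rel] sg] xx xn sx vv; have cV := cvg_vec xx vv.
have [c2 [c2p rel2]] : exists c2 : T + 'I_m -> R, (forall l, l \in S -> 0 < c2 (inl l)) /\
    lincomb (idx S) c2 (vec xbar v) = 0.
  have [cp|cn] := sg c nt rel; first by exists c.
  exists (fun k => - c k); split; last by rewrite lincombN rel oppr0.
  by move=> l /cn; rewrite oppr_gt0.
have ex := near_rc S0 sv c2p rel2 xx xn sx vv.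
suff H : \forall n \near ultraN, forall c,
    nontriv (idx S) c -> lincomb (idx S) c (vec (xs n) (vs n)) = 0 ->
    (forall l, l \in S -> 0 < c (inl l)) \/ (forall l, l \in S -> c (inl l) < 0).
  by apply: filterS2 ex H => n h1 h2; split.
apply: contrapT => /ultraN_not nH.
have /ultraN_choice [c' Hc'] : \forall n \near ultraN, exists c : T + 'I_m -> R,
    [/\ nontriv (idx S) c, lincomb (idx S) c (vec (xs n) (vs n)) = 0 &
      exists q : T * T,
        [&& q.1 \in S, q.2 \in S, c (inl q.1) <= 0 & 0 <= c (inl q.2)]].
  apply: filterS nH => n /existsNP [c' /not_implyP [ntc /not_implyP [relc /not_orP []]]].
  move=> /existsNP [l1 /not_implyP [l1S /negP c1]] /existsNP [l2 /not_implyP [l2S /negP c2']].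
  exists c'; split => //; exists (l1, l2); rewrite l1S l2S /=.
  by move: c1 c2'; rewrite -!leNgt => -> ->.
have [|[l1 l2] Hq] := @ultraN_fin (T * T)%type (fun n q =>
    [&& q.1 \in S, q.2 \in S, c' n (inl q.1) <= 0 & 0 <= c' n (inl q.2)]).
  by apply: filterS Hc' => n [].
have [_ /and4P[/= l1S l2S _ _]] := ultraN_ex Hq.
have [|cl [n1 n2 n3]] := @relation_limit0 R d _ (idx S) _ _ c' cV.
  by apply: filterS Hc' => n [].
have k1 : inl l1 \in idx S by rewrite inE.
have k2 : inl l2 \in idx S by rewrite inE.
have [_ h1] := n3 _ k1; have [h2 _] := n3 _ k2.
have {}h1 : cl (inl l1) <= 0 by apply: h1; apply: filterS Hq => n /and4P[].
have {}h2 : 0 <= cl (inl l2) by apply: h2; apply: filterS Hq => n /and4P[].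
have [/(_ l1 l1S)|/(_ l2 l2S)] := sg cl n1 n2; first by rewrite ltNge h1.
by rewrite ltNge h2.
Qed.

(** The points [x] and [x'] need not be close relative to each other: the two sequences of a
    counterexample tend to [xbar] with the same limiting subgradients. These form a circuit by
    [circuit_limit], and [circuit_open] carries it to [x']. *)
Lemma circuit_uniform S : S != finset.set0 ->
  exists2 e, 0 < e & forall x (x' : 'rV[R]_d) v (v' : T -> 'rV[R]_d), x != xbar -> x' != xbar ->
    `|x - xbar| < e -> `|x' - xbar| < e -> subgrads S x v -> subgrads S x' v' ->
    (forall l, l \in S -> `|v' l - v l| < e) -> circuit S x v -> circuit S x' v'.
Proof.
move=> S0; apply: contrapT => H.
have {}H : forall n : nat, exists q : ('rV[R]_d * 'rV[R]_d) * ((T -> 'rV[R]_d) * (T -> 'rV[R]_d)),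
    [/\ [/\ q.1.1 != xbar, q.1.2 != xbar, `|q.1.1 - xbar| < n.+1%:R^-1 &
         `|q.1.2 - xbar| < n.+1%:R^-1],
        subgrads S q.1.1 q.2.1, subgrads S q.1.2 q.2.2,
        (forall l, l \in S -> `|q.2.2 l - q.2.1 l| < n.+1%:R^-1) &
        circuit S q.1.1 q.2.1 /\ ~ circuit S q.1.2 q.2.2].
  move=> n; apply: contrapT => nq; apply: H; exists n.+1%:R^-1; first by rewrite invr_gt0.
  move=> x x' v v' h1 h2 h3 h4 h5 h6 h7 h8; apply: contrapT => h9.
  by apply: nq; exists ((x, x'), (v, v')).
have [q Hq] := choice H.
pose x n := (q n).1.1; pose x' n := (q n).1.2; pose v n := (q n).2.1; pose v' n := (q n).2.2.
have xx : x @ ultraN --> xbar.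
  apply/cvgrPdist_lt => e e0; near=> n; have [[_ _ h _] _ _ _ _] := Hq n.
  by rewrite distrC; apply: lt_trans h _; near: n; exact: ultraN_inv.
have xx' : x' @ ultraN --> xbar.
  apply/cvgrPdist_lt => e e0; near=> n; have [[_ _ _ h] _ _ _ _] := Hq n.
  by rewrite distrC; apply: lt_trans h _; near: n; exact: ultraN_inv.
have lim l : exists w : 'rV[R]_d, l \in S ->
    (fun n => v n l) @ ultraN --> w /\ (fun n => v' n l) @ ultraN --> w.
  have [lS|lS] := boolP (l \in S); last by exists 0.
  have [r [L [r0 L0 HL]]] := nice_bound xbar (f_nice l).
  have [|w _ vw] := @ultraN_rV R d (fun n => v n l) L.
    near=> n; apply: (HL (x n)); last by have [_ h _ _ _] := Hq n; exact: h.
    by rewrite distrC; near: n; exact: cvgr_dist_lt xx _ r0.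
  exists w => _; split => //.
  rewrite (_ : (fun n => v' n l) = (fun n => (v' n l - v n l) + v n l)); last first.
    by apply/funext => n; rewrite subrK.
  rewrite -[w]add0r; apply: cvgD => //.
  apply/cvgrPdist_lt => e e0; near=> n; have [_ _ _ /(_ l lS) h _] := Hq n.
  by rewrite sub0r normrN; apply: lt_trans h _; near: n; exact: ultraN_inv.
have [w Hw] := choice lim.
have [||||||sw cw] := @circuit_limit S x v w => //.
- by apply: ultraN_all => n; case: (Hq n) => -[].
- by apply: ultraN_all => n; case: (Hq n).
- by move=> l lS; case: (Hw l lS).
- by apply: ultraN_all => n; case: (Hq n) => _ _ _ _ [].
have : \forall n \near ultraN, circuit S (x' n) (v' n).
  apply: circuit_open S0 sw cw xx' _ _ _.
  - by apply: ultraN_all => n; case: (Hq n) => -[].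
  - by apply: ultraN_all => n; case: (Hq n).
  - by move=> l lS; case: (Hw l lS).
move=> /ultraN_ex [n nc].
by case: (Hq n) => _ _ _ _ [_]; apply.
Unshelve. all: by end_near. Qed.

End circuits.

(** * Convexity, semicontinuity and extremal slopes of subdifferentials *)

Section subdiff_sets.
Variables (R : realType) (d : nat).
Implicit Types (f : 'rV[R]_d -> R) (x u v w : 'rV[R]_d) (t : R).

Lemma regular_subdiff_convex f x v w t : 0 <= t <= 1 ->
  regular_subdiff f x v -> regular_subdiff f x w ->
  regular_subdiff f x (v + t *: (w - v)).
Proof.
move=> /andP[t0 t1] /regular_subdiffP Hv /regular_subdiffP Hw.
apply/regular_subdiffP => e e0.
have [r1 r10 H1] := Hv e e0; have [r2 r20 H2] := Hw e e0.
exists (Num.min r1 r2); first by rewrite lt_min r10.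
move=> y; rewrite lt_min => /andP[/H1 h1 /H2 h2].
by rewrite dotvDl dotvZl dotvBl; nra.
Qed.

(** Otherwise nearby subgradients that keep distance [e] from the subdifferential at [x] would,
    being bounded, converge to one of its members. *)
Lemma regular_subdiff_usc f x e : nice f -> 0 < e ->
  \forall y \near x, forall v, regular_subdiff f y v ->
    exists2 w, regular_subdiff f x w & `|v - w| < e.
Proof.
move=> nf e0; apply: contrapT => H.
have {}H : forall n : nat, exists q : 'rV[R]_d * 'rV[R]_d,
    [/\ `|q.1 - x| < n.+1%:R^-1, regular_subdiff f q.1 q.2 &
     forall w, regular_subdiff f x w -> e <= `|q.2 - w|].
  move=> n; apply: contrapT => nq; apply: H; apply/near_rVP.
  exists n.+1%:R^-1; first by rewrite invr_gt0.
  move=> y yr v vy; apply: contrapT => nw; apply: nq; exists (y, v); split => // w wx.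
  by rewrite leNgt; apply/negP => vw; apply: nw; exists w.
have [q Hq] := choice H.
have qx : (fst \o q) @ ultraN --> x.
  apply/cvgrPdist_lt => r r0; near=> n; have [h _ _] := Hq n.
  by rewrite distrC; apply: lt_trans h _; near: n; exact: ultraN_inv.
have [r [L [r0 L0 HL]]] := nice_bound x nf.
have [|v _ qv] := @ultraN_rV R d (snd \o q) L.
  near=> n; apply: (HL (q n).1); last by have [_ h _] := Hq n.
  by rewrite distrC; near: n; exact: cvgr_dist_lt qx _ r0.
have vx : regular_subdiff f x v.
  by apply: nice_closed nf qx qv _; apply: ultraN_all => n; case: (Hq n).
have /ultraN_ex [n] : \forall n \near ultraN, `|v - (snd \o q) n| < e.
  exact: cvgr_dist_lt qv _ e0.
by have [_ _ /(_ v vx)] := Hq n; rewrite distrC /= leNgt => /negP.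
Unshelve. all: by end_near. Qed.

Lemma regular_subdiff_argmax f x u : nice f -> exists2 w, regular_subdiff f x w &
  forall v, regular_subdiff f x v -> dotv v u <= dotv w u.
Proof.
move=> nf; have [|||w wx wmin] := @ultraN_min R _ (regular_subdiff f x)
  (fun a l => a @ ultraN --> l) (fun w => - dotv w u).
- by have [v vx] := nice_subdiff_neq0 x nf; exists v.
- move=> Y HY; have [r [L [r0 L0 HL]]] := nice_bound x nf.
  have [|v _ Yv] := @ultraN_rV R d Y L.
    by apply: ultraN_all => n; apply: (HL x) => //; rewrite subrr normr0.
  exists v => //; apply: nice_closed nf (cvg_cst x) Yv _; exact: ultraN_all.
- move=> Y w _ Yw; apply: cvgN; apply: cvg_dotv => //; exact: cvg_cst.
by exists w => // v vx; rewrite -lerN2; exact: wmin.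
Qed.

Lemma exists_orthogonal (a : 'rV[R]_d) : (1 < d)%N -> exists2 q : 'rV[R]_d, q != 0 & dotv q a = 0.
Proof.
move=> d1; pose i0 := Ordinal (ltnW d1); pose i1 := Ordinal d1.
have i01 : i1 != i0 by [].
have dj (j : 'I_d) s (b : 'rV[R]_d) : dotv (s *: delta_mx 0 j) b = s * b 0 j.
  rewrite dotvZl /dotv (bigD1 j)//= mxE !eqxx mul1r big1 ?addr0// => i ij.
  by rewrite mxE (negPf ij) andbF mul0r.
have [a0|a0] := eqVneq (a 0 i0) 0.
  exists (1 *: delta_mx 0 i0); last by rewrite dj a0 mulr0.
  apply/eqP => /rowP /(_ i0); rewrite !mxE !eqxx mulr1 => /eqP; by rewrite oner_eq0.
exists (a 0 i1 *: delta_mx 0 i0 - a 0 i0 *: delta_mx 0 i1).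
  apply/eqP => /rowP /(_ i1); rewrite !mxE !eqxx (negPf i01) mulr0 add0r mulr1 => /eqP.
  by rewrite oppr_eq0 (negPf a0).
by rewrite dotvBl !dj mulrC subrr.
Qed.

End subdiff_sets.

(** * Propagation of circuits around the reference point *)

Section propagation.
Variables (R : realType) (d m : nat) (T : finType).
Variables (f : T -> 'rV[R]_d -> R) (gh : 'I_m -> 'rV[R]_d -> 'rV[R]_d).
Variables (xbar : 'rV[R]_d) (I1 : {set 'I_m}).
Implicit Types (S : {set T}) (x u : 'rV[R]_d) (v vl : T -> 'rV[R]_d).
Implicit Types (c : T + 'I_m -> R) (e : R).
Hypothesis f_nice : forall l, nice (f l).
Hypothesis gh_cont : forall i, continuous (gh i).
Hypothesis gh_indep : independent (idx (T := T) I1 finset.set0) (vec gh xbar (fun=> 0)).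

Notation idx := (idx I1).
Notation vec := (vec gh).
Notation subgrads := (subgrads f).
Notation circuit := (circuit gh I1).

Hypothesis rc : forall S v c, S != finset.set0 -> subgrads S xbar v ->
  (forall l, l \in S -> 0 < c (inl l)) -> lincomb (idx S) c (vec xbar v) = 0 ->
  exists2 e, 0 < e & forall x (v' : T -> 'rV[R]_d), x != xbar -> `|x - xbar| < e -> subgrads S x v' ->
    (forall l, l \in S -> `|v' l - v l| < e) ->
    exists2 c', nontriv (idx S) c' & lincomb (idx S) c' (vec x v') = 0.

Variable S : {set T}.
Hypothesis S0 : S != finset.set0.

Definition has_circuit x := exists2 v, subgrads S x v & circuit S x v.

Definition punctured e x := x != xbar /\ `|x - xbar| < e.

(** The subdifferentials are convex, so [v] and [v'] are joined by [N.+1] equal steps of size less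
    than [e], each covered by uniform stability. *)
Lemma circuit_all x v v' e :
  (forall x (x' : 'rV[R]_d) v (v' : T -> 'rV[R]_d), x != xbar -> x' != xbar ->
    `|x - xbar| < e -> `|x' - xbar| < e -> subgrads S x v -> subgrads S x' v' ->
    (forall l, l \in S -> `|v' l - v l| < e) -> circuit S x v -> circuit S x' v') ->
  0 < e -> punctured e x ->
  subgrads S x v -> circuit S x v -> subgrads S x v' -> circuit S x v'.
Proof.
move=> He e0 [xn xe] sv cv sv'.
pose D := \sum_l `|v' l - v l|.
have D0 : 0 <= D by exact: sumr_ge0.
have [N ND] : exists N : nat, D / e < N.+1%:R.
  by have [N h] := ultraN_ex (ultraN_big (D / e)); exists N; apply: lt_trans h _; rewrite ltr_nat.
pose w (i : nat) l := v l + (i%:R / N.+1%:R) *: (v' l - v l).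
have N0 : (0 : R) < N.+1%:R by [].
have sw i : (i <= N.+1)%N -> subgrads S x (w i).
  move=> iN l lS; apply: regular_subdiff_convex; [|exact: sv|exact: sv'].
  by rewrite divr_ge0// ler_pdivrMr// mul1r ler_nat.
have cw i : (i <= N.+1)%N -> circuit S x (w i).
  elim: i => [_|i IH iN].
    suff -> : w 0 = v by [].
    by apply/funext => l; rewrite /w mul0r scale0r addr0.
  apply: (He x x (w i)) => //; [exact/sw/ltnW|exact: sw| |exact/IH/ltnW].
  move=> l lS; rewrite /w opprD addrACA subrr add0r -scalerBl -mulrBl -natrB// subSnn.
  rewrite normrZ ger0_norm ?divr_ge0// mul1r mulrC ltr_pdivrMr// -ltr_pdivrMl// mulrC.
  apply: le_lt_trans ND; rewrite ler_pM2r ?invr_gt0// /D (bigD1 l)//= lerDl.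
  exact: sumr_ge0.
have := cw N.+1 (leqnn _); suff -> : w N.+1 = v' by [].
by apply/funext => l; rewrite /w divff ?gt_eqF// scale1r addrC subrK.
Qed.

(** By outer semicontinuity at [x], subgradients at a nearby [y] are within [e] of subgradients at
    [x]. This settles both directions, since at each point one circuit makes every choice a
    circuit. *)
Lemma circuit_locally : exists2 e, 0 < e &
  (forall x v v', punctured e x -> subgrads S x v -> circuit S x v ->
     subgrads S x v' -> circuit S x v') /\
  forall x, punctured e x -> exists2 r, 0 < r & forall y, punctured e y ->
    `|y - x| < r -> has_circuit x <-> has_circuit y.
Proof.
have [e e0 He] := circuit_uniform f_nice gh_cont gh_indep rc S0.
exists e => //; have all := circuit_all He e0.
split => [x v v'|x [xn xe]]; first exact: all.
have /near_rVP [r r0 Hr] : \forall y \near x, forall l (a : 'rV[R]_d),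
    regular_subdiff (f l) y a -> exists2 b, regular_subdiff (f l) x b & `|a - b| < e.
  by apply: (@filter_forall _ _ _ (nbhs x)) => l; exact: regular_subdiff_usc.
exists r => // y [yn ye] /Hr {}Hr.
have [v' sv'] : exists v', subgrads S y v'.
  have /choice [v' sv'] := fun l => nice_subdiff_neq0 y (f_nice l).
  by exists v' => l _.
have /choice [w Hw] : forall l, exists b : 'rV[R]_d,
    l \in S -> regular_subdiff (f l) x b /\ `|v' l - b| < e.
  move=> l; have [lS|lS] := boolP (l \in S); last by exists 0.
  by have [w wx vw] := Hr l _ (sv' l lS); exists w.
have sw : subgrads S x w by move=> l /Hw [].
have wv l : l \in S -> `|v' l - w l| < e by move=> /Hw [].
split=> -[u su cu].
  exists v' => //; apply: (He x y w v') => //.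
  exact: all cu sw.
exists w => //; apply: (He y x v' w) => //.
  by move=> l lS; rewrite distrC; exact: wv.
exact: all cu sv'.
Qed.

(** Connectedness of a segment, through the supremum of the parameters whose point has a circuit:
    local constancy puts it in the set and lets it not stay below 1. *)
Lemma has_circuit_segment e x y : 
  (forall x, punctured e x -> exists2 r, 0 < r & forall y, punctured e y ->
    `|y - x| < r -> has_circuit x <-> has_circuit y) ->
  (forall t : R, 0 <= t <= 1 -> punctured e (x + t *: (y - x))) ->
  has_circuit x -> has_circuit y.
Proof.
move=> loc seg Px; pose p (t : R) := x + t *: (y - x).
pose A := [set t : R | 0 <= t <= 1 /\ has_circuit (p t)].
have A0 : A 0 by rewrite /A /= lexx ler01 /p scale0r addr0.
have Aub : ubound A 1 by move=> t [/andP[]].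
have hA : has_sup A by split; [exists 0|exists 1].
pose s := sup A.
have s01 : 0 <= s <= 1.
  by apply/andP; split; [apply: ub_le_sup => //; exists 1|apply: ge_sup => //; exists 0].
have [r r0 Hr] := loc _ (seg s s01).
pose k := r / (`|y - x| + 1).
have n1 : 0 < `|y - x| + 1 by rewrite ltr_wpDl.
have k0 : 0 < k by rewrite divr_gt0.
have near_s t : 0 <= t <= 1 -> `|t - s| < k -> has_circuit (p s) <-> has_circuit (p t).
  move=> t01 ts; apply: Hr; first exact: seg.
  rewrite /p opprD addrACA subrr add0r -scalerBl normrZ.
  move: ts; rewrite ltr_pdivlMr// => ts; apply: le_lt_trans ts.
  by rewrite ler_wpM2l// lerDl.
have Ps : has_circuit (p s).
  have [t [t01 Pt] st] := sup_adherent k0 hA.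
  have ts : t <= s by apply: ub_le_sup => //; exists 1.
  apply/(near_s t) => //; rewrite ler0_norm ?subr_le0//.
  by rewrite -/s in st; lra.
have [s1|s1] := ltP s 1; last first.
  have sE : s = 1 by apply/eqP; rewrite eq_le s1; case/andP: s01 => _ ->.
  by move: Ps; rewrite sE /p scale1r addrC subrK.
case/andP: s01 => s0 _.
pose t := Num.min 1 (s + k / 2).
have st : s < t by rewrite lt_min s1 ltrDl divr_gt0.
have t01 : 0 <= t <= 1 by rewrite (ltW (le_lt_trans s0 st)) ge_min lexx.
have : t <= s.
  apply: ub_le_sup; first by exists 1.
  split => //; apply/(near_s t) => //.
  rewrite gtr0_norm ?subr_gt0//.
  have : t <= s + k / 2 by rewrite ge_min lexx orbT.
  by lra.
by rewrite leNgt st.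
Qed.

(** Since the segment from [x] to [y] may meet [xbar], it is replaced by a detour through [q + xbar]
    with [q] orthogonal to [x - xbar]. The product with [x - xbar] shows that both legs avoid
    [xbar]; it also covers the direct segment when [y - xbar] is orthogonal too. *)
Lemma has_circuit_everywhere e x y : (1 < d)%N -> 0 < e ->
  (forall x, punctured e x -> exists2 r, 0 < r & forall y, punctured e y ->
    `|y - x| < r -> has_circuit x <-> has_circuit y) ->
  punctured e x -> punctured e y -> has_circuit x -> has_circuit y.
Proof.
move=> d1 e0 loc [xn xe] [yn ye].
have seg (a b : 'rV[R]_d) t : `|a - xbar| < e -> `|b - xbar| < e -> 0 <= t <= 1 ->
    `|a + t *: (b - a) - xbar| < e.
  move=> ae be /andP[t0 t1].
  have -> : a + t *: (b - a) - xbar = (1 - t) *: (a - xbar) + t *: (b - xbar).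
    by apply/rowP => i; rewrite !mxE; ring.
  apply: le_lt_trans (ler_normD _ _) _; rewrite !normrZ (ger0_norm t0) ger0_norm ?subr_ge0//.
  pose M := Num.max `|a - xbar| `|b - xbar|.
  have Me : M < e by rewrite gt_max ae be.
  have h1 : (1 - t) * `|a - xbar| <= (1 - t) * M.
    by rewrite ler_wpM2l ?subr_ge0// le_max lexx.
  have h2 : t * `|b - xbar| <= t * M by rewrite ler_wpM2l// le_max lexx orbT.
  by lra.
have [q0 q0n qa] := exists_orthogonal (x - xbar) d1.
have [q qn [qe qx]] : exists2 q : 'rV[R]_d, q != 0 & `|q| < e /\ dotv q (x - xbar) = 0.
  exists ((e / (2 * `|q0|)) *: q0); last split.
  - by rewrite scaler_eq0 negb_or q0n andbT mulf_neq0 ?gt_eqF// invr_gt0 mulr_gt0 ?normr_gt0.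
  - have q00 : 0 < `|q0| by rewrite normr_gt0.
    rewrite normrZ ger0_norm ?divr_ge0// ?(ltW e0) ?mulr_ge0//.
    by rewrite invfM mulrA mulfVK ?gt_eqF//; lra.
  - by rewrite dotvZl qa mulr0.
have a2 : 0 < dotv (x - xbar) (x - xbar).
  rewrite lt_neqAle dotvv_ge0 andbT eq_sym; apply/eqP => /dotvv_eq0 /eqP.
  by rewrite subr_eq0 (negPf xn).
have aff (a b : 'rV[R]_d) t : a + t *: (b - a) - xbar = (1 - t) *: (a - xbar) + t *: (b - xbar).
  by apply/rowP => i; rewrite !mxE; ring.
have [b0|b0] := eqVneq (dotv (y - xbar) (x - xbar)) 0.
  apply: (has_circuit_segment loc) => t t01; split; last exact: seg.
  rewrite -subr_eq0 aff; apply/eqP => E.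
  move: (E) => /(congr1 (fun z => dotv z (x - xbar))).
  rewrite dotvDl !dotvZl b0 mulr0 addr0 dotv0l => /eqP; rewrite mulf_eq0 (gt_eqF a2) orbF.
  move=> t1; move: E; rewrite (eqP t1) scale0r add0r.
  move: t1; rewrite subr_eq0 => /eqP <-; rewrite scale1r => /eqP.
  by rewrite subr_eq0 (negPf yn).
have qe' : `|q + xbar - xbar| < e by rewrite addrK.
have qn' : q + xbar != xbar by rewrite -subr_eq0 addrK.
move=> Px; have Pq : has_circuit (q + xbar).
  apply: (has_circuit_segment loc) Px => t t01; split; last exact: seg.
  rewrite -subr_eq0 aff addrK; apply/eqP => E.
  move: (E) => /(congr1 (fun z => dotv z (x - xbar))).
  rewrite dotvDl !dotvZl qx mulr0 addr0 dotv0l => /eqP; rewrite mulf_eq0 (gt_eqF a2) orbF.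
  move=> t1; move: E; rewrite (eqP t1) scale0r add0r.
  by move: t1; rewrite subr_eq0 => /eqP <-; rewrite scale1r => /eqP; rewrite (negPf qn).
apply: (has_circuit_segment loc) Pq => t t01; split; last exact: seg.
rewrite -subr_eq0 aff addrK; apply/eqP => E.
move: (E) => /(congr1 (fun z => dotv z (x - xbar))).
rewrite dotvDl !dotvZl qx mulr0 add0r dotv0l => /eqP; rewrite mulf_eq0 (negPf b0) orbF.
move=> /eqP t0; move: E; rewrite t0 scale0r addr0 subr0 scale1r => /eqP.
by rewrite (negPf qn).
Qed.

Section circuits_everywhere.
Variable e : R.
Hypothesis e_gt0 : 0 < e.
Hypothesis all_circuit : forall x v, punctured e x -> subgrads S x v -> circuit S x v.

(** Circuits are known off [xbar] only, so the mean value inequality starts from [xbar + t *: u].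
    The multiplier rule then splits the proximal subgradient of the sum into subgradients of the
    [f l]. *)
Lemma sum_approx_slope (u : 'rV[R]_d) (w : T -> 'rV[R]_d) (s : R) : u != 0 -> 0 < s < 1 ->
  exists (y : 'rV[R]_d) v, [/\ y != xbar, `|y - xbar| <= 2 * s * `|u|,
    forall l, regular_subdiff (f l) y (v l) &
    \sum_(l in S) f l (xbar + s *: u) - \sum_(l in S) f l xbar - 2 * s ^+ 2 <=
    s * dotv (\sum_(l in S) v l) u + s ^+ 2 * `|dotv (\sum_(l in S) v l) u|].
Proof.
move=> u0 /andP[s0 s1].
pose F x := \sum_(l in S) f l x.
have cF : continuous F.
  move=> x; apply: (@cvg_bigsum _ _ _ _ (nbhs x)) => l _; exact: nice_continuous.
have n0 : 0 < `|u| by rewrite normr_gt0.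
have s2 : 0 < s ^+ 2 by rewrite exprn_gt0.
have /near_rVP [r r0 Hr] : \forall x \near xbar, `|F xbar - F x| < s ^+ 2.
  exact: (@cvgr_dist_lt _ _ _ (nbhs xbar) _ F _ (cF xbar) _ s2).
(* This start costs at most [s ^+ 2] both in the value of [F] and in the parameter, which is
   negligible against [s]; the tolerance [t * |u| / 2] keeps [y] off [xbar]. *)
pose t := Num.min (s ^+ 2) (r / (`|u| + 1)).
have t0 : 0 < t by rewrite lt_min s2 divr_gt0// ltr_wpDl.
have ts : t <= s ^+ 2 by rewrite ge_min lexx.
have tr : t * `|u| < r.
  have : t <= r / (`|u| + 1) by rewrite ge_min lexx orbT.
  by rewrite ler_pdivlMr ?ltr_wpDl//; lra.
have s2s : s ^+ 2 < s by rewrite expr2; nra.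
have e20 : 0 < t * `|u| / 2 by rewrite divr_gt0// mulr_gt0.
have [k [y [q [/andP[k0 k1] yk qF qs]]]] :=
  approx_mean_value (xbar + t *: u) (xbar + s *: u) cF s2 e20.
have ba : xbar + s *: u - (xbar + t *: u) = (s - t) *: u.
  by rewrite opprD addrACA subrr add0r -scalerBl.
rewrite ba in yk qs.
have ye : y - (xbar + t *: u + k *: ((s - t) *: u)) =
          y - xbar - (t + k * (s - t)) *: u.
  by apply/rowP => i; rewrite !mxE; ring.
rewrite ye in yk.
have tk : t <= t + k * (s - t) <= s.
  by apply/andP; split; nra.
have nk : `|(t + k * (s - t)) *: u| = (t + k * (s - t)) * `|u|.
  by rewrite normrZ ger0_norm//; lra.
case/andP: tk => tk1 tk2.
have tk3 : t * `|u| <= (t + k * (s - t)) * `|u| by rewrite ler_wpM2r.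
have tk4 : (t + k * (s - t)) * `|u| <= s * `|u| by rewrite ler_wpM2r.
have ylow : 0 < `|y - xbar|.
  have := lerB_dist ((t + k * (s - t)) *: u) (y - xbar).
  by rewrite distrC nk; lra.
have [C [r' [r'0 HC]]] := qF.
have [|||v [Hv vq]] := @multiplier_rule R d T f (fun l => (l \in S)%:R) (- q) y C r' f_nice.
- by [].
- exact: r'0.
- move=> x /HC; rewrite dotvNl /F.
  have -> : \sum_l (l \in S)%:R * (f l x - f l y) = F x - F y.
    rewrite /F -sumrB [RHS]big_mkcond; apply: eq_bigr => l _.
    by case: (l \in S); rewrite ?mul1r ?mul0r.
  by rewrite /F; lra.
have {}vq : \sum_(l in S) v l = q.
  apply/eqP; rewrite -subr_eq0 -[X in _ == X]vq; apply/eqP; congr (_ - _).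
  rewrite big_mkcond; apply: eq_bigr => l _.
  by case: (l \in S); rewrite ?scale1r ?scale0r.
exists y, v; split => //.
- by rewrite -subr_eq0 -normr_gt0.
- have := ler_normD (y - xbar - (t + k * (s - t)) *: u) ((t + k * (s - t)) *: u).
  rewrite subrK nk; have : t * `|u| <= s * `|u| by rewrite ler_wpM2r//; lra.
  lra.
- rewrite vq; move: qs; rewrite dotvZr -/(F _) => qs.
  have := Hr (xbar + t *: u); rewrite addrAC subrr add0r normrZ gtr0_norm// => /(_ tr).
  rewrite ltr_norml => /andP[h1 h2].
  have h3 : - (t * dotv q u) <= s ^+ 2 * `|dotv q u|.
    apply: (@le_trans _ _ (t * `|dotv q u|)); last by rewrite ler_wpM2r.
    by rewrite -mulrN ler_wpM2l ?(ltW t0)// -normrN ler_norm.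
  by rewrite -/(F xbar); lra.
Qed.

(** The sum of the [f l] grows along [u] at least at the rate of the sum of the largest slopes, and
    mean value subgradients at [y n != xbar] reach this rate in the limit. No single limit exceeds
    its own largest slope, so all are largest at once; they form a circuit as a limit of
    circuits. *)
Lemma circuit_of_max_slope (u : 'rV[R]_d) : u != 0 ->
  exists v, [/\ subgrads S xbar v, circuit S xbar v &
    forall l, l \in S -> forall w, regular_subdiff (f l) xbar w -> dotv w u <= dotv (v l) u].
Proof.
move=> u0.
have /choice [w Hw] : forall l, exists w, regular_subdiff (f l) xbar w /\
    forall a : 'rV[R]_d, regular_subdiff (f l) xbar a -> dotv a u <= dotv w u.
  by move=> l; have [w h1 h2] := regular_subdiff_argmax xbar u (f_nice l); exists w.
pose s (n : nat) : R := n.+2%:R^-1.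
have s01 n : 0 < s n < 1 by rewrite invr_gt0 ltr0n /= invf_lt1 ?ltr1n.
have sr r : 0 < r -> \forall n \near ultraN, s n < r.
  move=> r0; near=> n.
  apply: (@lt_trans _ _ (n.+1%:R^-1)); first by rewrite ltf_pV2 ?posrE// ltr_nat.
  by near: n; exact: ultraN_inv.
have cs : s @ ultraN --> (0 : R).
  apply/cvgrPdist_lt => r r0; near=> n.
  have /andP[h _] := s01 n; rewrite sub0r normrN gtr0_norm//.
  by near: n; exact: sr.
have /choice [y /choice [v Hyv]] := fun n => sum_approx_slope w u0 (s01 n).
have yx : y @ ultraN --> xbar.
  apply/cvgrPdist_lt => r r0; near=> n; have [_ h _ _] := Hyv n.
  rewrite distrC; apply: le_lt_trans h _.
  have : s n < r / (2 * `|u|).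
    near: n; apply: sr; by rewrite divr_gt0// mulr_gt0// normr_gt0.
  by rewrite ltr_pdivlMr ?mulr_gt0 ?normr_gt0// => h2; lra.
have /choice [vl Hvl] : forall l, exists v0 : 'rV[R]_d, (fun n => v n l) @ ultraN --> v0.
  move=> l; have [r [L [r0 L0 HL]]] := nice_bound xbar (f_nice l).
  have [|v0 _ h] := @ultraN_rV R d (fun n => v n l) L; last by exists v0.
  near=> n; have [_ _ h _] := Hyv n; apply: HL (h l).
  by rewrite distrC; near: n; exact: cvgr_dist_lt yx _ r0.
have yn : \forall n \near ultraN, y n != xbar.
  by apply: ultraN_all => n; case: (Hyv n).
have sv : \forall n \near ultraN, subgrads S (y n) (v n).
  by apply: ultraN_all => n l _; case: (Hyv n).
have [||sl cl] := @circuit_limit R d m T f gh xbar I1 f_nice gh_cont gh_indep rc S y v vl S0 yx yn sv.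
- by move=> l _.
- near=> n; apply: all_circuit; last by near: n.
  split; first by near: n.
  by rewrite distrC; near: n; exact: cvgr_dist_lt yx _ e_gt0.
exists vl; split => //.
have lew l : l \in S -> dotv (vl l) u <= dotv (w l) u.
  by move=> lS; have [_] := Hw l; apply; exact: sl.
suff sumle : \sum_(l in S) dotv (w l) u <= \sum_(l in S) dotv (vl l) u.
  move=> l lS z zx; apply: (@le_trans _ _ (dotv (w l) u)); first by case: (Hw l) => _; exact.
  move: sumle; rewrite !(bigD1 l lS) /=.
  have : \sum_(i in S | i != l) dotv (vl i) u <= \sum_(i in S | i != l) dotv (w i) u.
    by apply: ler_sum => i /andP[iS _]; exact: lew.
  lra.
pose V n := dotv (\sum_(l in S) v n l) u.
have cV : V @ ultraN --> dotv (\sum_(l in S) vl l) u.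
  apply: cvg_dotv; last exact: cvg_cst.
  by apply: cvg_bigsum => l _.
rewrite -[X in _ <= X]dotv_suml; apply/ler_addgt0Pr => g g0.
rewrite -lerBlDr.
have c1 : (fun n => V n + s n * `|V n| + s n * 2) @ ultraN -->
    dotv (\sum_(l in S) vl l) u + 0 * `|dotv (\sum_(l in S) vl l) u| + 0 * 2.
  apply: cvgD; first apply: cvgD => //; apply: cvgM => //.
    exact: cvg_norm.
  exact: cvg_cst.
rewrite !mul0r !addr0 in c1.
apply: ler_cvg_to (cvg_cst _) c1 _.
pose g' := g / (#|S|%:R + 1).
have g'0 : 0 < g' by rewrite divr_gt0// ltr_wpDl.
have slope : \forall n \near ultraN, forall l,
    f l xbar + s n * dotv (w l) u - g' * s n <= f l (xbar + s n *: u).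
  apply: filter_forall => l; have [wl _] := Hw l.
  have [r r0 Hr] := regular_subdiff_dir wl u g'0.
  near=> n; apply: Hr; have /andP[-> _] := s01 n => /=.
  by near: n; exact: sr.
near=> n.
have slopen : forall l, f l xbar + s n * dotv (w l) u - g' * s n <= f l (xbar + s n *: u).
  by near: n.
have /andP[sn0 _] := s01 n.
have [_ _ _ h] := Hyv n.
have h2 : \sum_(l in S) (f l xbar + s n * dotv (w l) u - g' * s n) <=
    \sum_(l in S) f l (xbar + s n *: u) by apply: ler_sum => l _.
rewrite sumrB big_split /= -mulr_sumr sumr_const -mulr_natl in h2.
have h3 : #|S|%:R * (g' * s n) <= s n * g.
  rewrite mulrA [leRHS]mulrC ler_pM2r// /g' mulrA ler_pdivrMr ?ltr_wpDl//.
  by rewrite mulrC ler_pM2l// lerDl.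
rewrite -(ler_pM2l sn0).
rewrite -/(V n) !expr2 in h.
lra.
Unshelve. all: by end_near. Qed.

(** Some subgradient has nonnegative slope, hence so has the one of largest slope; the positive
    relation paired with [u] then forces all these largest slopes to be 0. *)
Lemma max_slope_le0 u : (forall i, i \in I1 -> dotv (gh i xbar) u = 0) ->
  (forall l, l \in S -> exists2 a : 'rV[R]_d, regular_subdiff (f l) xbar a & 0 <= dotv a u) ->
  forall l, l \in S -> forall w, regular_subdiff (f l) xbar w -> dotv w u <= 0.
Proof.
have [->|u0] := eqVneq u 0; first by move=> _ _ l _ w _; rewrite dotv0r.
move=> gu vu l lS w wx.
have [v [sv [[c nt rel] sg] vmax]] := circuit_of_max_slope u0.
have vge k : k \in S -> 0 <= dotv (v k) u.
  by move=> kS; have [z zx zu] := vu k kS; apply: le_trans zu (vmax k kS z zx).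
suff : dotv (v l) u = 0 by move=> <-; exact: vmax.
have [c2 [c2p rel2]] : exists c2 : T + 'I_m -> R, (forall l, l \in S -> 0 < c2 (inl l)) /\
    lincomb (idx S) c2 (vec xbar v) = 0.
  have [cp|cn] := sg c nt rel; first by exists c.
  exists (fun k => - c k); split; last by rewrite lincombN rel oppr0.
  by move=> k /cn; rewrite oppr_gt0.
move: rel2 => /(congr1 (fun z => dotv z u)); rewrite dotv0l /lincomb dotv_suml.
rewrite (bigD1 (inl l)) /=; last by rewrite inE.
move=> h; have h2 : 0 <= \sum_(i in idx S | i != inl l) dotv (c2 i *: vec xbar v i) u.
  apply: sumr_ge0 => -[k|i] /andP[]; rewrite inE dotvZl /= => kS _.
    by rewrite mulr_ge0 ?vge// ltW// c2p.
  by rewrite gu// mulr0.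
rewrite dotvZl in h.
have h3 : c2 (inl l) * dotv (v l) u <= 0 by rewrite -h lerDl.
apply/eqP; rewrite eq_le vge// andbT.
by move: h3; rewrite pmulr_rle0// c2p.
Qed.

(** Once no slope along [u] is positive, the slopes along [- u] are nonnegative, and the preceding
    bound applies to [- u] as well. *)
Lemma slope_eq0 u : (forall i, i \in I1 -> dotv (gh i xbar) u = 0) ->
  (forall l, l \in S -> exists2 a : 'rV[R]_d, regular_subdiff (f l) xbar a & 0 <= dotv a u) ->
  forall l, l \in S -> forall w, regular_subdiff (f l) xbar w -> dotv w u = 0.
Proof.
move=> gu vu l lS w wx; have le0 := max_slope_le0 gu vu.
apply/eqP; rewrite eq_le (le0 l)//= -oppr_le0 -dotvNr.
apply: (@max_slope_le0 (- u)) lS _ wx => [i iI|k kS].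
  by rewrite dotvNr gu// oppr0.
have [v vx _] := vu k kS; exists v => //.
by rewrite dotvNr oppr_ge0 (le0 k).
Qed.

End circuits_everywhere.
End propagation.

Lemma sum_sumType (V : nmodType) (I J : finType) (P : pred (I + J)) (F : I + J -> V) :
  \sum_(k | P k) F k = \sum_(i | P (inl i)) F (inl i) + \sum_(j | P (inr j)) F (inr j).
Proof. exact: big_sumType. Qed.

(** * Penalization *)

Section penalized_projection.
Variables (R : realType) (d m : nat) (T : finType).
Variables (f : T -> 'rV[R]_d -> R) (h : 'I_m -> 'rV[R]_d -> R).
Variables (gh : 'I_m -> 'rV[R]_d -> 'rV[R]_d).
Implicit Types (S : {set T}) (x y z u : 'rV[R]_d) (v : T -> 'rV[R]_d).
Hypothesis f_nice : forall l, nice (f l).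
Hypothesis h_nice : forall j, nice (h j).
Hypothesis hN_nice : forall j, nice (fun x => - h j x).
Hypothesis h_grad : forall j x w, regular_subdiff (h j) x w -> w = gh j x.
Hypothesis hN_grad : forall j x w, regular_subdiff (fun x => - h j x) x w -> w = - gh j x.

Definition pos (t : R) := Num.max 0 t.

Lemma pos_ge0 t : 0 <= pos t. Proof. by rewrite le_max lexx. Qed.

Lemma pos_ge t : t <= pos t. Proof. by rewrite le_max lexx orbT. Qed.

Lemma pos_le0 t : t <= 0 -> pos t = 0. Proof. by move=> t0; apply/max_idPl. Qed.

Lemma pos_id t : 0 <= t -> pos t = t. Proof. by move=> t0; apply/max_idPr. Qed.

Lemma posE t : pos t = (t + `|t|) / 2.
Proof.
have [t0|t0] := leP 0 t; first by rewrite pos_id// ger0_norm//; field.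
by rewrite pos_le0 ?(ltW t0)// ltr0_norm// subrr mul0r.
Qed.

Lemma cvg_pos (F : nat -> R) (l : R) : F @ ultraN --> l -> (fun n => pos (F n)) @ ultraN --> pos l.
Proof.
move=> Fl; rewrite posE; under eq_fun do rewrite posE.
apply: cvgM; last exact: cvg_cst.
by apply: cvgD => //; exact: cvg_norm.
Qed.

(** A quadratic upper model: the derivative [2 * pos t] of [pos t ^+ 2] is 2-Lipschitz. *)
Lemma sqr_pos_le (a b : R) : pos a ^+ 2 <= pos b ^+ 2 + 2 * pos b * (a - b) + (a - b) ^+ 2.
Proof.
have [b0|b0] := leP 0 b.
  rewrite (pos_id b0); have -> : b ^+ 2 + 2 * b * (a - b) + (a - b) ^+ 2 = a ^+ 2 by ring.
  have [a0|a0] := leP 0 a; first by rewrite pos_id.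
  by rewrite pos_le0 ?(ltW a0)// expr0n /= sqr_ge0.
rewrite (pos_le0 (ltW b0)) expr0n /= mulr0 mul0r !add0r.
have [a0|a0] := leP 0 a; last by rewrite pos_le0 ?(ltW a0)// expr0n /= sqr_ge0.
by rewrite pos_id//; nra.
Qed.

(** The squares are linearized at [y], the errors going into the quadratic constant [C]. The
    multiplier rule wants nonnegative weights, so [h j] or its opposite is used according to the
    sign of [h j y]. *)
Lemma penalty_multipliers S (a b K : R) y z : 0 <= a -> 0 <= b -> 0 <= K ->
  (\forall y' \near y, 0 <=
     a * (\sum_(l in S) pos (f l y') ^+ 2 - \sum_(l in S) pos (f l y) ^+ 2) +
     K * (dotv (y' - z) (y' - z) - dotv (y - z) (y - z)) +
     b * (\sum_j h j y' ^+ 2 - \sum_j h j y ^+ 2)) ->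
  exists2 v, (forall l, regular_subdiff (f l) y (v l)) &
    \sum_(l in S) (2 * a * pos (f l y)) *: v l + \sum_j (2 * b * h j y) *: gh j y
      = (2 * K) *: (z - y).
Proof.
move=> a0 b0 K0 ymin.
pose I := (T + 'I_m)%type.
pose F (k : I) := match k with inl l => f l | inr j =>
  if 0 <= h j y then h j else (fun x => - h j x) end.
pose c (k : I) := match k with inl l => if l \in S then 2 * a * pos (f l y) else 0
  | inr j => 2 * b * `|h j y| end.
have F_nice k : nice (F k).
  by case: k => [l|j] //=; case: ifP.
have c_ge0 k : 0 <= c k.
  case: k => [l|j] /=; last by rewrite !mulr_ge0.
  by case: ifP => // _; rewrite !mulr_ge0// pos_ge0.
have /choice [L HL] : forall k, exists L, 0 <= L /\
    \forall y' \near y, `|F k y' - F k y| <= L * `|y' - y|.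
  move=> k; have [lip _] := F_nice k; have [r [L [r0 L0 Hr]]] := lip y.
  exists L; split => //; apply/near_rVP; exists r => // y' yr.
  by apply: Hr => //; rewrite subrr normr0.
have : \forall y' \near y, forall k, `|F k y' - F k y| <= L k * `|y' - y|.
  by apply: (@filter_forall _ _ _ (nbhs y)) => k; case: (HL k).
move=> /near_rVP [r1 r10 H1]; move: ymin => /near_rVP [r2 r20 H2].
pose C := K * d%:R + \sum_(l in S) a * L (inl l) ^+ 2 + \sum_j b * L (inr j) ^+ 2.
have [||v [vF rel]] := @multiplier_rule R d I F c ((2 * K) *: (y - z)) y C (Num.min r1 r2) F_nice c_ge0.
- by rewrite lt_min r10.
- move=> y'; rewrite lt_min => /andP[/H1 yL /H2 {}H2]; apply: le_trans H2 _.
  have {}yL k : (F k y' - F k y) ^+ 2 <= L k ^+ 2 * `|y' - y| ^+ 2.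
    by rewrite -exprMn -[leLHS]real_normK ?num_real// ler_sqr ?nnegrE// mulr_ge0//; case: (HL k).
  rewrite sum_sumType dotvZl.
  have e1 : a * (\sum_(l in S) pos (f l y') ^+ 2 - \sum_(l in S) pos (f l y) ^+ 2) <=
      \sum_l c (inl l) * (F (inl l) y' - F (inl l) y) +
      (\sum_(l in S) a * L (inl l) ^+ 2) * `|y' - y| ^+ 2.
    rewrite -sumrB mulr_sumr mulr_suml.
    rewrite [X in _ <= X + _](_ : _ = \sum_(l in S) 2 * a * pos (f l y) * (f l y' - f l y)); last first.
      by rewrite [RHS]big_mkcond; apply: eq_bigr => l _ /=; case: ifP => // _; rewrite mul0r.
    rewrite -big_split /=; apply: ler_sum => l lS.
    have := sqr_pos_le (f l y') (f l y); have /= := yL (inl l) => h1 h2.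
    have : a * (pos (f l y') ^+ 2 - pos (f l y) ^+ 2) <=
      a * (2 * pos (f l y) * (f l y' - f l y) + L (inl l) ^+ 2 * `|y' - y| ^+ 2).
      by rewrite ler_wpM2l//; lra.
    lra.
  have e2 : b * (\sum_j h j y' ^+ 2 - \sum_j h j y ^+ 2) <=
      \sum_j c (inr j) * (F (inr j) y' - F (inr j) y) +
      (\sum_j b * L (inr j) ^+ 2) * `|y' - y| ^+ 2.
    rewrite -sumrB mulr_sumr mulr_suml -big_split /=; apply: ler_sum => j _.
    have /= := yL (inr j); case: ifP => [h0 h2|/negbT].
      rewrite ger0_norm//.
      have : b * (h j y' - h j y) ^+ 2 <= b * (L (inr j) ^+ 2 * `|y' - y| ^+ 2) by rewrite ler_wpM2l.
      lra.
    rewrite -ltNge => h0 h2; rewrite ltr0_norm//.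
    have : b * (- h j y' - - h j y) ^+ 2 <= b * (L (inr j) ^+ 2 * `|y' - y| ^+ 2) by rewrite ler_wpM2l.
    lra.
  have e3 : K * (dotv (y' - z) (y' - z) - dotv (y - z) (y - z)) <=
      2 * K * dotv (y - z) (y' - y) + K * d%:R * `|y' - y| ^+ 2.
    have [w wE] : exists w, w = y' - y by eexists.
    have [t tE] : exists t, t = y - z by eexists.
    have -> : y' - z = w + t by rewrite wE tE addrA subrK.
    rewrite -wE -tE !dotvDl !dotvDr (dotvC t w).
    have : K * dotv w w <= K * (d%:R * `|w| ^+ 2) by rewrite ler_wpM2l// dotvv_le.
    lra.
  rewrite /C !mulrDl; lra.
exists (fun l => v (inl l)); first by move=> l; exact: (vF (inl l)).
move: rel; rewrite sum_sumType /= => rel.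
have -> : \sum_(l in S) (2 * a * pos (f l y)) *: v (inl l) =
   \sum_l (if l \in S then 2 * a * pos (f l y) else 0) *: v (inl l).
  by rewrite big_mkcond; apply: eq_bigr => l _; case: ifP => // _; rewrite scale0r.
have -> : \sum_j (2 * b * h j y) *: gh j y = \sum_j (2 * b * `|h j y|) *: v (inr j).
  apply: eq_bigr => j _; have /= := vF (inr j).
  case: ifP => [h0 /h_grad ->|/negbT]; first by rewrite ger0_norm.
  by rewrite -ltNge => h0 /hN_grad ->; rewrite ltr0_norm// mulrN scalerN scaleNr opprK.
by apply/eqP; rewrite -subr_eq0 -scalerN opprB -[X in _ == X]rel.
Qed.

(** The tolerance of the mean value inequality is taken proportional to [|b n - a n|], so it still
    vanishes after division by this length. *)
Lemma mean_slope (g : 'rV[R]_d -> R) (a b : nat -> 'rV[R]_d) x u (e : nat -> R) :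
  nice g -> a @ ultraN --> x -> b @ ultraN --> x ->
  (\forall n \near ultraN, a n != b n) ->
  (fun n => `|b n - a n|^-1 *: (b n - a n)) @ ultraN --> u ->
  e @ ultraN --> (0 : R) ->
  (\forall n \near ultraN, - (e n * `|b n - a n|) <= g (b n) - g (a n)) ->
  exists2 w, regular_subdiff g x w & 0 <= dotv w u.
Proof.
move=> ng ax bx ab bau e0 Hg.
have bax : (fun n => b n - a n) @ ultraN --> (0 : 'rV[R]_d).
  by rewrite -(subrr x); exact: cvgB.
have /ultraN_choice [q Hq] : \forall n \near ultraN, exists q : 'rV[R]_d * 'rV[R]_d,
    [/\ `|q.1 - a n| <= n.+1%:R^-1 + `|b n - a n|, regular_subdiff g q.1 q.2 &
     - (e n + n.+1%:R^-1) <= dotv q.2 (`|b n - a n|^-1 *: (b n - a n))].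
  near=> n.
  have nab : 0 < `|b n - a n| by rewrite normr_gt0 subr_eq0 eq_sym; near: n.
  have n0 : (0 : R) < n.+1%:R^-1 by rewrite invr_gt0.
  have [||s [y [q [/andP[s0 s1] ys /proximal_regular qy qs]]]] :=
    @approx_mean_value R d g (a n) (b n) (`|b n - a n| * n.+1%:R^-1) n.+1%:R^-1
      (nice_continuous ng) => //; first exact: mulr_gt0.
  exists (y, q); split => //=.
    have -> : y - a n = (y - (a n + s *: (b n - a n))) + s *: (b n - a n).
      by rewrite opprD addrA subrK.
    apply: le_trans (ler_normD _ _) _; rewrite normrZ ger0_norm//.
    by rewrite lerD// ?(ltW ys)// ler_piMl.
  rewrite dotvZr -(ler_pM2l nab) mulrA divff ?gt_eqF// mul1r.
  have h1 : - (e n * `|b n - a n|) <= g (b n) - g (a n) by near: n.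
  by apply: le_trans qs; rewrite mulrN mulrDr opprD lerD2r mulrC.
have q1x : (fun n => (q n).1) @ ultraN --> x.
  rewrite (_ : (fun n => (q n).1) = (fun n => ((q n).1 - a n) + a n)); last first.
    by apply/funext => n; rewrite subrK.
  rewrite -[x]add0r; apply: cvgD => //; apply/cvgrPdist_lt => r r0; near=> n.
  rewrite sub0r normrN.
  have [k1 _ _] : [/\ `|(q n).1 - a n| <= n.+1%:R^-1 + `|b n - a n|, regular_subdiff g (q n).1 (q n).2 &
     - (e n + n.+1%:R^-1) <= dotv (q n).2 (`|b n - a n|^-1 *: (b n - a n))] by near: n.
  have h1 : n.+1%:R^-1 < r / 2 by near: n; apply: ultraN_inv; rewrite divr_gt0.
  have h2 : `|b n - a n| < r / 2.
    rewrite -normrN -sub0r; near: n; apply: cvgr_dist_lt bax _ _; by rewrite divr_gt0.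
  by apply: le_lt_trans k1 _; rewrite [ltRHS]splitr ltrD.
have sq : \forall n \near ultraN, regular_subdiff g (q n).1 (q n).2.
  by apply: filterS Hq => n [].
have [r [L [r0 L0 HL]]] := nice_bound x ng.
have [|w _ qw] := @ultraN_rV R d (fun n => (q n).2) L.
  near=> n; apply: (HL (q n).1); last by near: n.
  by rewrite distrC; near: n; exact: cvgr_dist_lt q1x _ r0.
exists w; first exact: nice_closed ng q1x qw sq.
have c1 : (fun n => dotv (q n).2 (`|b n - a n|^-1 *: (b n - a n))) @ ultraN --> dotv w u.
  exact: cvg_dotv.
have c2 : (fun n => - (e n + n.+1%:R^-1)) @ ultraN --> - (0 + 0 : R).
  by apply: cvgN; apply: cvgD => //; exact: cvg_ultraN_inv.
rewrite addr0 oppr0 in c2.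
apply: ler_cvg_to c2 c1 _.
by apply: filterS Hq => n [].
Unshelve. all: by end_near. Qed.

(** The exterior penalty method on a ball: comparison with [x0] bounds [n%:R * P (Y n)] by [Psi x0],
    so [P] vanishes at the limit. *)
Lemma penalty_method (Psi P : 'rV[R]_d -> R) (z x0 : 'rV[R]_d) (rho : R) :
  (forall (Y : nat -> 'rV[R]_d) y, Y @ ultraN --> y -> Psi \o Y @ ultraN --> Psi y) ->
  (forall (Y : nat -> 'rV[R]_d) y, Y @ ultraN --> y -> P \o Y @ ultraN --> P y) ->
  (forall y, 0 <= Psi y) -> (forall y, 0 <= P y) -> P x0 = 0 -> `|x0 - z| <= rho ->
  exists (Y : nat -> 'rV[R]_d) y, [/\ Y @ ultraN --> y, P y = 0, `|y - z| <= rho,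
    forall n, `|Y n - z| <= rho &
    forall n y', `|y' - z| <= rho ->
      Psi (Y n) + n%:R * P (Y n) <= Psi y' + n%:R * P y'].
Proof.
move=> cPsi cP Psi0 P0 Px0 xrho.
pose phi (n : nat) y := Psi y + n%:R * P y.
have bnd y : `|y - z| <= rho -> `|y| <= rho + `|z|.
  by move=> k1; rewrite -[y](subrK z); apply: le_trans (ler_normD _ _) _; rewrite lerD2r.
have cl (Y : nat -> 'rV[R]_d) (y : 'rV[R]_d) : Y @ ultraN --> y ->
    (forall n, `|Y n - z| <= rho) -> `|y - z| <= rho.
  move=> Yy YD; apply: ler_cvg_to (cvg_norm (cvgB Yy (cvg_cst z))) (cvg_cst _) _.
  exact: ultraN_all.
have /choice [Y HY] : forall n, exists y, `|y - z| <= rho /\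
    forall y', `|y' - z| <= rho -> phi n y <= phi n y'.
  move=> n; have [|||y yD ymin] := @ultraN_min R 'rV[R]_d [set y | `|y - z| <= rho]
    (fun a l => a @ ultraN --> l) (phi n); last by exists y.
  - by exists x0.
  - move=> Y YD; have [|y _ Yy] := @ultraN_rV R d Y (rho + `|z|).
      by apply: ultraN_all => k; apply: bnd; exact: YD.
    by exists y => //=; exact: cl Yy YD.
  - move=> Y y _ Yy; apply: cvgD; first exact: cPsi.
    by apply: cvgM; [exact: cvg_cst|exact: cP].
have Yphi n : phi n (Y n) <= Psi x0.
  by have [_ /(_ x0 xrho)] := HY n; rewrite {2}/phi Px0 mulr0 addr0.
have [|y0 _ Yy0] := @ultraN_rV R d Y (rho + `|z|).
  by apply: ultraN_all => k; apply: bnd; case: (HY k).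
exists Y, y0; split => //.
- apply/eqP; rewrite eq_le P0 andbT leNgt; apply/negP => Py.
  have P2 : 0 < P y0 / 2 by rewrite divr_gt0.
  have /ultraN_ex [n [k1 k2]] : \forall n \near ultraN,
      `|P y0 - (P \o Y) n| < P y0 / 2 /\ Psi x0 / (P y0 / 2) < n%:R.
    near=> n; split; first by near: n; exact: cvgr_dist_lt (cP _ _ Yy0) _ P2.
    by near: n; exact: ultraN_big.
  move: k2; rewrite ltr_pdivrMr// => k2; move: k1; rewrite /= ltr_norml => /andP[_ k1].
  have := Yphi n; rewrite /phi; have := Psi0 (Y n).
  have : n%:R * (P y0 / 2) <= n%:R * P (Y n) by rewrite ler_wpM2l//; lra.
  lra.
- by apply: cl Yy0 _ => n; case: (HY n).
- by move=> n; case: (HY n).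
- by move=> n; case: (HY n).
Unshelve. all: by end_near. Qed.

(** A penalized problem stands in for the projection of [z] because its multipliers are explicit;
    feasibility up to [eta] is enough. *)
Lemma penalized_projection_point S xbar z (D eta : R) :
  (forall l, f l xbar = 0) -> (forall j, h j xbar = 0) ->
  0 < D -> 0 < eta -> z != xbar ->
  (forall y, (forall l, l \in S -> f l y <= 0) -> (forall j, h j y = 0) -> D <= `|z - y|) ->
  exists y v (c : T + 'I_m -> R),
  [/\ [/\ y != xbar, `|y - z| <= d.+1%:R * `|xbar - z| & D <= 2 * `|z - y|],
    forall l, l \in S -> f l y <= eta, forall j, `|h j y| <= eta,
    (forall l, regular_subdiff (f l) y (v l)) &
    z - y = \sum_(l in S) c (inl l) *: v l + \sum_j c (inr j) *: gh j y].
Proof.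
move=> f0 h0 D0 eta0 zx HD.
(* Comparison with [xbar] gives [|y - z| ^+ 2 <= d * |xbar - z| ^+ 2], the factor [d] coming from
   the maximum norm; [d.+1] makes the minimizers interior to the ball. *)
pose rho := d.+1%:R * `|xbar - z|.
have zx0 : 0 < `|xbar - z| by rewrite normr_gt0 subr_eq0 eq_sym.
have rho0 : 0 < rho by rewrite mulr_gt0.
pose P y := \sum_(l in S) pos (f l y) ^+ 2 + \sum_j h j y ^+ 2.
have cP (Y : nat -> 'rV[R]_d) y : Y @ ultraN --> y -> (fun n => P (Y n)) @ ultraN --> P y.
  move=> Yy; apply: cvgD; apply: cvg_bigsum => i _.
    have c1 : (fun n => f i (Y n)) @ ultraN --> f i y.
      by apply: continuous_cvg => //; exact: nice_continuous.
    by rewrite expr2; apply: cvgM; exact: cvg_pos.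
  have c1 : (fun n => h i (Y n)) @ ultraN --> h i y.
    by apply: continuous_cvg => //; exact: nice_continuous.
  by rewrite expr2; apply: cvgM.
have P0 y : 0 <= P y.
  by rewrite addr_ge0// sumr_ge0// => *; exact: sqr_ge0.
have Pxbar : P xbar = 0.
  rewrite /P !big1 ?addr0// => i _; first by rewrite h0 expr0n.
  by rewrite f0 pos_le0// expr0n.
have Pge l y : l \in S -> pos (f l y) ^+ 2 <= P y.
  move=> lS; rewrite /P (bigD1 l)//= -addrA lerDl addr_ge0// sumr_ge0// => *; exact: sqr_ge0.
have PgeH j y : h j y ^+ 2 <= P y.
  rewrite /P [X in _ <= _ + X](bigD1 j)//= addrCA lerDl addr_ge0// sumr_ge0// => *; exact: sqr_ge0.
have xrho : `|xbar - z| <= rho by rewrite /rho ler_peMl// ler1n.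
have [||Y [y0 [Yy0 Py0 _ Yrho' Ymin']]] := @penalty_method
    (fun y => dotv (y - z) (y - z)) P z xbar rho _ cP _ P0 Pxbar xrho.
- by move=> Y y Yy; apply: cvg_dotv; apply: cvgB => //; exact: cvg_cst.
- by move=> y; exact: dotvv_ge0.
have Dy0 : D <= `|z - y0|.
  apply: HD => [l lS|j].
    rewrite leNgt; apply/negP => fl; have := Pge l y0 lS; rewrite Py0 pos_id ?(ltW fl)//.
    by rewrite leNgt exprn_gt0.
  have := PgeH j y0; rewrite Py0 => k1; apply/eqP; rewrite -sqrf_eq0.
  by rewrite eq_le k1 sqr_ge0.
have cD : (fun n => `|z - Y n|) @ ultraN --> `|z - y0|.
  by apply: cvg_norm; apply: cvgB => //; exact: cvg_cst.
have D2 : 0 < D / 2 by rewrite divr_gt0.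
have /ultraN_ex [n [k1 k2 k3]] : \forall n \near ultraN,
    [/\ forall l, l \in S -> f l (Y n) <= eta, forall j, `|h j (Y n)| <= eta &
        D / 2 < `|z - Y n|].
  near=> n; split.
  - near: n; apply: filter_forall => l; have [lS|lS] := boolP (l \in S); last exact: ultraN_all.
    have c1 : (fun n => f l (Y n)) @ ultraN --> f l y0.
      by apply: continuous_cvg => //; exact: nice_continuous.
    near=> n => _; have : `|f l y0 - f l (Y n)| < eta by near: n; exact: cvgr_dist_lt c1 _ eta0.
    rewrite ltr_norml => /andP[k1 _].
    have : f l y0 <= pos (f l y0) by exact: pos_ge.
    have : pos (f l y0) = 0.
      apply/eqP; rewrite -sqrf_eq0 eq_le sqr_ge0 andbT -Py0; exact: Pge.
    lra.
  - near: n; apply: filter_forall => j.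
    have c1 : (fun n => h j (Y n)) @ ultraN --> h j y0.
      by apply: continuous_cvg => //; exact: nice_continuous.
    have h0' : h j y0 = 0.
      by apply/eqP; rewrite -sqrf_eq0 eq_le sqr_ge0 andbT -Py0; exact: PgeH.
    near=> n; have : `|h j y0 - h j (Y n)| < eta by near: n; exact: cvgr_dist_lt c1 _ eta0.
    by rewrite h0' sub0r normrN => /ltW.
  - have : `| `|z - y0| - `|z - Y n| | < D / 2 by near: n; exact: cvgr_dist_lt cD _ D2.
    by rewrite ltr_norml => /andP[_]; lra.
have Yrho := Yrho' n; have Ymin := Ymin' n.
have Ylt : `|Y n - z| < rho.
  rewrite -(ltr_pXn2r (n := 2)) ?nnegrE ?normr_ge0 ?(ltW rho0)//.
  apply: le_lt_trans (sqr_norm_le_dotv _) _.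
  apply: (@le_lt_trans _ _ (d%:R * `|xbar - z| ^+ 2)).
    apply: le_trans (dotvv_le _); have := Ymin xbar xrho.
    by rewrite Pxbar mulr0 addr0; apply: le_trans; rewrite lerDl mulr_ge0.
  rewrite /rho exprMn ltr_pM2r ?exprn_gt0// -natrX ltr_nat.
  by rewrite expnS expn1 (leq_trans (ltnSn d))// leq_pmulr.
have [||||v vf rel] := @penalty_multipliers S n%:R n%:R 1 (Y n) z => //.
  apply/near_rVP; exists (rho - `|Y n - z|); first by rewrite subr_gt0.
  move=> y' y'r; have := Ymin y'.
  have y'z : `|y' - z| <= rho.
    have -> : y' - z = (y' - Y n) + (Y n - z) by rewrite addrA subrK.
    by apply: le_trans (ler_normD _ _) _; lra.
  move=> /(_ y'z); rewrite /P; lra.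
exists (Y n), v, (fun k => match k with inl l => n%:R * pos (f l (Y n)) | inr j => n%:R * h j (Y n) end).
have relE : z - Y n =
   \sum_(l in S) (n%:R * pos (f l (Y n))) *: v l + \sum_j (n%:R * h j (Y n)) *: gh j (Y n).
  apply: (@scalerI _ _ (2 : R)); first by rewrite pnatr_eq0.
  rewrite mulr1 in rel; rewrite -rel scalerDr !scaler_sumr.
  by congr (_ + _); apply: eq_bigr => i _; rewrite scalerA mulrA.
split => //=; split => //.
(* At [xbar] all residuals vanish, and with them the multipliers and [z - y], against
   [D / 2 < |z - y|]. *)
- apply/eqP => YE; move: k3; rewrite relE YE !big1 ?addr0 ?normr0; first by lra.
    by move=> j _; rewrite h0 mulr0 scale0r.
  by move=> l _; rewrite f0 pos_le0// mulr0 scale0r.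
- by lra.
Unshelve. all: by end_near. Qed.

End penalized_projection.

(** * Error bound for a system active at the reference point *)

Section error_bound.
Variables (R : realType) (d m : nat) (T : finType).
Variables (f : T -> 'rV[R]_d -> R) (h : 'I_m -> 'rV[R]_d -> R).
Variables (gh : 'I_m -> 'rV[R]_d -> 'rV[R]_d).
Variables (xbar : 'rV[R]_d) (I1 : {set 'I_m}).
Implicit Types (S : {set T}) (x y u : 'rV[R]_d) (v vl : T -> 'rV[R]_d).
Implicit Types (c : T + 'I_m -> R) (e : R).
Hypothesis f_nice : forall l, nice (f l).
Hypothesis h_nice : forall j, nice (h j).
Hypothesis hN_nice : forall j, nice (fun x => - h j x).
Hypothesis h_grad : forall j x w, regular_subdiff (h j) x w -> w = gh j x.
Hypothesis hN_grad : forall j x w, regular_subdiff (fun x => - h j x) x w -> w = - gh j x.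
Hypothesis gh_cont : forall i, continuous (gh i).
Hypothesis f_xbar : forall l, f l xbar = 0.
Hypothesis h_xbar : forall j, h j xbar = 0.
Hypothesis gh_indep : independent (idx (T := T) I1 finset.set0) (vec gh xbar (fun=> 0)).
Hypothesis gh_span : \forall x \near xbar, forall j, exists mu : 'I_m -> R,
  gh j x = \sum_(i in I1) mu i *: gh i x.

Notation idx := (idx I1).
Notation vec := (vec gh).
Notation subgrads := (subgrads f).
Notation circuit := (circuit gh I1).

Hypothesis rc : forall S v c, S != finset.set0 -> subgrads S xbar v ->
  (forall l, l \in S -> 0 < c (inl l)) -> lincomb (idx S) c (vec xbar v) = 0 ->
  exists2 e, 0 < e & forall x (v' : T -> 'rV[R]_d), x != xbar -> `|x - xbar| < e -> subgrads S x v' ->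
    (forall l, l \in S -> `|v' l - v l| < e) ->
    exists2 c', nontriv (idx S) c' & lincomb (idx S) c' (vec x v') = 0.

Lemma lincomb_idx S c (V : T + 'I_m -> 'rV[R]_d) : lincomb (idx S) c V =
  \sum_(l in S) c (inl l) *: V (inl l) + \sum_(i in I1) c (inr i) *: V (inr i).
Proof.
rewrite /lincomb sum_sumType; congr (_ + _); apply: eq_bigl => k; by rewrite inE.
Qed.

Lemma gh_sum_span x (b : 'I_m -> R) :
  (forall j, exists mu : 'I_m -> R, gh j x = \sum_(i in I1) mu i *: gh i x) ->
  exists mu : 'I_m -> R, \sum_j b j *: gh j x = \sum_(i in I1) mu i *: gh i x.
Proof.
move=> /choice [mu Hmu]; exists (fun i => \sum_j b j * mu j i).
under eq_bigr do rewrite Hmu scaler_sumr.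
rewrite exchange_big /=; apply: eq_bigr => i _.
by rewrite scaler_suml; apply: eq_bigr => j _; rewrite scalerA.
Qed.

Definition feasible_for S y := (forall l, l \in S -> f l y <= 0) /\ forall j, h j y = 0.

(** Independence bounds the coefficients, so the limit of the unit vectors lies in the limiting
    span; being orthogonal to it, this limit would be 0. *)
Lemma unit_in_span_orthogonal (K : finType) (A : {set K})
    (V : nat -> K -> 'rV[R]_d) (Vl : K -> 'rV[R]_d) (us : nat -> 'rV[R]_d) u :
  (forall k, k \in A -> (fun n => V n k) @ ultraN --> Vl k) -> independent A Vl ->
  us @ ultraN --> u -> (\forall n \near ultraN, `|us n| = 1) ->
  (\forall n \near ultraN, exists c : K -> R, us n = lincomb A c (V n)) ->
  (forall k, k \in A -> dotv (Vl k) u = 0) -> False.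
Proof.
move=> VV ind usu us1 /ultraN_choice [c usE] ort.
have [|cl Hcl] := @coef_limit R d K A V Vl c 1 VV ind.
  by apply: filterS2 us1 usE => n n1 <-; rewrite n1.
have uE : u = lincomb A cl Vl.
  have c1 : (fun n => lincomb A (c n) (V n)) @ ultraN --> lincomb A cl Vl.
    by apply: cvg_bigsum => k kA; apply: cvgZ; [exact: Hcl|exact: VV].
  apply: (cvg_unique _ usu) => //; apply: cvg_trans c1.
  apply: near_eq_cvg; by apply: filterS usE => n ->.
have u0 : u = 0.
  apply: dotvv_eq0; rewrite {1}uE /lincomb dotv_suml big1// => k kA.
  by rewrite dotvZl ort// mulr0.
have n1 : `|u| = 1.
  by apply: (cvg_unique _ (cvg_norm usu)) => //; exact: cvg_near_cst.
by move: n1; rewrite u0 normr0 => /eqP; rewrite eq_sym oner_eq0.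
Qed.

(** [D n] is a lower bound for the distance from [z n] to the set cut out by [S]. Residuals of order
    [D n / n.+1] are negligible along the segment from the penalized projection [y n] to [z n], so
    to first order no [f l] decreases and [h] is constant there. *)
Lemma no_bad_sequence S e (z : nat -> 'rV[R]_d) (D : nat -> R) : 0 < e ->
  (S != finset.set0 -> forall x v, punctured xbar e x -> subgrads S x v -> circuit S x v) ->
  z @ ultraN --> xbar ->
  (\forall n \near ultraN, [/\ z n != xbar, 0 < D n,
     forall y, feasible_for S y -> D n <= `|z n - y|,
     forall j, `|h j (z n)| <= D n / n.+1%:R &
     forall l, l \in S -> - (D n / n.+1%:R) <= f l (z n)]) -> False.
Proof.
move=> e0 allc zx Hz.
have /ultraN_choice [q Hq] : \forall n \near ultraN,
    exists q : ('rV[R]_d * (T -> 'rV[R]_d)) * (T + 'I_m -> R),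
    [/\ [/\ q.1.1 != xbar, `|q.1.1 - z n| <= d.+1%:R * `|xbar - z n| &
         D n <= 2 * `|z n - q.1.1|],
      forall l, l \in S -> f l q.1.1 <= D n / n.+1%:R,
      forall j, `|h j q.1.1| <= D n / n.+1%:R,
      (forall l, regular_subdiff (f l) q.1.1 (q.1.2 l)) &
      z n - q.1.1 = \sum_(l in S) q.2 (inl l) *: q.1.2 l +
                    \sum_j q.2 (inr j) *: gh j q.1.1].
  apply: filterS Hz => n [zn Dn Dz hz fz].
  have [||y [v [c Hc]]] := @penalized_projection_point R d m T f h gh f_nice h_nice
     hN_nice h_grad hN_grad S xbar (z n) (D n) (D n / n.+1%:R) f_xbar h_xbar Dn _ zn.
  - by rewrite divr_gt0.
  - by move=> y yS yh; apply: Dz; split.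
  - by exists ((y, v), c).
pose y n := (q n).1.1; pose v n := (q n).1.2; pose c n := (q n).2.
have yz : \forall n \near ultraN, 0 < `|z n - y n|.
  by apply: filterS2 Hz Hq => n [_ Dn _ _ _] [[_ _ k1] _ _ _ _]; rewrite /y; lra.
have yx : y @ ultraN --> xbar.
  rewrite (_ : y = (fun n => (y n - z n) + z n)); last by apply/funext => n; rewrite subrK.
  rewrite -[xbar]add0r; apply: cvgD => //; apply/cvgrPdist_lt => r r0; near=> n.
  rewrite sub0r normrN.
  have k1 : `|y n - z n| <= d.+1%:R * `|xbar - z n|.
    by near: n; apply: filterS Hq => n [[]].
  apply: le_lt_trans k1 _; rewrite mulrC -ltr_pdivlMr//.
  by near: n; apply: cvgr_dist_lt zx _ _; rewrite divr_gt0.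
pose us n := `|z n - y n|^-1 *: (z n - y n).
have us1 : \forall n \near ultraN, `|us n| = 1.
  apply: filterS yz => n n0; rewrite /us normrZ normfV normr_id mulVf//.
  by rewrite gt_eqF.
have [|u _ usu] := @ultraN_rV R d us 1; first by apply: filterS us1 => n ->.
(* Both ends contribute [D n / n.+1], and [D n <= 2 * |z n - y n|]; hence the factor 4. *)
have e4 : (fun n => 4 * n.+1%:R^-1 : R) @ ultraN --> (0 : R).
  rewrite -[X in _ --> X](mulr0 (4 : R)); apply: cvgM; first exact: cvg_cst.
  exact: cvg_ultraN_inv.
have slope (g : 'rV[R]_d -> R) : nice g ->
    (\forall n \near ultraN, - (2 * (D n / n.+1%:R)) <= g (z n) - g (y n)) ->
    exists2 w, regular_subdiff g xbar w & 0 <= dotv w u.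
  move=> ng gn; apply: (mean_slope ng yx zx _ usu e4).
    by apply: filterS yz => n; rewrite normr_gt0 subr_eq0 eq_sym.
  apply: filterS2 gn Hq => n gn [[_ _ k1] _ _ _ _]; apply: le_trans gn.
  have n0 : 0 <= n.+1%:R^-1 :> R by rewrite invr_ge0.
  rewrite lerN2; rewrite -/(y n) in k1; move: n0 k1; move: (n.+1%:R^-1 : R) => i.
  by nra.
have vu l : l \in S -> exists2 w, regular_subdiff (f l) xbar w & 0 <= dotv w u.
  move=> lS; apply: slope => //; apply: filterS2 Hz Hq => n [_ _ _ _ fz] [_ fy _ _ _].
  move: (fz l lS) (fy l lS); rewrite -/(y n); move: (D n / _) => t; lra.
have hle : \forall n \near ultraN, forall j,
    `|h j (z n) - h j (y n)| <= 2 * (D n / n.+1%:R).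
  apply: filterS2 Hz Hq => n [_ _ _ hz _] [_ _ hy _ _] j.
  apply: le_trans (ler_normB _ _) _.
  move: (hz j) (hy j); rewrite -/(y n); move: (D n / _) => t; lra.
have gu j : dotv (gh j xbar) u = 0.
  have [||w /h_grad -> w0] := slope (h j) => //.
    apply: filterS hle => n /(_ j); by rewrite ler_norml => /andP[].
  have [||w' /hN_grad -> w0'] := slope (fun x => - h j x) => //.
    apply: filterS hle => n /(_ j); rewrite ler_norml => /andP[_]; move: (2 * _) => t; lra.
  by apply/eqP; rewrite eq_le w0 andbT -oppr_ge0 -dotvNl.
have span : \forall n \near ultraN, exists b : T + 'I_m -> R,
    us n = lincomb (idx S) b (vec (y n) (v n)).
  have : \forall n \near ultraN, forall j, exists mu : 'I_m -> R,
      gh j (y n) = \sum_(i in I1) mu i *: gh i (y n) by exact: (yx _ gh_span).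
  move=> sp; apply: filterS2 Hq sp => n [_ _ _ _ E] /gh_sum_span.
  move=> /(_ (fun j => c n (inr j))) [mu muE].
  exists (fun k => `|z n - y n|^-1 * (match k with inl l => c n (inl l) | inr i => mu i end)).
  rewrite lincombZ lincomb_idx /us; congr (_ *: _).
  by rewrite {1}/y E -/(y n) muE.
have [vl Hvl] : exists vl, forall l, (fun n => v n l) @ ultraN --> vl l.
  have vb l : exists L, \forall n \near ultraN, `|v n l| <= L.
    have [r [L [r0 L0 HL]]] := nice_bound xbar (f_nice l).
    exists L; near=> n; apply: (HL (y n)).
      by rewrite distrC; near: n; exact: cvgr_dist_lt yx _ r0.
    by near: n; apply: filterS Hq => n [_ _ _ h4 _]; exact: h4.
  suff : forall l, exists w : 'rV[R]_d, (fun n => v n l) @ ultraN --> w.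
    by move=> /choice [vl Hvl]; exists vl.
  by move=> l; have [L HL] := vb l; have [w _ vw] := ultraN_rV HL; exists w.
have cV := cvg_vec (I1 := I1) gh_cont yx (fun l (_ : l \in S) => Hvl l).
have sv : \forall n \near ultraN, subgrads S (y n) (v n).
  by apply: filterS Hq => n [_ _ _ h4 _] l _; exact: h4.
have [SE|S0] := eqVneq S finset.set0.
  apply: (unit_in_span_orthogonal cV _ usu us1 span).
    move: gh_indep; rewrite SE => ind b nt; have := ind b nt.
    by rewrite !lincomb_idx !big_set0.
  by move=> [l|i]; rewrite inE ?SE ?inE// => _; exact: gu.
have /finset.set0Pn [i0 i0S] := S0.
have yn : \forall n \near ultraN, y n != xbar.
  by apply: filterS Hq => n [[]].
have cn : \forall n \near ultraN, circuit S (y n) (v n).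
  near=> n; apply: allc => //; last by near: n.
  split; first by near: n.
  by rewrite distrC; near: n; exact: cvgr_dist_lt yx _ e0.
have [sl cl] := circuit_limit f_nice gh_cont gh_indep rc S0 yx yn sv (fun l (_ : l \in S) => Hvl l) cn.
have Ku := slope_eq0 f_nice gh_cont gh_indep rc S0 e0 (allc S0) (fun i _ => gu i) vu.
(* The family on [S] is dependent, so its coefficients could be unbounded. Dropping [i0] leaves an
   independent limit family, because the circuit has no relation vanishing at [i0]. *)
pose A := idx S :\ (inl i0 : T + 'I_m).
have i0A : (inl i0 : T + 'I_m) \in idx S by rewrite inE.
have lincombA b (V : T + 'I_m -> 'rV[R]_d) : lincomb (idx S) b V = b (inl i0) *: V (inl i0) + lincomb A b V.
  by rewrite /lincomb (big_setD1 _ i0A).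
have AS : A \subset idx S by exact: subD1set.
apply: (@unit_in_span_orthogonal _ A _ (vec xbar vl) us u) => //.
- by move=> k /(fintype.subsetP AS); exact: cV.
- move=> b nt; apply/eqP => rel.
  have [_ /(_ (fun k => if k \in A then b k else 0))] := cl.
  rewrite (lincomb_sub _ _ AS) => sg.
  have /sg {}sg : nontriv (idx S) (fun k => if k \in A then b k else 0).
    by case: nt => k kA bk; exists k; [exact: (fintype.subsetP AS)|rewrite kA].
  by case: (sg rel) => /(_ i0 i0S); rewrite !inE eqxx /= ltxx.
- apply: filterS2 span cn => n [b bE] [[a nta rela] sga].
  have a0 : a (inl i0) != 0.
    by have [/(_ i0 i0S) /gt_eqF ->|/(_ i0 i0S) /lt_eqF ->] := sga a nta rela.
  (* The relation of the circuit at [y n] eliminates the dropped vector from the representation of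
     [us n]. *)
  exists (fun k => b k - b (inl i0) / a (inl i0) * a k).
  have : lincomb (idx S) (fun k => b k - b (inl i0) / a (inl i0) * a k) (vec (y n) (v n)) = us n.
    by rewrite lincombB rela scaler0 subr0 bE.
  by rewrite lincombA divfK// subrr scale0r add0r.
- move=> [l|i] /(fintype.subsetP AS); rewrite inE => lS; last exact: gu.
  exact: (Ku l lS _ (sl l lS)).
Unshelve. all: by end_near. Qed.

(** The case of empty [S]: for a sequence of counterexamples the residual of [h] is [D n / n.+1],
    with [D n] below the distance to the solutions. *)
Lemma equality_error_bound : exists C r, [/\ 0 <= C, 0 < r &
  forall x, `|x - xbar| < r -> exists2 y, (forall j, h j y = 0) &
    `|x - y| <= C * \sum_j `|h j x|].
Proof.
apply: contrapT => H.
have /choice [z Hz] : forall n : nat, exists x, `|x - xbar| < n.+1%:R^-1 /\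
    forall y, (forall j, h j y = 0) -> n.+1%:R * \sum_j `|h j x| < `|x - y|.
  move=> n; apply: contrapT => nx; apply: H; exists n.+1%:R, n.+1%:R^-1.
  split; [exact: ler0n|by rewrite invr_gt0|].
  move=> x xr; apply: contrapT => ny; apply: nx; exists x; split => // y hy.
  by rewrite ltNge; apply/negP => k; apply: ny; exists y.
have zx : z @ ultraN --> xbar.
  apply/cvgrPdist_lt => r r0; near=> n; have [k _] := Hz n.
  by rewrite distrC; apply: lt_trans k _; near: n; exact: ultraN_inv.
have sum_gt0 n : 0 < \sum_j `|h j (z n)|.
  rewrite lt_neqAle sumr_ge0// andbT eq_sym; apply/negP => /eqP s0.
  have /(_ (z n)) := (Hz n).2; rewrite s0 mulr0 subrr normr0 ltxx.
  move=> k; suff : false by []; apply: k => j.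
  apply/eqP; rewrite -normr_eq0; apply/eqP.
  exact: (psumr_eq0P (fun j _ => normr_ge0 (h j (z n))) s0).
apply: (@no_bad_sequence finset.set0 1 z (fun n => n.+1%:R * \sum_j `|h j (z n)|)) => //.
  by rewrite eqxx.
apply: ultraN_all => n; split.
- apply/eqP => zE; have := sum_gt0 n; rewrite zE big1 ?ltxx// => j _.
  by rewrite h_xbar normr0.
- by rewrite mulr_gt0.
- by move=> y [_ hy]; apply: ltW; apply: (Hz n).2.
- move=> j; rewrite mulrAC divff// mul1r (bigD1 j)//= lerDl; exact: sumr_ge0.
- by move=> l; rewrite inE.
Unshelve. all: by end_near. Qed.

(** The Euclidean norm of the positive parts: its multipliers [pos (f l z) / infeasibility z] have
    square sum 1, so they cannot all vanish in the limit, and a positive one signals a violation. *)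
Definition infeasibility x := Num.sqrt (\sum_l pos (f l x) ^+ 2).

Lemma infeasibility_ge0 x : 0 <= infeasibility x.
Proof. exact: sqrtr_ge0. Qed.

Lemma sqr_infeasibility x : infeasibility x ^+ 2 = \sum_l pos (f l x) ^+ 2.
Proof. by rewrite sqr_sqrtr// sumr_ge0// => l _; exact: sqr_ge0. Qed.

Lemma pos_le_infeasibility l x : pos (f l x) <= infeasibility x.
Proof.
rewrite -(ler_pXn2r (n := 2)) ?nnegrE ?pos_ge0 ?infeasibility_ge0//.
rewrite sqr_infeasibility (bigD1 l)//= lerDl sumr_ge0// => *; exact: sqr_ge0.
Qed.

Lemma infeasibility_le_sum x : infeasibility x <= \sum_l pos (f l x).
Proof.
have s0 : 0 <= \sum_l pos (f l x) by apply: sumr_ge0 => l _; exact: pos_ge0.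
rewrite -(ler_pXn2r (n := 2)) ?nnegrE ?infeasibility_ge0// sqr_infeasibility.
rewrite [leRHS]expr2 mulr_suml; apply: ler_sum => l _; rewrite expr2.
rewrite ler_wpM2l ?pos_ge0// (bigD1 l)//= lerDl sumr_ge0// => *; exact: pos_ge0.
Qed.

Lemma infeasibility_gt0 x : (exists l, 0 < f l x) -> 0 < infeasibility x.
Proof.
move=> [l fl]; apply: lt_le_trans (pos_le_infeasibility l x).
by rewrite pos_id ?ltW.
Qed.

Lemma cvg_infeasibility (Y : nat -> 'rV[R]_d) y : Y @ ultraN --> y ->
  infeasibility \o Y @ ultraN --> infeasibility y.
Proof.
move=> Yy; apply: (@continuous_cvg _ _ _ _ _ (fun n => \sum_l pos (f l (Y n)) ^+ 2) (@Num.sqrt R)).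
  exact: sqrt_continuous.
apply: cvg_bigsum => l _.
have c1 : (fun n => f l (Y n)) @ ultraN --> f l y.
  by apply: continuous_cvg => //; exact: nice_continuous.
by rewrite expr2; apply: cvgM; exact: cvg_pos.
Qed.

(** A variational principle in the manner of Ekeland, with a quadratic perturbation; the equations
    are penalized as well, so they hold at [z] only up to [t * infeasibility z]. *)
Lemma infeasible_stationary x (k t : R) : 0 < k -> 0 < t -> (forall j, h j x = 0) ->
  0 < infeasibility x ->
  (forall y, (forall l, f l y <= 0) -> (forall j, h j y = 0) -> k * infeasibility x < `|x - y|) ->
  exists z v (b : 'I_m -> R),
  [/\ `|z - x| <= k * infeasibility x, 0 < infeasibility z <= infeasibility x,
    forall j, `|h j z| <= t * infeasibility z, forall l, regular_subdiff (f l) z (v l) &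
    `|\sum_l (pos (f l z) / infeasibility z) *: v l + \sum_j b j *: gh j z| <= 2 / k].
Proof.
move=> k0 t0 hx rx Hx.
set r := infeasibility x in rx Hx *.
(* Values at most [r] confine the minimizers to [|y - x| <= k * r], where the gradient
   [(2 * K) *: (y - x)] has norm at most [2 / k]. *)
pose K := (k ^+ 2 * r)^-1.
have K0 : 0 < K by rewrite invr_gt0 mulr_gt0// exprn_gt0.
pose P y := \sum_j h j y ^+ 2.
have P0 y : 0 <= P y by apply: sumr_ge0 => j _; exact: sqr_ge0.
have cP (Y : nat -> 'rV[R]_d) y : Y @ ultraN --> y -> P \o Y @ ultraN --> P y.
  move=> Yy; apply: cvg_bigsum => j _.
  have c1 : (fun n => h j (Y n)) @ ultraN --> h j y.
    by apply: continuous_cvg => //; exact: nice_continuous.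
  by rewrite expr2; apply: cvgM.
have rho0 : 0 < 2 * k * r by rewrite !mulr_gt0.
have [||||Y [y0 [Yy0 Py0 _ Yrho Ymin]]] := @penalty_method R d
    (fun y => infeasibility y + K * dotv (y - x) (y - x)) P x x (2 * k * r) _ cP _ P0.
- move=> Y y Yy; apply: cvgD; first exact: cvg_infeasibility.
  by apply: cvgM; [exact: cvg_cst|apply: cvg_dotv; apply: cvgB => //; exact: cvg_cst].
- by move=> y; rewrite addr_ge0 ?infeasibility_ge0// mulr_ge0 ?dotvv_ge0// ltW.
- by rewrite /P big1// => j _; rewrite hx expr0n.
- by rewrite subrr normr0 ltW.
have Phi n : infeasibility (Y n) + K * dotv (Y n - x) (Y n - x) <= r.
  have := Ymin n x; rewrite subrr normr0 dotv0l mulr0 addr0 (ltW rho0) => /(_ isT).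
  have -> : P x = 0 by rewrite /P big1// => j _; rewrite hx expr0n.
  rewrite mulr0 addr0; apply: le_trans; rewrite lerDl mulr_ge0//.
have Yk n : `|Y n - x| <= k * r.
  rewrite -(ler_pXn2r (n := 2)) ?nnegrE ?normr_ge0 ?mulr_ge0 ?(ltW k0) ?(ltW rx)//.
  apply: le_trans (sqr_norm_le_dotv _) _.
  rewrite -(ler_pM2l K0).
  have -> : K * (k * r) ^+ 2 = r.
    by rewrite /K; field; rewrite !gt_eqF.
  by have := Phi n; have := infeasibility_ge0 (Y n); lra.
have hy0 j : h j y0 = 0.
  apply/eqP; rewrite -sqrf_eq0 eq_le sqr_ge0 andbT -Py0 /P (bigD1 j)//= lerDl.
  by apply: sumr_ge0 => i _; exact: sqr_ge0.
have y0k : `|y0 - x| <= k * r.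
  apply: ler_cvg_to (cvg_norm (cvgB Yy0 (cvg_cst x))) (cvg_cst _) _.
  exact: ultraN_all.
(* A feasible limit would lie within [k * r] of [x], which [Hx] excludes. *)
have ry0 : 0 < infeasibility y0.
  apply: infeasibility_gt0; apply: contrapT => /forallNP nf.
  have := Hx y0; rewrite distrC ltNge y0k => /(_ _ hy0) Hf.
  suff : false by []; apply: Hf => l; rewrite leNgt; apply/negP; exact: nf.
have tr : 0 < t * (infeasibility y0 / 2) by rewrite mulr_gt0// divr_gt0.
have r2 : 0 < infeasibility y0 / 2 by rewrite divr_gt0.
have /ultraN_ex [n [k1 k2]] : \forall n \near ultraN,
    infeasibility y0 / 2 < infeasibility (Y n) /\
    forall j, `|h j (Y n)| <= t * (infeasibility y0 / 2).
  near=> n; split.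
    have : `|infeasibility y0 - (infeasibility \o Y) n| < infeasibility y0 / 2.
      by near: n; exact: cvgr_dist_lt (cvg_infeasibility Yy0) _ r2.
    by rewrite ltr_norml /= => /andP[_]; lra.
  near: n; apply: filter_forall => j.
  have c1 : (fun n => h j (Y n)) @ ultraN --> h j y0.
    by apply: continuous_cvg => //; exact: nice_continuous.
  near=> n; have : `|h j y0 - h j (Y n)| < t * (infeasibility y0 / 2).
    by near: n; exact: cvgr_dist_lt c1 _ tr.
  by rewrite hy0 sub0r normrN => /ltW.
have rYn : 0 < infeasibility (Y n) by apply: lt_trans k1.
have [||||v vf rel] := @penalty_multipliers R d m T f h gh f_nice h_nice hN_nice h_grad hN_grad
    [set: T]%SET (2 * infeasibility (Y n))^-1 n%:R K (Y n) x => //.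
- by rewrite invr_ge0 mulr_ge0// ltW.
- exact: ltW.
- have kr : k * r < 2 * k * r by rewrite -mulrA ltr_pMl ?mulr_gt0// ltr1n.
  apply/near_rVP; exists (2 * k * r - `|Y n - x|).
    by rewrite subr_gt0; apply: le_lt_trans (Yk n) kr.
  move=> y' y'r; have y'z : `|y' - x| <= 2 * k * r.
    have -> : y' - x = (y' - Y n) + (Y n - x) by rewrite addrA subrK.
    by apply: le_trans (ler_normD _ _) _; lra.
  have := Ymin n y' y'z.
  have setTE y : \sum_(l in [set: T]%SET) pos (f l y) ^+ 2 = infeasibility y ^+ 2.
    by rewrite sqr_infeasibility; apply: eq_bigl => l; rewrite inE.
  rewrite !setTE /P => Hmin.
  (* Concavity of the square root passes from the norm to its square, whose multipliers are known;
     hence the weight [(2 * infeasibility (Y n))^-1]. *)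
  have : infeasibility y' - infeasibility (Y n) <= (2 * infeasibility (Y n))^-1 *
      (infeasibility y' ^+ 2 - infeasibility (Y n) ^+ 2).
    rewrite mulrC ler_pdivlMr ?mulr_gt0//.
    by have := sqr_ge0 (infeasibility y' - infeasibility (Y n)); rewrite !expr2; lra.
  lra.
exists (Y n), v, (fun j => 2 * n%:R * h j (Y n)); split => //.
- rewrite rYn /=; have := Phi n; have : 0 <= K * dotv (Y n - x) (Y n - x).
    by rewrite mulr_ge0 ?dotvv_ge0// ltW.
  lra.
- by move=> j; apply: le_trans (k2 j) _; rewrite ler_wpM2l ?(ltW t0)// ltW.
- have -> : \sum_l (pos (f l (Y n)) / infeasibility (Y n)) *: v l =
    \sum_(l in [set: T]%SET) (2 * (2 * infeasibility (Y n))^-1 * pos (f l (Y n))) *: v l.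
    apply: eq_big => [l|l _]; first by rewrite inE.
    by congr (_ *: _); field; rewrite gt_eqF.
  rewrite rel normrZ distrC gtr0_norm ?mulr_gt0//.
  apply: (@le_trans _ _ (2 * K * (k * r))); first by rewrite ler_wpM2l// mulr_ge0// ltW.
  by rewrite le_eqVlt; apply/orP; left; apply/eqP; rewrite /K; field; rewrite !gt_eqF.
Unshelve. all: by end_near. Qed.

Definition bad_sequence (xs : nat -> 'rV[R]_d) := forall n : nat,
  [/\ `|xs n - xbar| < n.+1%:R^-1, forall j, h j (xs n) = 0 &
   forall y, (forall l, f l y <= 0) -> (forall j, h j y = 0) ->
     n.+1%:R * infeasibility (xs n) < `|xs n - y|].

Lemma bad_sequence_cvg xs : bad_sequence xs -> xs @ ultraN --> xbar.
Proof.
move=> bad; apply/cvgrPdist_lt => r r0; near=> n; have [k _ _] := bad n.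
by rewrite distrC; apply: lt_trans k _; near: n; exact: ultraN_inv.
Unshelve. all: by end_near. Qed.

Lemma bad_sequence_infeasible xs n : bad_sequence xs -> exists l, 0 < f l (xs n).
Proof.
move=> bad; apply: contrapT => /forallNP nf; have [_ hx /(_ (xs n))] := bad n.
rewrite subrr normr0 => /(_ _ hx) H; suff : n.+1%:R * infeasibility (xs n) < 0.
  by rewrite ltNge mulr_ge0// infeasibility_ge0.
by apply: H => l; rewrite leNgt; apply/negP; exact: nf.
Qed.

Lemma bad_sequence_small xs n : bad_sequence xs ->
  n.+1%:R * infeasibility (xs n) < `|xs n - xbar|.
Proof. by move=> /(_ n) [_ _ H]; apply: H => k; rewrite ?f_xbar ?h_xbar. Qed.

Lemma infeasibility_xbar : infeasibility xbar = 0.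
Proof.
apply/eqP; rewrite eq_le infeasibility_ge0 andbT.
apply: le_trans (infeasibility_le_sum _) _.
by rewrite big1// => l _; rewrite f_xbar pos_le0.
Qed.

(* Along points that are nearly critical for the infeasibility measure, a
   minimal positive relation between the limiting subgradients is a circuit. *)
Lemma critical_circuit (z : nat -> 'rV[R]_d) (v : nat -> T -> 'rV[R]_d) (a : nat -> T -> R)
    (b : nat -> 'I_m -> R) :
  z @ ultraN --> xbar -> (forall n, z n != xbar) ->
  (forall n l, regular_subdiff (f l) (z n) (v n l)) ->
  (forall n l, 0 <= a n l <= 1) -> (forall n, \sum_l a n l ^+ 2 = 1) ->
  (forall n, `|\sum_l a n l *: v n l + \sum_j b n j *: gh j (z n)| <= 2 / n.+1%:R) ->
  exists lam S, [/\ S != finset.set0, forall l, (fun n => a n l) @ ultraN --> lam l,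
    forall l, l \in S -> 0 < lam l &
    \forall n \near ultraN, circuit S (z n) (v n)].
Proof.
move=> zx zn sv a01 a1 rel.
have [|lam Hlam] := @ultraN_Rs R T a 1.
  by apply: ultraN_all => n l; have /andP[a0 ?] := a01 n l; rewrite ger0_norm.
have [vl Hvl] : exists vl, forall l, (fun n => v n l) @ ultraN --> vl l.
  suff : forall l, exists w : 'rV[R]_d, (fun n => v n l) @ ultraN --> w.
    by move=> /choice [vl Hvl]; exists vl.
  move=> l; have [r [L [r0 L0 HL]]] := nice_bound xbar (f_nice l).
  have [|w _ vw] := @ultraN_rV R d (fun n => v n l) L; last by exists w.
  near=> n; apply: (HL (z n)) => //.
  by rewrite distrC; near: n; exact: cvgr_dist_lt zx _ r0.
pose w n := \sum_l a n l *: v n l.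
have cw : w @ ultraN --> \sum_l lam l *: vl l.
  by apply: cvg_bigsum => l _; apply: cvgZ; [exact: Hlam|exact: Hvl].
have inv2 : (fun n => 2 / n.+1%:R : R) @ ultraN --> (0 : R).
  rewrite -[X in _ --> X](mulr0 (2 : R)); apply: cvgM; first exact: cvg_cst.
  exact: cvg_ultraN_inv.
have cb : (fun n => w n + \sum_j b n j *: gh j (z n)) @ ultraN --> (0 : 'rV[R]_d).
  apply/cvgrPdist_lt => r r0; near=> n; rewrite sub0r normrN.
  apply: le_lt_trans (rel n) _.
  have n0 : 0 <= 2 / n.+1%:R :> R by rewrite divr_ge0.
  rewrite -[X in X < _](ger0_norm n0) -normrN -sub0r; near: n.
  exact: cvgr_dist_lt inv2 _ r0.
have spz : \forall n \near ultraN, forall j, exists mu : 'I_m -> R,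
    gh j (z n) = \sum_(i in I1) mu i *: gh i (z n) by exact: (zx _ gh_span).
have /ultraN_choice [mu Hmu] : \forall n \near ultraN, exists mu : 'I_m -> R,
    \sum_j b n j *: gh j (z n) = \sum_(i in I1) mu i *: gh i (z n).
  by apply: filterS spz => n /gh_sum_span; exact.
pose c n (k : T + 'I_m) := match k with inl l => a n l | inr i => mu n i end.
have cV S := cvg_vec (S := S) (I1 := I1) gh_cont zx (fun l _ => Hvl l).
have cE n : lincomb (idx finset.set0) (c n) (vec (z n) (v n)) =
    \sum_(i in I1) mu n i *: gh i (z n).
  by rewrite lincomb_idx big_set0 add0r.
(* Only the coefficients on [I1] need a bound: the [a n l] lie in [[0, 1]], and the approximate
   relation then bounds the equality part. *)
have [||cl Hcl] := @coef_limit R d _ _ _ (vec xbar vl) c (`|\sum_l lam l *: vl l| + 2) (cV finset.set0).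
- move=> e nt; have := gh_indep nt; by rewrite !lincomb_idx !big_set0.
- near=> n; rewrite cE.
  have <- : \sum_j b n j *: gh j (z n) = \sum_(i in I1) mu n i *: gh i (z n) by near: n.
  have k1 : `|0 - (w n + \sum_j b n j *: gh j (z n))| < 1.
    by near: n; exact: cvgr_dist_lt cb _ ltr01.
  have k2 : `|\sum_l lam l *: vl l - w n| < 1.
    by near: n; exact: cvgr_dist_lt cw _ ltr01.
  have E (p1 p2 p3 : 'rV[R]_d) : p3 = p1 - p2 - p1 - (0 - (p2 + p3)).
    by apply/rowP => i; rewrite !mxE; ring.
  rewrite [X in `|X| <= _](E (\sum_l lam l *: vl l) (w n)).
  apply: le_trans (ler_normB _ _) _; apply: le_trans (lerD (ler_normB _ _) (lexx _)) _.
  lra.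
pose c0 (k : T + 'I_m) := match k with inl l => lam l | inr i => cl (inr i) end.
have lam_ge0 l : 0 <= lam l.
  apply: ler_cvg_to (cvg_cst _) (Hlam l) _; apply: ultraN_all => n.
  by case/andP: (a01 n l).
pose S0 := [set l | 0 < lam l]%SET.
have lam0 l : l \notin S0 -> lam l = 0.
  by rewrite inE -leNgt => k; apply/eqP; rewrite eq_le k lam_ge0.
have rel0 : lincomb (idx S0) c0 (vec xbar vl) = 0.
  rewrite (@lincomb_support _ _ _ _ _ [set: T]%SET); [|exact: finset.subsetT|by move=> l _ /lam0].
  have c1 : (fun n => w n + \sum_j b n j *: gh j (z n)) @ ultraN -->
      lincomb (idx [set: T]%SET) c0 (vec xbar vl).
    rewrite lincomb_idx; apply: cvgD.
      by rewrite (eq_bigl xpredT); [exact: cw|move=> l; rewrite inE].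
    apply: (@cvg_trans _ ((fun n => \sum_(i in I1) mu n i *: gh i (z n)) @ ultraN)).
      by apply: near_eq_cvg; apply: filterS Hmu => n ->.
    apply: cvg_bigsum => i iI; apply: cvgZ.
      by apply: (Hcl (inr i)); rewrite inE.
    by apply: continuous_cvg => //; exact: gh_cont.
  exact: cvg_unique c1 cb.
have lam1 : \sum_l lam l ^+ 2 = 1.
  have c1 : (fun n => \sum_l a n l ^+ 2) @ ultraN --> \sum_l lam l ^+ 2.
    by apply: cvg_bigsum => l _; rewrite expr2; apply: cvgM; exact: Hlam.
  apply: (cvg_unique _ c1) => //; apply: cvg_near_cst.
  by apply: ultraN_all.
have S00 : S0 != finset.set0.
  apply/negP => /eqP S0E; move: lam1; rewrite big1 => [/eqP|l _].
    by rewrite eq_sym oner_eq0.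
  by rewrite lam0 ?S0E ?inE// expr0n.
(* Supports of positive relations inside the support of [lam]; one of least cardinality leaves room
   for no nonnegative relation with a zero. *)
pose Q (S : {set T}) := [&& S != finset.set0, S \subset S0 & `[< exists2 c : T + 'I_m -> R,
   forall l, l \in S -> 0 < c (inl l) & lincomb (idx S) c (vec xbar vl) = 0 >]].
have QS0 : Q S0.
  apply/and3P; split => //; apply/asboolP; exists c0 => // l.
  by rewrite inE.
case: (arg_minnP (fun S : {set T} => #|S|) QS0) => S /and3P[Sn0 SS0 /asboolP [c1 c1p rel1]] Smin.
exists lam, S; split => //.
  by move=> l /(fintype.subsetP SS0); rewrite inE.
have svl : subgrads S xbar vl.
  move=> l _; apply: nice_closed (f_nice l) zx (Hvl l) _.
  exact: ultraN_all.
have nt1 : nontriv (idx S) c1.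
  have /finset.set0Pn [l lS] := Sn0.
  by exists (inl l); [rewrite inE|rewrite gt_eqF// c1p].
have circ : circuit S xbar vl.
  apply: circuit_of_nonneg nt1 rel1 _ _; first by move=> l /c1p /ltW.
  move=> c2 nt2 rel2 c2ge0.
  pose S' := [set l in S | 0 < c2 (inl l)]%SET.
  have S'S : S' \subset S by apply/fintype.subsetP => l; rewrite inE => /andP[].
  have c20 l : l \in S -> l \notin S' -> c2 (inl l) = 0.
    move=> lS; rewrite inE lS /= -leNgt => k.
    by apply/eqP; rewrite eq_le k c2ge0.
  have QS' : Q S'.
    apply/and3P; split.
    - apply/negP => /eqP S'E; apply: (not_nontriv_h gh_indep _ rel2) nt2 => l lS.
      by apply: c20 => //; rewrite S'E inE.
    - exact: fintype.subset_trans SS0.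
    - apply/asboolP; exists c2; first by move=> l; rewrite inE => /andP[].
      by rewrite (lincomb_support _ _ S'S c20).
  have /eqP SE : S' == S by rewrite eqEcard S'S Smin.
  by move=> l; rewrite -{1}SE inE => /andP[].
apply: (circuit_open gh_cont rc Sn0 svl circ zx) => [| |l _].
- exact: ultraN_all.
- by apply: ultraN_all => n l _.
- exact: Hvl.
Unshelve. all: by end_near. Qed.

(** The witnesses are replaced by nearly critical points [z n]. There the [f l] with [l \in S] are
    violated in proportion to the infeasibility [r n], so the distance to the set cut out by [S] is
    at least a multiple of [r n]. *)
Lemma no_bad_sequence_ge2 xs : (1 < d)%N -> bad_sequence xs -> False.
Proof.
move=> d1 bad; have xx := bad_sequence_cvg bad.
have /choice [q Hq] : forall n : nat, exists q : ('rV[R]_d * (T -> 'rV[R]_d)) * ('I_m -> R),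
  [/\ `|q.1.1 - xs n| <= n.+1%:R * infeasibility (xs n),
    0 < infeasibility q.1.1 <= infeasibility (xs n),
    forall j, `|h j q.1.1| <= n.+1%:R^-1 ^+ 2 * infeasibility q.1.1,
    forall l, regular_subdiff (f l) q.1.1 (q.1.2 l) &
    `|\sum_l (pos (f l q.1.1) / infeasibility q.1.1) *: q.1.2 l +
      \sum_j q.2 j *: gh j q.1.1| <= 2 / n.+1%:R].
  move=> n; have [_ hx Hx] := bad n.
  (* The square leaves room for the constant [kappa]: the residual of [h] has to be at most
     [kappa * r n / n.+1]. *)
  have [|||||z [v [b Hz]]] := @infeasible_stationary (xs n) n.+1%:R (n.+1%:R^-1 ^+ 2) => //.
  - by apply: infeasibility_gt0; exact: bad_sequence_infeasible.
  - by exists ((z, v), b).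
pose z n := (q n).1.1; pose v n := (q n).1.2; pose r n := infeasibility (z n).
have r0 n : 0 < r n by case: (Hq n) => _ /andP[].
have zx : z @ ultraN --> xbar.
  apply/cvgrPdist_lt => s s0; near=> n; have [k1 _ _ _ _] := Hq n.
  have k2 := bad_sequence_small n bad.
  have k3 : `|xbar - xs n| < s / 2 by near: n; apply: cvgr_dist_lt xx _ _; rewrite divr_gt0.
  rewrite distrC; have -> : z n - xbar = (z n - xs n) + (xs n - xbar) by rewrite addrA subrK.
  apply: le_lt_trans (ler_normD _ _) _; rewrite distrC in k3.
  rewrite [ltRHS]splitr ltrD// /z; apply: le_lt_trans k1 _; exact: lt_trans k2 k3.
have zn n : z n != xbar.
  by apply/eqP => zE; have := r0 n; rewrite /r zE infeasibility_xbar ltxx.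
pose a n l := pos (f l (z n)) / r n.
have a01 n l : 0 <= a n l <= 1.
  by rewrite divr_ge0 ?pos_ge0 ?(ltW (r0 n))//= ler_pdivrMr// mul1r pos_le_infeasibility.
have a1 n : \sum_l a n l ^+ 2 = 1.
  rewrite -[RHS](@divff _ (r n ^+ 2)) ?sqrf_eq0 ?gt_eqF// {1}/r sqr_infeasibility mulr_suml.
  by apply: eq_bigr => l _; rewrite /a expr_div_n /r sqr_infeasibility.
have [||lam [S [S0 Hlam Slam circ]]] := @critical_circuit z v a (fun n => (q n).2) zx zn _ a01 a1.
- by move=> n l; case: (Hq n) => _ _ _ h4 _; exact: h4.
- by move=> n; case: (Hq n) => _ _ _ _; exact.
have [e e0 [all loc]] := circuit_locally f_nice gh_cont gh_indep rc S0.
have near_e : \forall n \near ultraN, punctured xbar e (z n).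
  near=> n; split => //.
  by rewrite distrC; near: n; exact: cvgr_dist_lt zx _ e0.
have [n0 [cn0 pn0]] := ultraN_ex (filterI circ near_e).
have vn0 : subgrads S (z n0) (v n0) by move=> l _; case: (Hq n0) => _ _ _ h4 _; exact: h4.
have allc x w : punctured xbar e x -> subgrads S x w -> circuit S x w.
  move=> px sw; have [|w' sw' cw'] := has_circuit_everywhere d1 e0 loc pn0 px.
    by exists (v n0).
  exact: all cw' sw.
have /finset.set0Pn [l0 l0S] := S0.
have [lip _] := f_nice l0; have [s [L [s0 L0 HL]]] := lip xbar.
have L1 : 0 < L + 1 by rewrite ltr_wpDl.
(* Near [xbar] the value [f l0 (z n)] is at least [lam l0 / 2 * r n] and [f l0] is [L]-Lipschitz, so
   points with [f l0 <= 0] are at least [kappa * r n] away; [L + 1] is never zero. *)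
pose kappa := lam l0 / 2 / (L + 1).
have kappa0 : 0 < kappa by rewrite !divr_gt0// Slam.
have fpos n l : 0 < a n l -> f l (z n) = a n l * r n.
  rewrite /a divfK ?gt_eqF// pmulr_lgt0 ?invr_gt0// => k.
  have [k1|k1] := leP 0 (f l (z n)); first by rewrite pos_id.
  by move: k; rewrite pos_le0 ?ltxx// ltW.
have aS : \forall n \near ultraN, forall l, l \in S -> 0 < a n l.
  apply: filter_forall => l; have [lS|lS] := boolP (l \in S); last exact: ultraN_all.
  near=> n => _; have : `|lam l - a n l| < lam l by near: n; exact: cvgr_dist_lt (Hlam l) _ (Slam l lS).
  by rewrite ltr_norml => /andP[_]; lra.
have lam2 : 0 < lam l0 / 2 by rewrite divr_gt0// Slam.
have r_0 : r @ ultraN --> (0 : R).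
  by rewrite -infeasibility_xbar; exact: cvg_infeasibility.
have s2 : 0 < s / 2 by rewrite divr_gt0.
apply: (@no_bad_sequence S e z (fun n => kappa * r n) e0 (fun _ => allc) zx).
near=> n.
have aSn : forall l, l \in S -> 0 < a n l by near: n.
have an0 : lam l0 / 2 < a n l0.
  have : `|lam l0 - a n l0| < lam l0 / 2 by near: n; exact: cvgr_dist_lt (Hlam l0) _ lam2.
  by rewrite ltr_norml => /andP[_]; lra.
have kL : kappa * (L + 1) = lam l0 / 2 by rewrite divfK// gt_eqF.
have zs : `|z n - xbar| < s / 2.
  by rewrite distrC; near: n; apply: cvgr_dist_lt zx _ _; rewrite divr_gt0.
have kr : kappa * r n < s / 2.
  rewrite mulrC -ltr_pdivlMr//; have : `|0 - r n| < s / 2 / kappa.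
    by near: n; apply: cvgr_dist_lt r_0 _ _; exact: divr_gt0 s2 kappa0.
  by rewrite sub0r normrN; apply: le_lt_trans; exact: ler_norm.
have r0n := r0 n.
split => //.
- exact: mulr_gt0.
- move=> y [fy hy]; have [ys|ys] := ltP `|y - xbar| s.
    have zs' : `|z n - xbar| < s by lra.
    have := HL (z n) y zs' ys => k1; have k2 := ler_norm (f l0 (z n) - f l0 y).
    have k3 := fy l0 l0S; have k4 := fpos n l0 (aSn l0 l0S).
    have k5 : lam l0 / 2 * r n <= a n l0 * r n by rewrite ler_wpM2r// ltW.
    rewrite -(ler_pM2r L1) mulrAC kL.
    have := normr_ge0 (z n - y); lra.
  have k1 : y - xbar = (z n - xbar) - (z n - y) by apply/rowP => i; rewrite !mxE; ring.
  by have := ler_normB (z n - xbar) (z n - y); rewrite -k1; lra.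
- move=> j; case: (Hq n) => _ _ /(_ j) k _ _; apply: le_trans k _.
  rewrite -/(z n) -/(r n) expr2 mulrAC ler_wpM2r ?invr_ge0// ler_wpM2r ?(ltW r0n)//.
  by apply: ltW; near: n; exact: ultraN_inv.
- move=> l lS; rewrite (fpos n l (aSn l lS)); apply: (@le_trans _ _ 0).
    by rewrite oppr_le0 divr_ge0// mulr_ge0// ltW.
  by rewrite mulr_ge0// ltW// aSn.
Unshelve. all: by end_near. Qed.

(** A punctured interval is disconnected, so circuits need not propagate. Instead, a vector
    orthogonal to the unit direction [u] is now 0, which applies to the gradients of [h] at [xbar]
    and to a limiting subgradient of a violated constraint. *)
Lemma no_bad_sequence_le1 xs : (d <= 1)%N -> bad_sequence xs -> False.
Proof.
move=> d1 bad; have xx := bad_sequence_cvg bad.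
have xn n : 0 < `|xs n - xbar|.
  by apply: le_lt_trans (bad_sequence_small n bad); rewrite mulr_ge0 ?infeasibility_ge0.
pose us n := `|xs n - xbar|^-1 *: (xs n - xbar).
have us1 n : `|us n| = 1 by rewrite normrZ normfV normr_id mulVf// gt_eqF.
have [|u _ usu] := @ultraN_rV R d us 1; first by apply: ultraN_all => n; rewrite us1.
have u1 : `|u| = 1.
  apply: (cvg_unique _ (cvg_norm usu)) => //; apply: cvg_near_cst.
  exact: ultraN_all.
have dot0 (w : 'rV[R]_d) : dotv w u = 0 -> w = 0.
  move=> wu; apply/rowP => j; rewrite mxE.
  have one (a b : 'rV[R]_d) : dotv a b = a 0 j * b 0 j.
    rewrite /dotv (bigD1 j)//= big1 ?addr0// => i /eqP ij; exfalso; apply: ij.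
    apply: val_inj => /=; have := ltn_ord i; have := ltn_ord j.
    by case: (val i) (val j) => [|?] [|?]; move: d1; case: d => [|[|?]].
  move: wu; rewrite one => /eqP; rewrite mulf_eq0 => /orP[/eqP //|/eqP uj].
  have : u = 0 by apply: dotvv_eq0; rewrite one uj mulr0.
  by move=> u0; move: u1; rewrite u0 normr0 => /eqP; rewrite eq_sym oner_eq0.
have xneq : \forall n \near ultraN, xbar != xs n.
  by apply: ultraN_all => n; rewrite eq_sym -subr_eq0 -normr_gt0.
have gu j : gh j xbar = 0.
  have cst0 : (fun=> 0) @ ultraN --> (0 : R) by exact: cvg_cst.
  have [|w /h_grad -> w0] := mean_slope (h_nice j) (cvg_cst xbar) xx xneq usu cst0.
    by apply: ultraN_all => n; have [_ -> _] := bad n; rewrite h_xbar subrr mul0r oppr0.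
  have [|w' /hN_grad -> w0'] := mean_slope (hN_nice j) (cvg_cst xbar) xx xneq usu cst0.
    by apply: ultraN_all => n; have [_ -> _] := bad n; rewrite h_xbar subrr mul0r oppr0.
  by apply: dot0; apply/eqP; rewrite eq_le w0 andbT -oppr_ge0 -dotvNl.
have I10 i : i \notin I1.
  apply/negP => iI; have := gh_indep.
  move=> /(_ (fun k => if k == inr i then 1 else 0)).
  have -> : lincomb (idx finset.set0) (fun k : T + 'I_m => if k == inr i then 1 else 0)
      (vec xbar (fun=> 0)) = 0.
    rewrite lincomb_idx big_set0 add0r big1// => k _ /=; by rewrite gu scaler0.
  rewrite eqxx => H; suff : false by []; apply: H; exists (inr i); first by rewrite inE.
  by rewrite eqxx oner_eq0.
have [|l0 Hl0] := @ultraN_fin T (fun n l => 0 < f l (xs n)).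
  by apply: ultraN_all => n; exact: bad_sequence_infeasible.
have /ultraN_choice [q Hq] : \forall n \near ultraN, exists q : 'rV[R]_d * 'rV[R]_d,
    [/\ q.1 != xbar, `|q.1 - xbar| <= 2 * `|xs n - xbar|, regular_subdiff (f l0) q.1 q.2 &
     0 < dotv q.2 (us n)].
  apply: filterS Hl0 => n fl.
  have cf := nice_continuous (f_nice l0).
  have f2 : 0 < f l0 (xs n) / 2 by rewrite divr_gt0.
  have /near_rVP [s s0 Hs] : \forall x \near xbar, `|f l0 xbar - f l0 x| < f l0 (xs n) / 2.
    exact: (@cvgr_dist_lt _ _ _ (nbhs xbar) _ (f l0) _ (cf xbar) _ f2).
  have D0 := xn n; set D := `|xs n - xbar| in D0 *.
  (* Starting at [a] rather than at [xbar] keeps the mean value point off [xbar], at the price of at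
     most half of the increase of [f l0]. *)
  pose t := Num.min (1 / 2) (s / (2 * D)).
  have t0 : 0 < t by rewrite lt_min !divr_gt0// mulr_gt0.
  have t1 : t <= 1 / 2 by rewrite ge_min lexx.
  have tD : t * D < s.
    have : t <= s / (2 * D) by rewrite ge_min lexx orbT.
    by rewrite ler_pdivlMr ?mulr_gt0//; lra.
  pose a := xbar + t *: (xs n - xbar).
  have fa : f l0 a < f l0 (xs n) / 2.
    have := Hs a; rewrite /a addrAC subrr add0r normrZ gtr0_norm// => /(_ tD).
    by rewrite f_xbar sub0r normrN; apply: le_lt_trans; exact: ler_norm.
  have e1 : 0 < (f l0 (xs n) - f l0 a) / 2 by rewrite divr_gt0//; lra.
  have e2 : 0 < t * D / 2 by rewrite divr_gt0// mulr_gt0.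
  have [k [y [w [/andP[k0 k1] yk /proximal_regular wy wk]]]] :=
    approx_mean_value a (xs n) cf e1 e2.
  have xa : xs n - a = (1 - t) *: (xs n - xbar).
    by apply/rowP => i; rewrite !mxE; ring.
  have ya : y - (a + k *: (xs n - a)) = (y - xbar) - (t + k * (1 - t)) *: (xs n - xbar).
    by rewrite xa; apply/rowP => i; rewrite !mxE; ring.
  rewrite ya in yk; rewrite xa dotvZr in wk.
  have tk1 : t <= t + k * (1 - t) by rewrite lerDl mulr_ge0//; lra.
  have tk2 : t + k * (1 - t) <= 1.
    have : k * (1 - t) <= 1 * (1 - t) by rewrite ler_wpM2r//; lra.
    lra.
  have nk : `|(t + k * (1 - t)) *: (xs n - xbar)| = (t + k * (1 - t)) * D.
    by rewrite normrZ ger0_norm//; lra.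
  have h1 : t * D <= (t + k * (1 - t)) * D by rewrite ler_wpM2r// ltW.
  have h2 : (t + k * (1 - t)) * D <= 1 * D by rewrite ler_wpM2r// ltW.
  exists (y, w); split => //=.
  - rewrite -subr_eq0 -normr_gt0.
    have := lerB_dist ((t + k * (1 - t)) *: (xs n - xbar)) (y - xbar).
    by rewrite distrC nk; lra.
  - have := ler_normD (y - xbar - (t + k * (1 - t)) *: (xs n - xbar))
      ((t + k * (1 - t)) *: (xs n - xbar)).
    rewrite subrK nk; have : t * D <= 1 * D by rewrite ler_wpM2r ?(ltW D0)//; lra.
    lra.
  - rewrite dotvZr mulr_gt0 ?invr_gt0//.
    have : 0 < (1 - t) * dotv w (xs n - xbar) by lra.
    by rewrite pmulr_rgt0//; lra.
have q1x : (fun n => (q n).1) @ ultraN --> xbar.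
  apply/cvgrPdist_lt => s s0; near=> n.
  have k1 : `|(q n).1 - xbar| <= 2 * `|xs n - xbar| by near: n; apply: filterS Hq => n [].
  have k2 : `|xbar - xs n| < s / 2 by near: n; apply: cvgr_dist_lt xx _ _; rewrite divr_gt0.
  by rewrite distrC; rewrite distrC in k2; lra.
have sq : \forall n \near ultraN, regular_subdiff (f l0) (q n).1 (q n).2.
  by apply: filterS Hq => n [].
have [s [L [s0 L0 HL]]] := nice_bound xbar (f_nice l0).
have [|w _ qw] := @ultraN_rV R d (fun n => (q n).2) L.
  near=> n; apply: (HL (q n).1); last by near: n.
  by rewrite distrC; near: n; exact: cvgr_dist_lt q1x _ s0.
have wx : regular_subdiff (f l0) xbar w := nice_closed (f_nice l0) q1x qw sq.
(* The slope along [u] is nonnegative as a limit of positive slopes, and nonpositive because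
   [f l0 (xs n)] is at most [|xs n - xbar| / n.+1]. *)
have w0 : w = 0.
  apply: dot0; apply/eqP; rewrite eq_le; apply/andP; split; last first.
    apply: ler_cvg_to (cvg_cst _) (cvg_dotv qw usu) _.
    by apply: filterS Hq => n [_ _ _ /ltW].
  apply/ler_addgt0Pr => e e0; rewrite add0r.
  have e2 : 0 < e / 2 by rewrite divr_gt0.
  have [s1 s10 Hs1] := (iffLR (regular_subdiffP _ _ _) wx) _ e2.
  apply: ler_cvg_to (cvg_dotv (cvg_cst w) usu) (cvg_cst _) _.
  near=> n.
  have k1 : `|xs n - xbar| < s1.
    by rewrite distrC; near: n; exact: cvgr_dist_lt xx _ s10.
  have k2 := Hs1 _ k1; rewrite f_xbar add0r in k2.
  have k3 : n.+1%:R^-1 < e / 2 by near: n; exact: ultraN_inv.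
  have k4 := bad_sequence_small n bad.
  have k5 : f l0 (xs n) <= infeasibility (xs n).
    by apply: le_trans (pos_le_infeasibility l0 _); exact: pos_ge.
  have k6 : infeasibility (xs n) <= `|xs n - xbar| * n.+1%:R^-1.
    by rewrite ler_pdivlMr// mulrC ltW.
  rewrite dotvZr -(ler_pM2l (xn n)) mulrA divff ?gt_eqF// mul1r.
  have k7 : `|xs n - xbar| * n.+1%:R^-1 <= `|xs n - xbar| * (e / 2).
    by rewrite ler_wpM2l// ltW.
  have k8 : infeasibility (xs n) <= `|xs n - xbar| * (e / 2) by exact: le_trans k7.
  lra.
have l01 : [set l0]%SET != finset.set0.
  by apply/finset.set0Pn; exists l0; rewrite inE.
(* As [w = 0], the singleton [l0] carries a positive relation at [xbar]. The qualification makes the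
   nearby subgradients [(q n).2] dependent, that is zero, although their slope is positive. *)
have [|||e e0 He] := @rc [set l0]%SET (fun=> w) (fun k => if k is inl _ then 1 else 0) l01.
- by move=> l; rewrite inE => /eqP ->.
- by move=> l _.
- rewrite lincomb_idx /= w0 !big1 ?addr0// => [i _|l _]; first by rewrite scale0r.
  by rewrite scaler0.
have : \forall n \near ultraN, False.
  near=> n.
  have [qn _ qs qu] : [/\ (q n).1 != xbar, `|(q n).1 - xbar| <= 2 * `|xs n - xbar|,
     regular_subdiff (f l0) (q n).1 (q n).2 & 0 < dotv (q n).2 (us n)] by near: n.
  have [|||c [[l|i]]] := He (q n).1 (fun=> (q n).2) qn.
  - by rewrite distrC; near: n; exact: cvgr_dist_lt q1x _ e0.
  - by move=> l; rewrite inE => /eqP ->.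
  - by move=> l _; rewrite distrC; near: n; exact: cvgr_dist_lt qw _ e0.
  - rewrite !inE => /eqP -> cl; rewrite lincomb_idx big_set1 /= [X in _ + X]big1 ?addr0.
      move=> /eqP; rewrite scaler_eq0 (negPf cl) => /eqP q0.
      by move: qu; rewrite q0 dotv0l ltxx.
    by move=> i; rewrite (negPf (I10 i)).
  - by rewrite inE (negPf (I10 i)).
by move=> /ultraN_ex [].
Unshelve. all: by end_near. Qed.

Lemma inequality_error_bound : exists C r, [/\ 0 <= C, 0 < r &
  forall x, `|x - xbar| < r -> (forall j, h j x = 0) ->
    exists y, [/\ forall l, f l y <= 0, forall j, h j y = 0 &
      `|x - y| <= C * infeasibility x]].
Proof.
apply: contrapT => H.
have /choice [xs bad] : forall n : nat, exists x, [/\ `|x - xbar| < n.+1%:R^-1,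
    forall j, h j x = 0 & forall y, (forall l, f l y <= 0) -> (forall j, h j y = 0) ->
     n.+1%:R * infeasibility x < `|x - y|].
  move=> n; apply: contrapT => nx; apply: H; exists n.+1%:R, n.+1%:R^-1.
  split; [exact: ler0n|by rewrite invr_gt0|].
  move=> x xr hx; apply: contrapT => ny; apply: nx; exists x; split => // y fy hy.
  by rewrite ltNge; apply/negP => k; apply: ny; exists y.
by have [d1|d1] := leqP d 1; [exact: no_bad_sequence_le1 bad|exact: no_bad_sequence_ge2 bad].
Qed.

(** The equations are restored first, by a move of length at most [C1 * B]; by the Lipschitz
    property this raises the violations of the inequalities by at most [SL * (C1 * B)]. *)
Theorem system_error_bound : exists C r, [/\ 0 <= C, 0 < r &
  forall x, `|x - xbar| < r -> exists y, [/\ forall l, f l y <= 0, forall j, h j y = 0 &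
    `|x - y| <= C * (\sum_l pos (f l x) + \sum_j `|h j x|)]].
Proof.
have [C1 [r1 [C10 r10 H1]]] := equality_error_bound.
have [C2 [r2 [C20 r20 H2]]] := inequality_error_bound.
have /choice [L HL] : forall l, exists L, 0 <= L /\ exists2 r, 0 < r &
    forall y z, `|y - xbar| < r -> `|z - xbar| < r -> `|f l y - f l z| <= L * `|y - z|.
  move=> l; have [lip _] := f_nice l; have [r [L [r0 L0 Hr]]] := lip xbar.
  by exists L; split => //; exists r.
have /choice [rl Hrl] : forall l, exists r, 0 < r /\
    forall y z, `|y - xbar| < r -> `|z - xbar| < r -> `|f l y - f l z| <= L l * `|y - z|.
  by move=> l; have [_ [r r0 Hr]] := HL l; exists r.
(* All Lipschitz estimates and the second bound hold on this radius; [r4] below makes the first move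
   shorter than [r3 / 2]. *)
pose r3 := \big[Num.min/r2]_l rl l.
have r3l l : r3 <= rl l by exact: bigmin_le_cond.
have r32 : r3 <= r2 by exact: bigmin_le_id.
have r30 : 0 < r3 by apply: lt_bigmin => // l _; case: (Hrl l).
pose SL := \sum_l L l.
have SL0 : 0 <= SL by apply: sumr_ge0 => l _; case: (HL l).
have : \forall x \near xbar, C1 * \sum_j `|h j x| < r3 / 2.
  have c1 : (fun x => C1 * \sum_j `|h j x|) @ xbar --> C1 * \sum_j `|h j xbar|.
    apply: (@cvgM _ _ (nbhs xbar)); first exact: cvg_cst.
    apply: (@cvg_bigsum _ _ _ _ (nbhs xbar)) => j _; apply: (@cvg_norm _ _ _ (nbhs xbar)).
    exact: nice_continuous.
  rewrite big1 ?mulr0 in c1; last by move=> j _; rewrite h_xbar normr0.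
  have r32' : 0 < r3 / 2 by rewrite divr_gt0.
  have /near_rVP [r r0 Hr] : \forall x \near xbar, `|0 - C1 * \sum_j `|h j x| | < r3 / 2.
    exact: (@cvgr_dist_lt _ _ _ (nbhs xbar) _ _ _ c1 _ r32').
  apply/near_rVP; exists r => // x /Hr.
  by rewrite sub0r normrN; apply: le_lt_trans; exact: ler_norm.
move=> /near_rVP [r4 r40 H4].
exists (C1 + C2 * (1 + SL * C1)), (Num.min (r3 / 2) (Num.min r1 r4)); split.
- by rewrite addr_ge0// mulr_ge0// addr_ge0// mulr_ge0.
- by rewrite !lt_min r10 r40 divr_gt0.
move=> x; rewrite !lt_min => /and3P[xr3 /H1 [x1 hx1 xx1] /H4 hr].
set A := \sum_l pos (f l x); set B := \sum_j `|h j x| in xx1 hr *.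
have A0 : 0 <= A by apply: sumr_ge0 => l _; exact: pos_ge0.
have B0 : 0 <= B by exact: sumr_ge0.
have x1r : `|x1 - xbar| < r3.
  have -> : x1 - xbar = (x - xbar) - (x - x1) by apply/rowP => i; rewrite !mxE; ring.
  by apply: le_lt_trans (ler_normB _ _) _; lra.
have [y [fy hy x1y]] := H2 x1 (lt_le_trans x1r r32) hx1.
exists y; split => //.
have xr : `|x - xbar| < r3 by lra.
have fx1 : infeasibility x1 <= A + SL * (C1 * B).
  apply: le_trans (infeasibility_le_sum _) _.
  rewrite /SL mulr_suml -big_split /=; apply: ler_sum => l _.
  have [_ Hl] := Hrl l.
  have := Hl x1 x (lt_le_trans x1r (r3l l)) (lt_le_trans xr (r3l l)) => k1.
  have k2 : L l * `|x1 - x| <= L l * (C1 * B).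
    by rewrite ler_wpM2l// 1?distrC//; case: (HL l).
  have k3 := ler_norm (f l x1 - f l x); have k4 := pos_ge (f l x).
  have k5 := normr_ge0 (f l x1 - f l x).
  rewrite /pos ge_max; apply/andP; split; last by rewrite -/(pos _); lra.
  by rewrite -/(pos _); have := pos_ge0 (f l x); lra.
have -> : x - y = (x - x1) + (x1 - y) by rewrite addrA subrK.
apply: le_trans (ler_normD _ _) _.
have k1 : `|x1 - y| <= C2 * (A + SL * (C1 * B)).
  by apply: le_trans x1y _; rewrite ler_wpM2l.
have k2 : 0 <= C1 * A by rewrite mulr_ge0.
have k3 : 0 <= C2 * B by rewrite mulr_ge0.
have k4 : 0 <= C2 * SL * C1 * A by rewrite !mulr_ge0.
lra.
Qed.

End error_bound.

(** * Smooth functions, norms and bases *)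

Section gradients.
Variables (R : realType) (d : nat).
Implicit Types (f : 'rV[R]_d -> R) (G : 'rV[R]_d -> 'rV[R]_d) (x y u v w : 'rV[R]_d).

Definition has_gradient f G := forall x e, 0 < e ->
  \forall y \near x, `|f y - f x - dotv (G x) (y - x)| <= e * `|y - x|.

Lemma differentiable_expansion (W : normedModType R) (f : 'rV[R]_d -> W) x :
  differentiable f x -> forall e, 0 < e ->
  \forall y \near x, `|f y - f x - 'd f x (y - x)| <= e * `|y - x|.
Proof.
move=> /diff_locally /eqaddoP H e e0.
have /near_rVP [r r0 Hr] := H e e0; apply/near_rVP; exists r => // y yr.
have := Hr (y - x); rewrite subr0 => /(_ yr); rewrite !fctE /= subrK.
by rewrite opprD addrA.
Qed.

Lemma diff_partials (W : normedModType R) (f : 'rV[R]_d -> W) x u :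
  differentiable f x -> 'd f x u = \sum_j u 0 j *: 'D_(delta_mx 0 j) f x.
Proof.
move=> df; rewrite {1}[u]row_sum_delta linear_sum; apply: eq_bigr => j _.
by rewrite linearZ /= deriveE//.
Qed.

Lemma smooth_has_gradient f : smooth f -> has_gradient f (grad f).
Proof.
move=> [df _] x e e0; have /near_rVP [r r0 Hr] := differentiable_expansion (df x) e0.
apply/near_rVP; exists r => // y /Hr; rewrite diff_partials//.
suff -> : \sum_j (y - x) 0 j *: 'D_(delta_mx 0 j) f x = dotv (grad f x) (y - x) by [].
by apply: eq_bigr => j _; rewrite [RHS]mulrC [X in _ = _ * X]mxE.
Qed.

Lemma rV_continuous G : (forall j, continuous (fun x => G x 0 j)) -> continuous G.
Proof.
move=> cG x; apply/(@cvgrPdist_lt _ _ _ (nbhs x)) => e e0.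
have : \forall y \near x, forall j, `|G x 0 j - G y 0 j| < e / 2.
  apply: (@filter_forall _ _ _ (nbhs x)) => j.
  by apply: (@cvgr_dist_lt _ _ _ (nbhs x) _ _ _ (cG j x)); rewrite divr_gt0.
move=> /near_rVP [r r0 Hr]; apply/near_rVP; exists r => // y /Hr {}Hr.
apply: (@le_lt_trans _ _ (e / 2)); last by lra.
apply: norm_le_coord => [|j]; first by rewrite divr_ge0// ltW.
by rewrite !mxE ltW.
Qed.

Lemma smooth_grad_continuous f : smooth f -> continuous (grad f).
Proof.
move=> [_ cf]; apply: rV_continuous => j.
rewrite (_ : (fun x => grad f x 0 j) = (fun x => 'D_(delta_mx 0 j) f x)); first exact: cf.
by apply/funext => x; rewrite mxE.
Qed.

Lemma has_gradient_grad f G : has_gradient f G -> forall x, grad f x = G x.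
Proof.
move=> fG x; apply/rowP => j; rewrite mxE; apply/cvg_lim => //.
apply/cvgrPdist_le => e e0; have /near_rVP [r r0 Hr] := fG x e e0.
have nd : `|delta_mx 0 j : 'rV[R]_d| <= 1.
  apply: norm_le_coord => // i; rewrite !mxE eqxx /=.
  by case: eqP => _; rewrite ?normr1 ?normr0.
have dj : dotv (G x) (delta_mx 0 j) = G x 0 j.
  rewrite /dotv (bigD1 j)//= mxE !eqxx mulr1 big1 ?addr0// => i ij.
  by rewrite mxE (negPf ij) andbF mulr0.
near=> t.
have t0 : t != 0 by near: t; exact: nbhs_dnbhs_neq.
have tr : `|t| < r by near: t; apply: dnbhs0_lt.
have := Hr (x + t *: delta_mx 0 j); rewrite addrAC subrr add0r dotvZr dj => H.
have nt : `|t *: (delta_mx 0 j : 'rV[R]_d)| <= `|t|.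
  by rewrite normrZ ler_piMr.
have {}H := H (le_lt_trans nt tr).
rewrite /= [t *: _ + x]addrC distrC -(ler_pM2l (_ : 0 < `|t|)) ?normr_gt0//.
rewrite -normrM mulrBr [t * (_ *: _)]mulrA divff// mul1r.
by apply: le_trans H _; rewrite mulrC ler_wpM2r// ltW.
Unshelve. all: by end_near. Qed.

Lemma component_has_gradient m (h : 'rV[R]_d -> 'rV[R]_m) i : smooth h ->
  has_gradient (component h i) (fun x => \row_j ('D_(delta_mx 0 j) h x) 0 i).
Proof.
move=> [df _] x e e0; have /near_rVP [r r0 Hr] := differentiable_expansion (df x) e0.
apply/near_rVP; exists r => // y /Hr; rewrite diff_partials//.
apply: le_trans; apply: le_trans (ler_coord_norm _ i).
rewrite !mxE summxE /component /dotv.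
rewrite le_eqVlt; apply/orP; left; apply/eqP; congr (`|_ - _|).
by apply: eq_bigr => j _; rewrite !mxE mulrC.
Qed.

Lemma component_grad_continuous m (h : 'rV[R]_d -> 'rV[R]_m) i : smooth h ->
  continuous (grad (component h i)).
Proof.
move=> sh; have := component_has_gradient i sh; case: sh => _ ch.
move=> /has_gradient_grad gE; apply: rV_continuous => j.
rewrite (_ : (fun x => _) = (fun x => ('D_(delta_mx 0 j) h x) 0 i)); last first.
  by apply/funext => x; rewrite gE mxE.
by move=> x; apply: (@cvg_coord _ _ _ (nbhs x)); exact: ch.
Qed.

Lemma component_has_grad m (h : 'rV[R]_d -> 'rV[R]_m) i : smooth h ->
  has_gradient (component h i) (grad (component h i)).
Proof.
move=> sh; have fG := component_has_gradient i sh.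
by move=> x e e0; rewrite (has_gradient_grad fG); exact: fG.
Qed.

Lemma has_gradient_affine f G (s c : R) : has_gradient f G ->
  has_gradient (fun x => s * (f x - c)) (fun x => s *: G x).
Proof.
move=> fG x e e0; have e1 : 0 < e / (`|s| + 1) by rewrite divr_gt0// ltr_wpDl.
have /near_rVP [r r0 Hr] := fG x _ e1; apply/near_rVP; exists r => // y /Hr H.
have -> : s * (f y - c) - s * (f x - c) - dotv (s *: G x) (y - x) =
   s * (f y - f x - dotv (G x) (y - x)) by rewrite dotvZl; ring.
rewrite normrM; apply: le_trans (ler_wpM2l (normr_ge0 s) H) _.
rewrite mulrA ler_wpM2r// mulrA ler_pdivrMr ?ltr_wpDl//.
by rewrite mulrC ler_pM2l// lerDl.
Qed.

Lemma has_gradient_opp f G : has_gradient f G ->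
  has_gradient (fun x => - f x) (fun x => - G x).
Proof.
move=> fG x e /(fG x) /near_rVP [r r0 Hr]; apply/near_rVP; exists r => // y /Hr.
by rewrite dotvNl -!opprD normrN.
Qed.

Lemma has_gradient_continuous f G : has_gradient f G -> continuous f.
Proof.
move=> fG x; apply/(@cvgrPdist_lt _ _ _ (nbhs x)) => e e0.
have /near_rVP [r r0 Hr] := fG x 1 ltr01.
pose C := 1 + d%:R * `|G x|.
have C0 : 0 < C by rewrite ltr_pwDl// mulr_ge0.
apply/near_rVP; exists (Num.min r (e / C)); first by rewrite lt_min r0 divr_gt0.
move=> y; rewrite lt_min => /andP[/Hr H]; rewrite ltr_pdivlMr// => yC.
have h1 := ler_dotv (G x) (y - x).
have h2 := ler_normD (f y - f x - dotv (G x) (y - x)) (dotv (G x) (y - x)).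
rewrite subrK in h2; rewrite distrC; apply: le_lt_trans yC.
by rewrite /C mulrDr mulr1; lra.
Qed.

(** Testing the subgradient inequality against the expansion along [w = v - G x] bounds [dotv w w]
    by every positive [e]. *)
Lemma has_gradient_subdiff f G x v : has_gradient f G -> regular_subdiff f x v -> v = G x.
Proof.
move=> fG vx; apply/eqP; rewrite -subr_eq0; apply/eqP/dotvv_eq0.
set w := v - G x; apply/eqP; rewrite eq_le dotvv_ge0 andbT.
apply/ler_addgt0Pr => e e0; rewrite add0r.
have c0 : 0 < 2 * (`|w| + 1) by rewrite mulr_gt0// ltr_wpDl.
have e1 : 0 < e / (2 * (`|w| + 1)) by rewrite divr_gt0.
have [r1 r10 H1] := (iffLR (regular_subdiffP _ _ _) vx) _ e1.
have /near_rVP [r2 r20 H2] := fG x _ e1.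
pose t := Num.min r1 r2 / (2 * (`|w| + 1)).
have m0 : 0 < Num.min r1 r2 by rewrite lt_min r10.
have t0 : 0 < t by rewrite divr_gt0.
have xw : x + t *: w - x = t *: w by rewrite addrAC subrr add0r.
have tw : `|x + t *: w - x| < Num.min r1 r2.
  rewrite xw normrZ gtr0_norm// /t mulrAC ltr_pdivrMr// ltr_pM2l//.
  by have := normr_ge0 w; lra.
move: tw; rewrite lt_min => /andP[/H1 k1 /H2 k2].
move: k1 k2; rewrite xw !dotvZr normrZ (gtr0_norm t0) ler_norml.
move=> k1 /andP[_ k2].
have k3 : t * dotv w w <= t * (2 * (e / (2 * (`|w| + 1)) * `|w|)).
  by rewrite {1}/w dotvBl; lra.
rewrite ler_pM2l// in k3; apply: le_trans k3 _.
have -> : 2 * (e / (2 * (`|w| + 1)) * `|w|) = e * (`|w| / (`|w| + 1)).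
  by field; rewrite gt_eqF// ltr_wpDl.
by rewrite ler_piMr ?(ltW e0)// ler_pdivrMr ?ltr_wpDl// mul1r lerDl.
Qed.

(** The mean value inequality bounds increments by nearby gradients; the graph is closed because the
    subdifferential is the singleton of a continuous map. *)
Lemma has_gradient_nice f G : has_gradient f G -> continuous G -> nice f.
Proof.
move=> fG cG; have cf := has_gradient_continuous fG; split.
  move=> x; have /near_rVP [r r0 Hr] : \forall y \near x, `|G x - G y| < 1.
    exact: (@cvgr_dist_lt _ _ _ (nbhs x) _ _ _ (cG x) _ ltr01).
  pose L := d%:R * (`|G x| + 1); have L0 : 0 <= L by rewrite mulr_ge0// addr_ge0.
  exists (r / 2), L; split => //; first by rewrite divr_gt0.
  have key y z : `|y - x| < r / 2 -> `|z - x| < r / 2 -> f y - f z <= L * `|y - z|.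
    move=> yr zr; apply/ler_addgt0Pr => e e0.
    have r2 : 0 < r / 2 by rewrite divr_gt0.
    have [s [u [q [/andP[s0 s1] us /proximal_regular /(has_gradient_subdiff fG) -> qs]]]] :=
      approx_mean_value z y cf e0 r2.
    have ux : `|u - x| < r.
      have -> : u - x = (u - (z + s *: (y - z))) + ((1 - s) *: (z - x) + s *: (y - x)).
        by apply/rowP => i; rewrite !mxE; ring.
      apply: le_lt_trans (ler_normD _ _) _; rewrite [ltRHS]splitr ltr_leD//.
      apply: le_trans (ler_normD _ _) _; rewrite !normrZ (ger0_norm s0) ger0_norm ?subr_ge0//.
      have h1 : (1 - s) * `|z - x| <= (1 - s) * (r / 2) by rewrite ler_wpM2l ?subr_ge0// ltW.
      have h2 : s * `|y - x| <= s * (r / 2) by rewrite ler_wpM2l// ltW.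
      lra.
    have h1 := ler_dotv (G u) (y - z); have h2 := ler_norm (dotv (G u) (y - z)).
    have h3 : `|G u| <= `|G x| + 1.
      have E : G u = G x - (G x - G u) by apply/rowP => i; rewrite !mxE; ring.
      by rewrite E; apply: le_trans (ler_normB _ _) _; rewrite lerD2l ltW// Hr.
    have h4 : d%:R * (`|G u| * `|y - z|) <= L * `|y - z|.
      by rewrite /L -mulrA ler_wpM2l// ler_wpM2r.
    lra.
  move=> y z yr zr; rewrite ler_norml key// andbT lerNl opprB distrC; exact: key.
move=> x v H; suff -> : v = G x.
  apply/regular_subdiffP => e /(fG x) /near_rVP [r r0 Hr]; exists r => // y /Hr.
  by rewrite ler_norml => /andP[]; lra.
apply/eqP; rewrite -subr_eq0 -normr_eq0 eq_le normr_ge0 andbT.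
apply/ler_addgt0Pr => e e0; rewrite add0r.
have e2 : 0 < e / 2 by rewrite divr_gt0.
have /near_rVP [r r0 Hr] : \forall y \near x, `|G x - G y| < e / 2.
  exact: (@cvgr_dist_lt _ _ _ (nbhs x) _ _ _ (cG x) _ e2).
have m0 : 0 < Num.min r (e / 2) by rewrite lt_min r0.
have [y [w [yx wv /(has_gradient_subdiff fG) wE]]] := H _ m0.
move: yx wv; rewrite !lt_min => /andP[/Hr yx _] /andP[_ wv].
have -> : v - G x = - (w - v) - (G x - G y).
  by rewrite wE; apply/rowP => i; rewrite !mxE; ring.
by apply: le_trans (ler_normB _ _) _; rewrite normrN; lra.
Qed.

(** A limit of regular subgradients is a limiting subgradient, the values converging by the
    Lipschitz property; regularity turns it back into a regular one. *)
Lemma regular_lipschitz_nice n (g : 'rV[R]_d -> 'rV[R]_n) i : locally_lipschitz g ->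
  subdiff_regular (component g i) -> nice (component g i).
Proof.
move=> lip reg; have lipi x : exists r L, [/\ 0 < r, 0 <= L &
     forall y z, `|y - x| < r -> `|z - x| < r ->
       `|component g i y - component g i z| <= L * `|y - z|].
  have [U /near_rVP [r r0 Hr] [M [_ HM]]] := lip x.
  exists r, (`|M| + 1); split => // y z yr zr.
  have := HM (`|M| + 1); rewrite ltr_pwDr ?ler_norm// => /(_ isT (y, z)) /= H.
  have {}H : `|g y - g z| <= (`|M| + 1) * `|y - z| by apply: H; split; exact: Hr.
  apply: le_trans H; apply: le_trans (ler_coord_norm _ i).
  by rewrite !mxE.
split => // x v H; rewrite -(reg x).
have /choice [q Hq] : forall n : nat, exists q : 'rV[R]_d * 'rV[R]_d,
    [/\ `|q.1 - x| < n.+1%:R^-1, `|q.2 - v| < n.+1%:R^-1 &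
        regular_subdiff (component g i) q.1 q.2].
  by move=> k; have [//|y [w Hyw]] := H k.+1%:R^-1; exists (y, w).
have qx : (fun k => (q k).1) @ \oo --> x.
  apply/cvgrPdist_lt => e e0; near=> k; have [h1 _ _] := Hq k.
  rewrite distrC; apply: lt_trans h1 _; near: k.
  exact: near_infty_natSinv_lt (PosNum e0).
exists (fun k => (q k).1), (fun k => (q k).2); split => //.
- have [r [L [r0 L0 HL]]] := lipi x.
  apply/cvgrPdist_lt => e e0; near=> k.
  have h1 : `|(q k).1 - x| < r.
    by rewrite distrC; near: k; exact: cvgr_dist_lt qx _ r0.
  have L1 : 0 < L + 1 by rewrite ltr_wpDl.
  have h2 : `|x - (q k).1| < e / (L + 1).
    by near: k; apply: cvgr_dist_lt qx _ _; rewrite divr_gt0// ltr_wpDl.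
  have h3 : `|x - x| < r by rewrite subrr normr0.
  apply: le_lt_trans (HL _ _ h3 h1) _; move: h2; rewrite ltr_pdivlMr// => h2.
  by have := normr_ge0 (x - (q k).1); lra.
- by move=> k; case: (Hq k).
- apply/cvgrPdist_lt => e e0; near=> k; have [_ h1 _] := Hq k.
  rewrite distrC; apply: lt_trans h1 _; near: k.
  exact: near_infty_natSinv_lt (PosNum e0).
Unshelve. all: by end_near. Qed.

End gradients.

(** * Equivalence of norms and distances to sets *)

Section norms.
Variable R : realType.

Lemma is_norm0 (V : lmodType R) (N : V -> R) : is_norm N -> N 0 = 0.
Proof. by move=> [_ NZ _]; rewrite -(scale0r 0) NZ normr0 mul0r. Qed.

Lemma is_norm_ge0 (V : lmodType R) (N : V -> R) x : is_norm N -> 0 <= N x.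
Proof.
move=> NN; have [ND NZ _] := NN; have := ND x (- x); rewrite subrr is_norm0//.
by rewrite -scaleN1r NZ normrN1 mul1r; lra.
Qed.

Lemma is_norm_le k (N : 'rV[R]_k -> R) : is_norm N ->
  exists2 C, 0 < C & forall u, N u <= C * `|u|.
Proof.
move=> NN; have [ND NZ _] := NN.
exists (1 + \sum_j N (delta_mx 0 j)).
  by rewrite ltr_pwDl// sumr_ge0// => j _; exact: is_norm_ge0.
move=> u; rewrite {1}[u]row_sum_delta.
apply: (@le_trans _ _ (\sum_j `|u 0 j| * N (delta_mx 0 j))).
  elim/big_ind2: _ => [|x1 x2 y1 y2 h1 h2|j _]; first by rewrite is_norm0.
    by apply: le_trans (ND _ _) _; rewrite lerD.
  by rewrite NZ.
rewrite mulrDl mul1r mulr_suml ler_wpDl//.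
by apply: ler_sum => j _; rewrite mulrC ler_wpM2l ?is_norm_ge0// ler_coord_norm.
Qed.

(** Compactness of the unit sphere of the maximum norm, on which [N] is continuous by [is_norm_le]
    and does not vanish. *)
Lemma is_norm_ge k (N : 'rV[R]_k -> R) : is_norm N ->
  exists2 c, 0 < c & forall u, c * `|u| <= N u.
Proof.
move=> NN; have [ND NZ N0] := NN; have [C C0 NC] := is_norm_le NN.
apply: contrapT => H.
have /choice [u Hu] : forall n : nat, exists u : 'rV[R]_k, `|u| = 1 /\ N u < n.+1%:R^-1.
  move=> n; apply: contrapT => nu; apply: H; exists n.+1%:R^-1; first by rewrite invr_gt0.
  move=> u; have [->|u0] := eqVneq u 0; first by rewrite normr0 mulr0 is_norm_ge0.
  have un : 0 < `|u| by rewrite normr_gt0.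
  rewrite leNgt; apply/negP => Nu; apply: nu; exists (`|u|^-1 *: u); split.
    by rewrite normrZ normfV normr_id mulVf// gt_eqF.
  by rewrite NZ normfV normr_id mulrC ltr_pdivrMr.
have [|l _ ul] := @ultraN_rV R k u 1; first by apply: ultraN_all => n; have [-> _] := Hu n.
have l1 : `|l| = 1.
  apply: (cvg_unique _ (cvg_norm ul)) => //; apply: cvg_near_cst.
  by apply: ultraN_all => n; have [-> _] := Hu n.
have : N l = 0.
  apply/eqP; rewrite eq_le is_norm_ge0// andbT.
  have c1 : (fun n => C * `|l - u n| + n.+1%:R^-1) @ ultraN --> C * `|l - l| + 0.
    apply: cvgD; last exact: cvg_ultraN_inv.
    apply: cvgM; first exact: cvg_cst.
    by apply: cvg_norm; apply: cvgB => //; exact: cvg_cst.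
  rewrite subrr normr0 mulr0 addr0 in c1.
  apply: ler_cvg_to (cvg_cst _) c1 _; apply: ultraN_all => n.
  have [_ h] := Hu n; rewrite -{1}[l](subrK (u n)).
  by apply: le_trans (ND _ _) _; rewrite lerD// ltW.
by move=> /N0 l0; move: l1; rewrite l0 normr0 => /eqP; rewrite eq_sym oner_eq0.
Qed.

Lemma is_norm_pair_ge (N : R * R -> R) : is_norm N ->
  exists2 c, 0 < c & forall z, c * `|z.1| <= N z /\ c * `|z.2| <= N z.
Proof.
move=> [ND NZ N0].
pose N' (u : 'rV[R]_2) := N (u 0 0, u 0 1).
have [|c c0 Hc] := @is_norm_ge 2 N'.
  split=> [x y|a x|x /N0 [x0 x1]].
  - by rewrite /N' !mxE; exact: (ND (x 0 0, x 0 1) (y 0 0, y 0 1)).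
  - by rewrite /N' !mxE; exact: (NZ a (x 0 0, x 0 1)).
  - apply/rowP => i; rewrite mxE; have [->|->] : i = 0 \/ i = 1.
      by case: i => [[|[|?]] ?] //; [left|right]; apply: val_inj.
    + by [].
    + by [].
exists c => // -[a b] /=.
pose u : 'rV[R]_2 := \row_i (if i == 0 then a else b).
have := Hc u; rewrite /N' !mxE /= => Nu.
have h0 := ler_coord_norm u 0; have h1 := ler_coord_norm u 1.
rewrite !mxE /= in h0 h1.
by split; apply: le_trans Nu; rewrite ler_wpM2l// ltW.
Qed.

Lemma dist_le (V : lmodType R) (N : V -> R) (S : set V) x y : is_norm N -> S y ->
  dist N S x <= N (x - y).
Proof.
move=> NN Sy; apply: ge_inf; last by exists y.
by exists 0 => _ [z _ <-]; exact: is_norm_ge0.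
Qed.

Lemma dist_adherent (V : lmodType R) (N : V -> R) (S : set V) x e : is_norm N ->
  S !=set0 -> 0 < e -> exists2 y, S y & N (x - y) < dist N S x + e.
Proof.
move=> NN [s Ss] e0; have hi : has_inf [set N (x - s) | s in S].
  by split; [exists (N (x - s)); exists s|exists 0 => _ [z _ <-]; exact: is_norm_ge0].
by have [_ [y Sy <-] h] := inf_adherent e0 hi; exists y.
Qed.

Lemma dist_ge0 (V : lmodType R) (N : V -> R) (S : set V) x : is_norm N -> S !=set0 ->
  0 <= dist N S x.
Proof.
move=> NN [s Ss]; apply: lb_le_inf; first by exists (N (x - s)); exists s.
by move=> _ [z _ <-]; exact: is_norm_ge0.
Qed.

End norms.

Lemma cvg_of_inv_dist (R : realType) k (x : nat -> 'rV[R]_k) l :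
  (forall n, `|x n - l| < n.+1%:R^-1) -> x @ \oo --> l.
Proof.
move=> xl; apply/cvgrPdist_lt => e e0; have := near_infty_natSinv_lt (PosNum e0).
by apply: filterS => n; rewrite distrC; exact: lt_trans.
Qed.

(** * Free families, bases and constant rank *)

Section bases.
Variables (R : realType) (d m : nat).
Implicit Types (F : 'I_m -> 'rV[R]_d) (I : {set 'I_m}).

(** Coefficients are indexed by the distinct labels in [s] instead of positions, so the vectors
    themselves may repeat. *)
Lemma free_map (J : eqType) (s : seq J) (F : J -> 'rV[R]_d) : uniq s ->
  (forall c : J -> R, \sum_(j <- s) c j *: F j = 0 -> forall j, j \in s -> c j = 0) ->
  free (map F s).
Proof.
move=> us H; pose t := in_tuple (map F s).
have -> : map F s = t by [].
apply/freeP => k rel.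
case: s us H @t k rel => [|j0 s'] us H t k rel; first by case.
set s := j0 :: s' in us H t k rel *.
have szs : size s = size (map F s) by rewrite size_map.
pose c j := if insub (index j s) is Some i then k i else 0.
have cE (i : 'I_(size (map F s))) : c (nth j0 s i) = k i.
  rewrite /c index_uniq ?szs//; case: insubP => [i' _ E|]; last by rewrite ltn_ord.
  by congr k; apply: val_inj.
move=> i; rewrite -cE; apply: H; last by rewrite mem_nth// szs.
rewrite (big_nth j0) big_mkord szs -[RHS]rel; apply: eq_bigr => l _.
by rewrite cE (nth_map j0)// szs.
Qed.

Lemma free_mapP (J : finType) (A : {set J}) (F : J -> 'rV[R]_d) :
  free [seq F j | j in A] -> independent A F.
Proof.
move=> fr c [k kA ck]; apply/eqP => rel.
move: fr; rewrite /image_mem => fr.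
have := @freeP _ _ _ (in_tuple (map F (enum A))) fr.
have sz : size (enum A) = size (map F (enum A)) by rewrite size_map.
move=> /= /(_ (fun i => c (nth k (enum A) i))) H.
have ik : (index k (enum A) < size (map F (enum A)))%N by rewrite -sz index_mem mem_enum.
have {H} := H _ (Ordinal ik); rewrite /= nth_index ?mem_enum// => H.
move: ck; rewrite H ?eqxx//.
rewrite -[RHS]rel /lincomb -[RHS]big_enum /= [RHS](big_nth k) [RHS]big_mkord sz.
by apply: eq_bigr => i _; rewrite (nth_map k)// sz.
Qed.

(** A free subfamily with the most elements spans: a vector outside its span could be added. *)
Lemma exists_basis F : exists I, basis_of <<[seq F i | i : 'I_m]>>%VS [seq F i | i in I].
Proof.
pose P (I : {set 'I_m}) := free [seq F i | i in I].
have P0 : P finset.set0 by rewrite /P /image_mem enum_set0 nil_free.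
have [I PI Imax] := arg_maxnP (fun I : {set 'I_m} => #|I|) P0.
exists I; apply/andP; split; last exact: PI.
rewrite eqEsubv; apply/andP; split.
  apply/span_subvP => _ /mapP [i _ ->]; apply: memv_span.
  by apply: map_f; rewrite mem_enum.
apply/span_subvP => _ /mapP [i _ ->].
case: (boolP (i \in I)) => iI; first by apply: memv_span; apply: map_f; rewrite mem_enum.
apply: contrapT => /negP ni.
suff /Imax : P (i |: I)%SET by rewrite /= cardsU1 iI add1n ltnn.
have pe : perm_eq (enum (i |: I)%SET) (i :: enum I).
  apply: uniq_perm; rewrite ?enum_uniq//= ?mem_enum ?iI ?enum_uniq// => j.
  by rewrite inE !mem_enum !inE.
by rewrite /P /image_mem (perm_free (perm_map F pe)) /= free_cons ni.
Qed.

Lemma basis_span F I : basis_of <<[seq F i | i : 'I_m]>>%VS [seq F i | i in I] ->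
  forall j, exists mu : 'I_m -> R, F j = \sum_(i in I) mu i *: F i.
Proof.
move=> /span_basis E j.
have : F j \in <<[seq F i | i in I]>>%VS.
  by rewrite E; apply: memv_span; apply: map_f; rewrite mem_enum.
rewrite /image_mem => Fj.
have sz : size (enum I) = size (map F (enum I)) by rewrite size_map.
have := @coord_span _ _ _ (in_tuple (map F (enum I))) _ Fj.
move=> H; exists (fun i => if insub (index i (enum I)) is Some k then
  coord (in_tuple (map F (enum I))) k (F j) else 0).
rewrite {1}H -[RHS]big_enum /= [RHS](big_nth j) [RHS]big_mkord sz; apply: eq_bigr => k _.
rewrite (nth_map j) ?sz// index_uniq ?sz ?enum_uniq//.
case: insubP => [k' _ Ek|]; last by rewrite ltn_ord.
by congr (coord _ _ _ *: _); apply: val_inj.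
Qed.

Lemma independent_rows F I : independent I F ->
  row_free (\matrix_(k < #|I|) F (enum_val k)).
Proof.
move=> ind; apply: inj_row_free => u; rewrite mulmx_sum_row => u0.
apply: contrapT => /eqP /rV0Pn [k uk].
(* Transport of coefficients from positions in the enumeration of [I] to indices; [enum_val] is
   injective, so at most one term survives. *)
pose c i := \sum_(k : 'I_#|I|) (if enum_val k == i then u 0 k else 0).
have cE k' : c (enum_val k') = u 0 k'.
  rewrite /c (bigD1 k')//= eqxx big1 ?addr0// => l lk.
  by rewrite (inj_eq enum_val_inj) (negPf lk).
have : nontriv I c by exists (enum_val k); [exact: enum_valP|rewrite cE].
move=> /ind /negP; apply; rewrite -[X in _ == X]u0 /lincomb big_enum_val.
by apply/eqP; apply: eq_bigr => l _; rewrite cE rowK.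
Qed.

Lemma rank_independent F I : independent I F ->
  \rank (\matrix_(i < m) F i) = #|I| ->
  forall j, exists mu : 'I_m -> R, F j = \sum_(i in I) mu i *: F i.
Proof.
move=> /independent_rows rf rk j.
pose B := \matrix_(k < #|I|) F (enum_val k).
have BA : (B <= \matrix_(i < m) F i)%MS.
  by apply/row_subP => k; rewrite rowK -(rowK F); exact: row_sub.
have /eqmxP : (B == \matrix_(i < m) F i)%MS.
  by rewrite -(mxrank_leqif_eq BA) rk (eqnP rf).
move=> /eqmxP/andP[_ AB].
have /submxP [D DE] : (F j <= B)%MS by apply: submx_trans AB; rewrite -(rowK F); exact: row_sub.
pose c i := \sum_(k : 'I_#|I|) (if enum_val k == i then D 0 k else 0).
have cE k' : c (enum_val k') = D 0 k'.
  rewrite /c (bigD1 k')//= eqxx big1 ?addr0// => l lk.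
  by rewrite (inj_eq enum_val_inj) (negPf lk).
exists c; rewrite DE mulmx_sum_row [RHS]big_enum_val; apply: eq_bigr => l _.
by rewrite cE rowK.
Qed.

Lemma independent_rank F I : independent I F ->
  (forall j, exists mu : 'I_m -> R, F j = \sum_(i in I) mu i *: F i) ->
  \rank (\matrix_(i < m) F i) = #|I|.
Proof.
move=> /independent_rows /eqnP <- sp; apply/eqP; rewrite eqn_leq.
apply/andP; split; apply: mxrankS; last first.
  by apply/row_subP => k; rewrite rowK -(rowK F); exact: row_sub.
apply/row_subP => j; rewrite rowK; have [mu ->] := sp j.
apply: summx_sub => i iI; apply: scalemx_sub.
by rewrite -(enum_rankK_in iI iI) -(rowK (fun k => F (enum_val k))); exact: row_sub.
Qed.

Lemma independent_near (F : 'rV[R]_d -> 'I_m -> 'rV[R]_d) I (x : 'rV[R]_d) :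
  (forall i, continuous (F^~ i)) -> independent I (F x) ->
  \forall y \near x, independent I (F y).
Proof.
move=> cF ind; apply/near_rVP; apply: contrapT => H.
have /choice [q Hq] : forall n : nat, exists q : 'rV[R]_d * ('I_m -> R),
    [/\ `|q.1 - x| < n.+1%:R^-1, nontriv I q.2 & lincomb I q.2 (F q.1) = 0].
  move=> n; apply: contrapT => nq; apply: H; exists n.+1%:R^-1; first by rewrite invr_gt0.
  move=> y yx c nc; apply/eqP => rel; apply: nq; by exists (y, c).
have qx : (fun n => (q n).1) @ ultraN --> x.
  by apply/cvg_ultraN/cvg_of_inv_dist => n; have [h _ _] := Hq n.
have [||cl [nt rel _]] := @relation_limit0 R d 'I_m I (fun n => F (q n).1) (F x) (fun n => (q n).2).
- by move=> k _; apply: (@continuous_cvg _ _ _ ultraN _ (fun n => (q n).1) (F^~ k) x) => //; exact: cF.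
- by apply: ultraN_all => n; have [] := Hq n.
by move: (ind _ nt); rewrite rel eqxx.
Qed.

(** Independence is an open condition, so [I] remains independent near [x]; as the rank is still its
    cardinality, no gradient leaves the span. *)
Lemma constant_rank_span (F : 'rV[R]_d -> 'I_m -> 'rV[R]_d) I (x : 'rV[R]_d) :
  (forall i, continuous (F^~ i)) ->
  basis_of <<[seq F x i | i : 'I_m]>>%VS [seq F x i | i in I] ->
  (\forall y \near x, \rank (\matrix_(i < m) F y i) = \rank (\matrix_(i < m) F x i)) ->
  \forall y \near x, forall j, exists mu : 'I_m -> R, F y j = \sum_(i in I) mu i *: F y i.
Proof.
move=> cF bI /near_rVP [r r0 Hr].
have ind : independent I (F x) by apply: free_mapP; exact: basis_free bI.
have /near_rVP [e e0 He] := independent_near cF ind.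
apply/near_rVP; exists (Num.min r e); first by rewrite lt_min r0.
move=> y; rewrite lt_min => /andP[/Hr yr /He ye].
by apply: rank_independent => //; rewrite yr; apply: independent_rank => //; exact: basis_span.
Qed.

End bases.

Lemma sum_pair_bool (V : nmodType) (I : finType) (F : I * bool -> V) :
  \sum_k F k = \sum_i (F (i, false) + F (i, true)).
Proof.
transitivity (\sum_i \sum_b F (i, b)); first by rewrite pair_bigA; apply: eq_bigr => -[].
by apply: eq_bigr => i _; rewrite big_bool addrC.
Qed.

(** * Branches of the disjunctive system *)

Section branch.
Variables (R : realType) (d n m p : nat).
Variables (g : 'rV[R]_d -> 'rV[R]_n) (h : 'rV[R]_d -> 'rV[R]_m).
Variables (G H : 'I_p -> 'rV[R]_d -> R) (A B : 'I_p -> \bar R * \bar R).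
Variable xbar : 'rV[R]_d.

Notation row := (('I_p * bool) * bool)%type.
Notation T := ('I_n + row)%type.
Notation gradh i x := (grad (component h i) x).

Definition phi (k : 'I_p * bool) := if k.2 then H k.1 else G k.1.

(** In a row [((i, b), s)], [b] selects [H] over [G] and [s] selects the upper over the lower end
    point. *)
Definition bound (l : row) : \bar R :=
  let q := if l.2 then B l.1.1 else A l.1.1 in if l.1.2 then q.2 else q.1.

Definition side (s : bool) : R := if s then 1 else -1.

Definition coord2 (b : bool) (z : R * R) := if b then z.2 else z.1.

(** An infinite end point equals no real number, so its row is never binding. *)
Definition binding (l : T) : bool :=
  match l with
  | inl i => i \in active g xbar
  | inr l => bound l == (phi l.1 xbar)%:E
  end.

(* Non-binding constraints are replaced by 0, so that every constraint of the
   branch is active at [xbar]. *)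
Definition branch (l : T) : 'rV[R]_d -> R :=
  if binding l then
    match l with
    | inl i => component g i
    | inr l => fun x => side l.2 * (phi l.1 x - phi l.1 xbar)
    end
  else fun=> 0.

Hypothesis g_nice : forall i, nice (component g i).
Hypothesis h_smooth : smooth h.
Hypothesis G_smooth : forall i, smooth (G i).
Hypothesis H_smooth : forall i, smooth (H i).
Hypothesis g_xbar : forall i, g xbar 0 i <= 0.
Hypothesis h_xbar : h xbar = 0.
Hypothesis GH_xbar : forall i, box (A i) (B i) (G i xbar, H i xbar).

Lemma phi_smooth k : smooth (phi k).
Proof. by rewrite /phi; case: k => i []; [exact: H_smooth|exact: G_smooth]. Qed.

Lemma has_gradient0 : @has_gradient R d (fun=> 0) (fun=> 0).
Proof.
move=> x e e0; apply/near_rVP; exists 1 => // y _.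
by rewrite dotv0l !subrr normr0 mulr_ge0// ltW.
Qed.

Lemma branch_gradient l : binding (inr l) ->
  has_gradient (branch (inr l)) (fun x => side l.2 *: grad (phi l.1) x).
Proof.
move=> bl; rewrite /branch bl; apply: has_gradient_affine.
exact: smooth_has_gradient (phi_smooth _).
Qed.

Lemma branch0 l : ~~ binding l -> branch l = fun=> 0.
Proof. by rewrite /branch => /negPf ->. Qed.

Lemma branch_nice l : nice (branch l).
Proof.
have [bl|/branch0 ->] := boolP (binding l); last first.
  by apply: (has_gradient_nice has_gradient0); exact: cst_continuous.
case: l bl => [i|l] bl; first by rewrite /branch bl.
apply: (has_gradient_nice (branch_gradient bl)) => x.
by apply: continuousZl_tmp; exact: smooth_grad_continuous (phi_smooth _) x.
Qed.

Lemma branch_xbar l : branch l xbar = 0.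
Proof.
rewrite /branch; case: ifPn => //; case: l => [i|l] /=; last by rewrite subrr mulr0.
by rewrite inE /component => /eqP.
Qed.

Lemma branch_subdiff l x w : regular_subdiff (branch (inr l)) x w -> binding (inr l) ->
  w = side l.2 *: grad (phi l.1) x.
Proof. by move=> H1 bl; exact: has_gradient_subdiff (branch_gradient bl) H1. Qed.

Lemma branch_subdiff0 l x w : regular_subdiff (branch l) x w -> ~~ binding l -> w = 0.
Proof.
by move=> + /branch0 E; rewrite E; exact: has_gradient_subdiff has_gradient0.
Qed.

Lemma side_le0 l z : binding (inr l) -> box (A l.1.1) (B l.1.1) z ->
  side l.2 * (coord2 l.1.2 z - phi l.1 xbar) <= 0.
Proof.
case: l => [[i b] s] /= /eqP bl [/andP[a1 b1] /andP[a2 b2]].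
by case: b s bl => -[]; rewrite /bound /= => bl; move: a1 b1 a2 b2; rewrite bl !lee_fin /side; lra.
Qed.

Lemma sideK s : side s * side s = 1.
Proof. by case: s; rewrite /side ?mulr1// mulrNN mulr1. Qed.

Definition row_holds (l : row) y : bool :=
  if l.2 then ((phi l.1 y)%:E <= bound l)%E else (bound l <= (phi l.1 y)%:E)%E.

Lemma box_rows i y :
  (forall b s, row_holds ((i, b), s) y) <-> box (A i) (B i) (G i y, H i y).
Proof.
split=> [rows|[/andP[a1 b1] /andP[a2 b2]]]; last by case=> -[].
by split; apply/andP; split;
  [exact: (rows false false)|exact: (rows false true)
  |exact: (rows true false)|exact: (rows true true)].
Qed.

Lemma row_near l : row_holds l xbar -> ~~ binding (inr l) ->
  \forall y \near xbar, row_holds l y.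
Proof.
have cphi := has_gradient_continuous (smooth_has_gradient (phi_smooth l.1)).
have dphi e : 0 < e -> \forall y \near xbar, `|phi l.1 xbar - phi l.1 y| < e.
  by move=> e0; apply: (@cvgr_dist_lt _ _ _ (nbhs xbar) _ _ _ (cphi xbar)).
rewrite /row_holds /=; case: (bound l) (l.2) => [a| |] [] /= hx; rewrite ?eqe => nb;
  do ?[by apply/near_rVP; exists 1 => // y _; rewrite ?leey ?leNye];
  do ?[by rewrite ?leNgt ?ltey ?ltNye in hx].
- have /dphi : 0 < a - phi l.1 xbar by rewrite subr_gt0 lt_neqAle eq_sym nb -lee_fin.
  move=> /near_rVP [r r0 Hr]; apply/near_rVP; exists r => // y /Hr.
  by rewrite ltr_norml lee_fin => /andP[h1 _]; move: h1; lra.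
- have /dphi : 0 < phi l.1 xbar - a by rewrite subr_gt0 lt_neqAle nb -lee_fin.
  move=> /near_rVP [r r0 Hr]; apply/near_rVP; exists r => // y /Hr.
  by rewrite ltr_norml lee_fin => /andP[_ h1]; move: h1; lra.
Qed.

(** Rows that do not bind hold strictly at [xbar], hence nearby by continuity; the binding ones are
    expressed by the branch. *)
Lemma branch_near : \forall y \near xbar, (forall l, branch l y <= 0) ->
  (forall i, g y 0 i <= 0) /\ forall i, box (A i) (B i) (G i y, H i y).
Proof.
have near_g : \forall y \near xbar, forall i, i \notin active g xbar -> g y 0 i <= 0.
  apply: (@filter_forall _ _ _ (nbhs xbar)) => i.
  have [|na] := boolP (i \in active g xbar); first by move=> _; apply/near_rVP; exists 1.
  have gi : 0 < - g xbar 0 i by rewrite oppr_gt0 lt_neqAle g_xbar andbT; rewrite inE in na.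
  have cg : continuous (component g i) := nice_continuous (g_nice i).
  have /near_rVP [r r0 Hr] : \forall y \near xbar,
      `|component g i xbar - component g i y| < - g xbar 0 i.
    exact: (@cvgr_dist_lt _ _ _ (nbhs xbar) _ _ _ (cg xbar)).
  apply/near_rVP; exists r => // y /Hr.
  by rewrite /component ltr_norml => /andP[h1 _] _; move: h1; lra.
have near_rows : \forall y \near xbar, forall l : row, ~~ binding (inr l) -> row_holds l y.
  apply: (@filter_forall _ _ _ (nbhs xbar)) => l.
  have [bl|nb] := boolP (binding (inr l)); first by apply/near_rVP; exists 1.
  have /near_rVP [r r0 Hr] : \forall y \near xbar, row_holds l y.
    apply: row_near => //; case: (l) => -[i b] s.
    by have /box_rows := GH_xbar i.
  by apply/near_rVP; exists r => // y /Hr.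
have /near_rVP [r1 r10 H1] := near_g; have /near_rVP [r2 r20 H2] := near_rows.
apply/near_rVP; exists (Num.min r1 r2); first by rewrite lt_min r10.
move=> y; rewrite lt_min => /andP[/H1 gy /H2 ry] fy; split=> i.
  have [ai|na] := boolP (i \in active g xbar); last exact: gy.
  by have := fy (inl i); rewrite /branch /= ai.
apply/box_rows => b s; have [bl|nb] := boolP (binding (inr ((i, b), s))); last exact: ry.
have := fy (inr ((i, b), s)); rewrite /branch bl /= /row_holds.
have /eqP -> := bl; rewrite /= /side.
by case: s {bl} => /=; rewrite lee_fin; lra.
Qed.

Lemma branch_small e : 0 < e -> \forall x \near xbar,
  \sum_l pos (branch l x) + \sum_j `|component h j x| < e.
Proof.
move=> e0.
have cE : (fun x => \sum_l `|branch l x| + \sum_j `|component h j x|) @ nbhs xbar --> (0 : R).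
  have E0 : \sum_l `|branch l xbar| + \sum_j `|component h j xbar| = 0.
    rewrite !big1 ?addr0// => [j _|l _]; last by rewrite branch_xbar normr0.
    by rewrite /component h_xbar mxE normr0.
  have sum_cvg (I : finType) (F : I -> 'rV[R]_d -> R) : (forall l, continuous (F l)) ->
      (fun x => \sum_l `|F l x|) @ nbhs xbar --> \sum_l `|F l xbar|.
    move=> cF; apply: (@cvg_bigsum R R^o _ _ (nbhs xbar) _ _ _ (fun l x => `|F l x|)) => l _.
    by apply: (@cvg_norm _ _ _ (nbhs xbar)); exact: cF.
  rewrite -[X in _ --> X]E0; apply: (@cvgD _ _ _ (nbhs xbar)).
    by apply: (sum_cvg _ branch) => l; exact: nice_continuous (branch_nice l).
  apply: (sum_cvg _ (component h)) => j.
  exact: has_gradient_continuous (component_has_grad j h_smooth).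
have /near_rVP [r r0 Hr] : \forall x \near xbar,
    `|0 - (\sum_l `|branch l x| + \sum_j `|component h j x|)| < e.
  exact: (@cvgr_dist_lt _ _ _ (nbhs xbar) _ _ _ cE).
apply/near_rVP; exists r => // x /Hr; rewrite sub0r normrN ger0_norm; last first.
  by rewrite addr_ge0// sumr_ge0.
apply: le_lt_trans; rewrite lerD2r; apply: ler_sum => l _.
by rewrite /pos ge_max normr_ge0 ler_norm.
Qed.

(** A point of the box satisfies the binding rows, so a violation at [x] is at most the coordinate
    gap to that point. The factor 2 counts the two end points of a coordinate. *)
Lemma branch_residual x s : (forall i, box (A i) (B i) (s i)) ->
  \sum_l pos (branch l x) <= \sum_i pos (g x 0 i)
    + 2 * \sum_i (`|G i x - (s i).1| + `|H i x - (s i).2|).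
Proof.
move=> sAB; rewrite sum_sumType; apply: lerD.
  apply: ler_sum => i _; rewrite /branch; case: ifP => _ //.
  by rewrite pos_le0// pos_ge0.
pose D (k : 'I_p * bool) := `|phi k x - coord2 k.2 (s k.1)|.
have -> : 2 * \sum_i (`|G i x - (s i).1| + `|H i x - (s i).2|) = \sum_(l : row) D l.1.
  rewrite sum_pair_bool /= [RHS]big_split /= -[RHS]mulr2n -[RHS]mulr_natl; congr (_ * _).
  by rewrite sum_pair_bool.
apply: ler_sum => l _; have [bl|/branch0 ->] := boolP (binding (inr l)); last first.
  by rewrite pos_le0// normr_ge0.
rewrite /pos ge_max normr_ge0 /= /branch bl.
apply: (@le_trans _ _ (side l.2 * (phi l.1 x - coord2 l.1.2 (s l.1.1)))).
  have := side_le0 bl (sAB l.1.1); rewrite -subr_ge0 => le0; rewrite -subr_ge0.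
  by apply: le_trans le0 _; rewrite le_eqVlt; apply/orP; left; apply/eqP; ring.
apply: le_trans (ler_norm _) _; rewrite normrM.
suff -> : `|side l.2| = 1 by rewrite mul1r.
by rewrite /side; case: (l.2); rewrite ?normrN1 ?normr1.
Qed.

Section constraint_qualification.
Variables (C1 C2 : set (R * R)) (I1 : {set 'I_m}).
Hypothesis boxAB : forall i, box (A i) (B i) = C1 \/ box (A i) (B i) = C2.
Hypothesis I1_basis : basis_of <<[seq gradh i xbar | i : 'I_m]>>%VS
  [seq gradh i xbar | i in I1].
Hypothesis prcpld : MPODC_PRCPLD g h G H C1 C2 xbar.

Notation idx := (idx (T := T) I1).
Notation vec := (vec (T := T) (fun i x => gradh i x)).

Lemma lincomb_branch S c (V : T + 'I_m -> 'rV[R]_d) : lincomb (idx S) c V =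
  \sum_(i | inl i \in S) c (inl (inl i)) *: V (inl (inl i))
  + \sum_k \sum_(s | inr (k, s) \in S) c (inl (inr (k, s))) *: V (inl (inr (k, s)))
  + \sum_(i in I1) c (inr i) *: V (inr i).
Proof.
rewrite lincomb_idx sum_sumType; congr (_ + _ + _).
by rewrite pair_big_dep /=; apply: eq_big => -[].
Qed.

Lemma lincomb_pred1 (K : finType) (D : {set K}) (V : K -> 'rV[R]_d) a : a \in D ->
  lincomb D (fun k => (k == a)%:R) V = V a.
Proof.
move=> aD; rewrite /lincomb (bigD1 a)//= eqxx scale1r big1 ?addr0// => k /andP[_ /negPf ->].
by rewrite scale0r.
Qed.

Lemma rc_nonbinding S (x : 'rV[R]_d) v l : subgrads branch S x v -> l \in S -> ~~ binding l ->
  exists2 c, nontriv (idx S) c & lincomb (idx S) c (vec x v) = 0.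
Proof.
move=> sv lS bl; have lI : inl l \in idx S by rewrite inE.
exists (fun k => (k == inl l)%:R); first by exists (inl l); rewrite ?eqxx// oner_eq0.
by rewrite lincomb_pred1//=; exact: branch_subdiff0 (sv _ lS) bl.
Qed.

(** Both end points of a coordinate bind when its interval is a single point, and their gradients
    are opposite at every [x]. The case is set apart because the two multipliers could cancel in
    [eta]. *)
Lemma rc_opposite S (x : 'rV[R]_d) v k : subgrads branch S x v ->
  (forall s, inr (k, s) \in S) -> (forall l, l \in S -> binding l) ->
  exists2 c, nontriv (idx S) c & lincomb (idx S) c (vec x v) = 0.
Proof.
move=> sv kS bS.
have lI s : inl (inr (k, s)) \in idx S by rewrite inE.
exists (fun j => (j == inl (inr (k, true)))%:R - -1 * (j == inl (inr (k, false)))%:R).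
  exists (inl (inr (k, true))) => //; rewrite eqxx.
  have /negPf -> : inl (inr (k, true)) != inl (inr (k, false)) :> T + 'I_m by apply/eqP => -[].
  by rewrite mulr0 subr0 oner_eq0.
rewrite lincombB !lincomb_pred1//= (branch_subdiff (sv _ (kS _)) (bS _ (kS _))).
rewrite (branch_subdiff (sv _ (kS false)) (bS _ (kS _))) /side /= scale1r !scaleN1r.
by rewrite opprK subrr.
Qed.

Section one_sided.
Variables (S : {set T}) (c : T + 'I_m -> R).
Hypothesis S_binding : forall l, l \in S -> binding l.
Hypothesis S_one_sided : forall k : 'I_p * bool, ~ (forall s : bool, inr (k, s) \in S).
Hypothesis c_gt0 : forall l, l \in S -> 0 < c (inl l).

(** The signed multiplier of [G i] or [H i]: [side] turns the positive weights of rows into a normal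
    vector of the box. *)
Definition eta (k : 'I_p * bool) := \sum_(s | inr (k, s) \in S) c (inl (inr (k, s))) * side s.

Lemma eta_unique k s s' : inr (k, s) \in S -> inr (k, s') \in S -> s' = s.
Proof.
move=> kS kS'; apply: contrapT => ss; apply: (S_one_sided (k := k)) => t.
by have [->|->] : t = s \/ t = s' by case: t s s' ss {kS kS'} => -[] []; auto.
Qed.

Lemma sum_side (V : nmodType) k s (F : bool -> V) : inr (k, s) \in S ->
  \sum_(s' | inr (k, s') \in S) F s' = F s.
Proof.
move=> kS; rewrite (bigD1 s)//= big1 ?addr0// => s' /andP[kS'].
by rewrite (eta_unique kS kS') eqxx.
Qed.

Lemma eta_neq0 k : eta k != 0 -> exists s, inr (k, s) \in S.
Proof.
move=> ek; apply: contrapT => nS; move: ek; rewrite /eta big1 ?eqxx// => s kS.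
by exfalso; apply: nS; exists s.
Qed.

Lemma neq0_eta k s : inr (k, s) \in S -> eta k != 0.
Proof.
move=> kS; rewrite /eta (sum_side _ kS) mulf_neq0 ?(gt_eqF (c_gt0 kS))//.
by case: (s); rewrite /side /= ?oppr_eq0 oner_eq0.
Qed.

Lemma eta_normal_cone i : normal_cone (box (A i) (B i)) (G i xbar, H i xbar)
  (eta (i, false), eta (i, true)).
Proof.
have part (b : bool) (y : R * R) : box (A i) (B i) y ->
    eta (i, b) * (coord2 b y - phi (i, b) xbar) <= 0.
  move=> By; rewrite /eta mulr_suml; apply: sumr_le0 => s kS.
  rewrite -mulrA mulr_ge0_le0 ?(ltW (c_gt0 kS))//.
  by have := @side_le0 ((i, b), s) y (S_binding kS) By.
split=> [|y By]; first exact: GH_xbar.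
by have := part false y By; have := part true y By; rewrite /coord2 /phi /=; lra.
Qed.

Lemma sum_eta (F : 'I_p * bool -> 'rV[R]_d) :
  \sum_k \sum_(s | inr (k, s) \in S) c (inl (inr (k, s))) *: (side s *: F k) =
  \sum_i (eta (i, false) *: F (i, false) + eta (i, true) *: F (i, true)).
Proof.
transitivity (\sum_k eta k *: F k).
  apply: eq_bigr => k _; rewrite /eta scaler_suml; apply: eq_bigr => s _.
  by rewrite scalerA.
by rewrite sum_pair_bool.
Qed.

Definition gradients (x : 'rV[R]_d) (v : T -> 'rV[R]_d) : seq 'rV[R]_d :=
  [seq v (inl i) | i in [set i | inl i \in S]%SET]
  ++ [seq gradh i x | i in I1]
  ++ [seq grad (G i) x | i in [set i | eta (i, false) != 0]%SET]
  ++ [seq grad (H i) x | i in [set i | eta (i, true) != 0]%SET].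

(** The two families correspond one to one: a row over [k] lies in [S] exactly when [eta k != 0],
    and its gradient differs from that of [phi k] by a sign. *)
Lemma gradients_free (x : 'rV[R]_d) v : subgrads branch S x v ->
  independent (idx S) (vec x v) -> free (gradients x v).
Proof.
move=> sv ind.
pose F (j : ('I_n + 'I_m) + 'I_p * bool) :=
  match j with inl (inl i) => v (inl i) | inl (inr i) => gradh i x | inr k => grad (phi k) x end.
pose s := map (inl \o inl) (enum [set i | inl i \in S]%SET)
  ++ map (inl \o inr) (enum I1)
  ++ map (fun i => inr (i, false)) (enum [set i | eta (i, false) != 0]%SET)
  ++ map (fun i => inr (i, true)) (enum [set i | eta (i, true) != 0]%SET)
  : seq (('I_n + 'I_m) + 'I_p * bool).
have -> : gradients x v = map F s by rewrite /gradients /s !map_cat -!map_comp.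
have us : uniq s.
  rewrite !cat_uniq !map_inj_uniq ?enum_uniq; do ?by move=> ? ? [].
  rewrite /= andbT; apply/and3P; split; apply/hasPn => j; rewrite ?mem_cat.
  - by move=> /or3P[] /mapP [? _ ->]; apply/mapP => -[].
  - by move=> /orP[] /mapP [? _ ->]; apply/mapP => -[].
  - by move=> /mapP [? _ ->]; apply/mapP => -[].
apply: free_map us _ => a rel.
pose c' (k : T + 'I_m) := match k with
  | inl (inl i) => a (inl (inl i))
  | inr i => a (inl (inr i))
  | inl (inr (k, t)) => side t * a (inr k) end.
have relS : lincomb (idx S) c' (vec x v) = 0.
  rewrite lincomb_branch -[RHS]rel !big_cat !big_map !big_enum /=.
  rewrite -addrA; congr (_ + _); first by apply: eq_bigl => i; rewrite inE.
  rewrite addrC; congr (_ + _).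
  transitivity (\sum_k (if eta k != 0 then a (inr k) *: grad (phi k) x else 0)).
    apply: eq_bigr => k _; case: ifPn => [/eta_neq0 [t kS]|/negPn/eqP e0].
      rewrite (sum_side _ kS) (branch_subdiff (sv _ kS) (S_binding kS)) /=.
      by rewrite scalerA mulrAC sideK mul1r.
    rewrite big1// => t kS; exfalso; by move: (neq0_eta kS); rewrite e0 eqxx.
  rewrite sum_pair_bool.
  by rewrite big_split /= -!big_mkcond /=; congr (_ + _); apply: eq_bigl => i; rewrite inE.
have c'0 k : k \in idx S -> c' k = 0.
  move=> kS; apply: contrapT => /eqP ck.
  have /ind : nontriv (idx S) c' by exists k.
  by rewrite relS eqxx.
move=> j; rewrite !mem_cat => /or4P[] /mapP [i + ->]; rewrite mem_enum ?inE /= => iS.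
- by have := c'0 (inl (inl i)); rewrite inE => /(_ iS).
- by have := c'0 (inr i); rewrite inE => /(_ iS).
- have [t kS] := eta_neq0 iS; have := c'0 (inl (inr ((i, false), t))); rewrite inE => /(_ kS) /=.
  by move=> /(congr1 (fun q => side t * q)); rewrite mulrA sideK mul1r mulr0.
- have [t kS] := eta_neq0 iS; have := c'0 (inl (inr ((i, true), t))); rewrite inE => /(_ kS) /=.
  by move=> /(congr1 (fun q => side t * q)); rewrite mulrA sideK mul1r mulr0.
Qed.

End one_sided.

Lemma regular_limiting_subdiff (q : 'rV[R]_d -> R) x w : regular_subdiff q x w ->
  limiting_subdiff q x w.
Proof.
move=> qw; exists (fun=> x), (fun=> w).
by split=> //; [exact: cvg_cst|exact: cvg_cst|exact: cvg_cst].
Qed.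

Lemma branch_limiting_subdiff S i (x : 'rV[R]_d) v : subgrads branch S x v ->
  (forall l, l \in S -> binding l) -> inl i \in S ->
  limiting_subdiff (component g i) x (v (inl i)).
Proof.
move=> sv bS iS; apply: regular_limiting_subdiff.
by have := sv _ iS; rewrite /branch bS.
Qed.

(** The qualification concerns sequences: a failure at every radius [N.+1%:R^-1] gives one along
    which the family stays free. Degenerate [S] are settled beforehand, so that the multipliers
    built from [c] are nonzero. *)
Lemma branch_rc S v c : S != finset.set0 -> subgrads branch S xbar v ->
  (forall l, l \in S -> 0 < c (inl l)) -> lincomb (idx S) c (vec xbar v) = 0 ->
  exists2 e, 0 < e & forall x (v' : T -> 'rV[R]_d), x != xbar -> `|x - xbar| < e ->
    subgrads branch S x v' -> (forall l, l \in S -> `|v' l - v l| < e) ->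
    exists2 c', nontriv (idx S) c' & lincomb (idx S) c' (vec x v') = 0.
Proof.
move=> S0 sv cp rel.
have [bS|nbS] := pselect (forall l, l \in S -> binding l); last first.
  have [l lS nbl] : exists2 l, l \in S & ~~ binding l.
    by apply: contrapT => H1; apply: nbS => l lS; apply: contrapT => /negP ?; apply: H1; exists l.
  by exists 1 => // x v' _ _ sv' _; exact: rc_nonbinding sv' lS nbl.
have [[k kS]|os] := pselect (exists k, forall s, inr (k, s) \in S).
  by exists 1 => // x v' _ _ sv' _; exact: rc_opposite sv' kS bS.
have {}os (k : 'I_p * bool) : ~ (forall s : bool, inr (k, s) \in S).
  by move=> kS; apply: os; exists k.
apply: contrapT => H1.
have /choice [q Hq] : forall N : nat, exists q : 'rV[R]_d * (T -> 'rV[R]_d),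
    [/\ q.1 != xbar, `|q.1 - xbar| < N.+1%:R^-1, subgrads branch S q.1 q.2,
      forall l, l \in S -> `|q.2 l - v l| < N.+1%:R^-1 & independent (idx S) (vec q.1 q.2)].
  move=> N; apply: contrapT => nq; apply: H1; exists N.+1%:R^-1; first by rewrite invr_gt0.
  move=> x v' xx xn sv' vv; apply: contrapT => nc; apply: nq; exists (x, v'); split => //.
  by move=> c' nc'; apply/eqP => rel'; apply: nc; exists c'.
have [_ PR] := prcpld.
pose lh : 'rV[R]_m := \row_i (if i \in I1 then c (inr i) else 0).
pose lg : 'rV[R]_n := \row_i (if inl i \in S then c (inl (inl i)) else 0).
pose eta1 : 'rV[R]_p := \row_i eta S c (i, false).
pose eta2 : 'rV[R]_p := \row_i eta S c (i, true).
have nz : (lh, lg, eta1, eta2) != 0.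
  have /finset.set0Pn [l lS] := S0; apply/negP => /eqP z0.
  have lg0 i : lg 0 i = 0
    by have := congr1 (fun q : 'rV[R]_m * 'rV[R]_n * 'rV[R]_p * 'rV[R]_p => q.1.1.2 0 i) z0;
      rewrite [RHS]mxE.
  have eta10 i : eta1 0 i = 0
    by have := congr1 (fun q : 'rV[R]_m * 'rV[R]_n * 'rV[R]_p * 'rV[R]_p => q.1.2 0 i) z0;
      rewrite [RHS]mxE.
  have eta20 i : eta2 0 i = 0
    by have := congr1 (fun q : 'rV[R]_m * 'rV[R]_n * 'rV[R]_p * 'rV[R]_p => q.2 0 i) z0;
      rewrite [RHS]mxE.
  case: l lS => [i|[[i b] s]] lS.
    by have := lg0 i; rewrite mxE lS => /eqP; rewrite gt_eqF// cp.
  have /negP := neq0_eta os cp lS; apply.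
  by case: b lS => _; [have := eta20 i|have := eta10 i]; rewrite mxE => ->.
have rel0 : 0 = \sum_(i in [set i | inl i \in S]%SET) lg 0 i *: v (inl i)
    + \sum_(i in I1) lh 0 i *: gradh i xbar
    + \sum_i (eta1 0 i *: grad (G i) xbar + eta2 0 i *: grad (H i) xbar).
  rewrite -[LHS]rel lincomb_branch [LHS]addrAC; congr (_ + _ + _).
  - by apply: eq_big => [i|i iS]; rewrite ?inE// mxE iS.
  - by apply: eq_bigr => i iI; rewrite mxE iI.
  transitivity (\sum_k \sum_(s | inr (k, s) \in S)
      c (inl (inr (k, s))) *: (side s *: grad (phi k) xbar)).
    apply: eq_bigr => k _; apply: eq_bigr => s kS.
    by rewrite /= (branch_subdiff (sv _ kS) (bS _ kS)).
  by rewrite (sum_eta _ _ (fun k => grad (phi k) xbar)); apply: eq_bigr => i _; rewrite !mxE.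
have I2a : [set i | inl i \in S]%SET \subset active g xbar.
  by apply/fintype.subsetP => i; rewrite inE => /bS.
have := PR I1 I1_basis _ I2a lh lg eta1 eta2 (fun i => v (inl i)) nz.
move=> /(_ _ _ _ _ rel0 _ (fun N => (q N).1) (fun N i => (q N).2 (inl i))) [].
- by move=> i iI; rewrite mxE (negPf iI).
- by move=> i; rewrite inE mxE => /negPf ->.
- by move=> i; rewrite inE; exact: branch_limiting_subdiff.
- by move=> i; rewrite inE mxE => iS; rewrite iS ltW// cp.
- move=> i; have := eta_normal_cone bS cp i; rewrite !mxE.
  by case: (boxAB i) => ->; [left|right].
- by apply: cvg_of_inv_dist => N; have [] := Hq N.
- by move=> N; have [] := Hq N.
- move=> N i; rewrite inE; have [_ _ sN _ _] := Hq N.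
  exact: branch_limiting_subdiff.
- move=> i; rewrite inE => iS; apply: cvg_of_inv_dist => N.
  by have [_ _ _ vN _] := Hq N; exact: vN.
move=> N _ /(_ N) /(_ (leqnn N)) /negP; apply.
have [_ _ sN _ iN] := Hq N.
have := gradients_free bS os cp sN iN; rewrite /gradients.
have -> : [set i | eta1 0 i != 0]%SET = [set i | eta S c (i, false) != 0]%SET.
  by apply/setP => i; rewrite !inE mxE.
have -> // : [set i | eta2 0 i != 0]%SET = [set i | eta S c (i, true) != 0]%SET.
by apply/setP => i; rewrite !inE mxE.
Qed.

(** Arbitrary points [s i] of the boxes take the place of distances, so that almost nearest points
    can be inserted later; [y] does not depend on them. *)
Lemma branch_error_bound : exists C r : R, [/\ 0 <= C, 0 < r &
  forall x, `|x - xbar| < r -> exists y : 'rV[R]_d,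
    [/\ forall i, g y 0 i <= 0, h y = 0, forall i, box (A i) (B i) (G i y, H i y)
     & forall s, (forall i, box (A i) (B i) (s i)) ->
       `|x - y| <= C * (\sum_i pos (g x 0 i) + \sum_j `|h x 0 j|
                        + \sum_i (`|G i x - (s i).1| + `|H i x - (s i).2|))]].
Proof.
have hG j := component_has_grad j h_smooth.
have hNG j := has_gradient_opp (hG j).
have cgh j : continuous (grad (component h j)) := component_grad_continuous (i := j) h_smooth.
have cNgh j : continuous (fun x => - grad (component h j) x).
  by move=> x; apply: (@cvgN _ _ _ (nbhs x)); exact: cgh.
have hxb j : component h j xbar = 0 by rewrite /component h_xbar mxE.
have gh_indep : independent (idx finset.set0) (vec xbar (fun=> 0)).
  move=> c [[l|i] kI ck]; first by rewrite !inE in kI.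
  rewrite lincomb_idx big_set0 add0r.
  apply: (free_mapP (basis_free I1_basis) (c := fun i => c (inr i))).
  by exists i => //; rewrite inE in kI.
have [rk _] := prcpld.
have gh_span := constant_rank_span cgh I1_basis rk.
have [C [r [C0 r0 EB]]] := system_error_bound branch_nice
  (fun j => has_gradient_nice (hG j) (cgh j)) (fun j => has_gradient_nice (hNG j) (cNgh j))
  (fun j x w => @has_gradient_subdiff _ _ _ _ x w (hG j))
  (fun j x w => @has_gradient_subdiff _ _ _ _ x w (hNG j))
  cgh branch_xbar hxb gh_indep gh_span branch_rc.
have /near_rVP [r1 r10 H1] := branch_near.
have C2_gt0 : 0 < 2 * (C + 1) by rewrite mulr_gt0// ltr_wpDl.
have /near_rVP [r2 r20 H2] := branch_small (divr_gt0 r10 C2_gt0).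
(* [branch_near] needs [y] within [r1] of [xbar]: half of it is spent on [x], and [r2] makes the
   residual small enough for [|x - y| <= r1 / 2]. The factor 2 is that of [branch_residual]. *)
exists (2 * C), (Num.min r (Num.min r2 (r1 / 2))); split; first by rewrite mulr_ge0.
  by rewrite !lt_min r0 r20 divr_gt0.
move=> x; rewrite !lt_min => /and3P[xr xr2 xr1].
have [y [fy hy xy]] := EB x xr; exists y.
have small : C * (\sum_l pos (branch l x) + \sum_j `|component h j x|) <= r1 / 2.
  have q0 : 0 <= \sum_l pos (branch l x) + \sum_j `|component h j x|.
    by rewrite addr_ge0// sumr_ge0// => l _; exact: pos_ge0.
  move: (ltW (H2 x xr2)) q0; move: (_ + _) => q; rewrite ler_pdivlMr// => qr q0.
  by rewrite ler_pdivlMr//; apply: le_trans qr; nra.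
have yr1 : `|y - xbar| < r1.
  rewrite -(subrK x y) -addrA; apply: le_lt_trans (ler_normD _ _) _.
  by rewrite distrC; move: (le_trans xy small) xr1; lra.
have [gy GHy] := H1 y yr1 fy; split => //.
  by apply/rowP => j; rewrite mxE; exact: hy.
move=> s sAB; apply: le_trans xy _; rewrite -/(component h).
have R1 := branch_residual x sAB.
have q10 : 0 <= \sum_i pos (g x 0 i) by apply: sumr_ge0 => i _; exact: pos_ge0.
have q20 : 0 <= \sum_j `|h x 0 j| by apply: sumr_ge0.
rewrite [X in _ <= X]mulrAC [X in _ <= X]mulrC ler_wpM2l//.
apply: le_trans (lerD R1 (lexx (\sum_j `|h x 0 j|))) _.
move: q10 q20; move: (\sum_(i < n) _) => q1; move: (\sum_(j < m) _) => q2.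
by move: (\sum_(i < p) _) => q3; lra.
Qed.

End constraint_qualification.
End branch.

(** * Almost nearest points in a union of two boxes *)

Section boxes.
Variable R : realType.
Implicit Types (a b : \bar R * \bar R) (z w s : R * R) (N : R * R -> R).

Lemma is_norm_pair_le N : is_norm N ->
  exists2 C, 0 < C & forall z, N z <= C * (`|z.1| + `|z.2|).
Proof.
move=> NN; have [ND NZ _] := NN.
exists (1 + N (1, 0) + N (0, 1)).
  by rewrite -addrA ltr_pwDl// addr_ge0// is_norm_ge0.
move=> z; have zE : z = z.1 *: (1, 0) + z.2 *: (0, 1) :> R * R.
  by case: z => x y /=; congr (_, _) => /=; rewrite /GRing.scale /=; ring.
rewrite {1}zE; apply: le_trans (ND _ _) _; rewrite !NZ.
have p1 := mulr_ge0 (normr_ge0 z.2) (is_norm_ge0 (1, 0) NN).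
have p2 := mulr_ge0 (normr_ge0 z.1) (is_norm_ge0 (0, 1) NN).
have := normr_ge0 z.1; have := normr_ge0 z.2; lra.
Qed.

Lemma le_ereal_open (x : \bar R) (t : R) : ~~ (x <= t%:E)%E ->
  exists2 e : R, 0 < e & forall u, `|u - t| < e -> ~~ (x <= u%:E)%E.
Proof.
case: x => [x| |]; rewrite ?leNye// -?ltNge => xt; last by exists 1 => // u _; rewrite -ltNge ltry.
rewrite lte_fin in xt; exists (x - t); first by rewrite subr_gt0.
by move=> u; rewrite -ltNge lte_fin ltr_norml => /andP[_ h]; move: h; lra.
Qed.

Lemma ge_ereal_open (x : \bar R) (t : R) : ~~ (t%:E <= x)%E ->
  exists2 e : R, 0 < e & forall u, `|u - t| < e -> ~~ (u%:E <= x)%E.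
Proof.
case: x => [x| |]; rewrite ?leey// -?ltNge => xt; last by exists 1 => // u _; rewrite -ltNge ltNyr.
rewrite lte_fin in xt; exists (t - x); first by rewrite subr_gt0.
by move=> u; rewrite -ltNge lte_fin ltr_norml => /andP[h _]; move: h; lra.
Qed.

Lemma box_separated a b z : ~ box a b z -> exists2 e : R, 0 < e &
  forall w, `|w.1 - z.1| < e -> `|w.2 - z.2| < e -> ~ box a b w.
Proof.
move=> /not_andP [|] /negP; rewrite negb_and => /orP[] => [/le_ereal_open|/ge_ereal_open] [e e0 He];
  exists e => // w w1 w2 [/andP[h1 h2] /andP[h3 h4]].
- by move: (He _ w1); rewrite h1.
- by move: (He _ w1); rewrite h2.
- by move: (He _ w2); rewrite h3.
- by move: (He _ w2); rewrite h4.
Qed.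

(** A box that misses [zbar] is closed and so stays away from it; near [zbar], almost nearest points
    of the union lie in a box containing [zbar], and thus define an admissible branch. *)
Lemma nearby_box_selection N a1 b1 a2 b2 zbar : is_norm N ->
  (box a1 b1 `|` box a2 b2) zbar ->
  exists e k : R, [/\ 0 < e, 0 < k & forall z t, `|z.1 - zbar.1| < e -> `|z.2 - zbar.2| < e ->
    0 < t -> t <= k -> exists s (r : bool),
      let a := if r then a1 else a2 in let b := if r then b1 else b2 in
      [/\ box a b s, box a b zbar & N (z - s) < dist N (box a1 b1 `|` box a2 b2) z + t]].
Proof.
move=> NN Uz; set U := box a1 b1 `|` box a2 b2.
have [d d0 Hd] : exists2 d : R, 0 < d & forall (r : bool) w,
    `|w.1 - zbar.1| < d -> `|w.2 - zbar.2| < d ->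
    box (if r then a1 else a2) (if r then b1 else b2) w ->
    box (if r then a1 else a2) (if r then b1 else b2) zbar.
  have sep a b : exists2 d : R, 0 < d & forall w,
      `|w.1 - zbar.1| < d -> `|w.2 - zbar.2| < d -> box a b w -> box a b zbar.
    have [bz|/box_separated [d d0 Hd]] := pselect (box a b zbar); first by exists 1.
    by exists d => // w w1 w2 /(Hd w w1 w2).
  have [d1 d10 H1] := sep a1 b1; have [d2 d20 H2] := sep a2 b2.
  exists (Num.min d1 d2); first by rewrite lt_min d10.
  by move=> r w; rewrite !lt_min => /andP[? ?] /andP[? ?]; case: r; [exact: H1|exact: H2].
have [C C0 NC] := is_norm_pair_le NN; have [c c0 Nc] := is_norm_pair_ge NN.
(* [N (z - zbar)] and the tolerance are at most [c * d / 4] each, so [N (z - s) < c * d / 2]: the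
   coordinates of [s] are within [d / 2] of those of [z], hence within [d] of those of [zbar]. *)
exists (Num.min (d / 2) (c * d / (8 * C))), (c * d / 4).
have cd : 0 < c * d by rewrite mulr_gt0.
split; first by rewrite lt_min !divr_gt0// mulr_gt0.
  by rewrite divr_gt0.
move=> z t; rewrite !lt_min => /andP[z1 z1'] /andP[z2 z2'] t0 tk.
have [s Us Ns] : exists2 s, U s & N (z - s) < dist N U z + t.
  by apply: dist_adherent => //; exists zbar.
have Nz : N (z - zbar) <= c * d / 4.
  apply: le_trans (NC _) _; move: z1' z2'; rewrite !ltr_pdivlMr ?mulr_gt0//=.
  by move: `|z.1 - _| `|z.2 - _| => p q; nra.
have Nzs : N (z - s) < c * d / 2.
  by have := dist_le z NN Uz; move: Ns Nz tk; rewrite -/U; lra.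
have [n1 n2] := Nc (z - s).
have s1 : `|s.1 - zbar.1| < d.
  have : `|z.1 - s.1| < d / 2.
    by rewrite -(ltr_pM2l c0) (le_lt_trans n1)// mulrA.
  by have := ler_distD z.1 s.1 zbar.1; rewrite (distrC s.1 z.1); lra.
have s2 : `|s.2 - zbar.2| < d.
  have : `|z.2 - s.2| < d / 2.
    by rewrite -(ltr_pM2l c0) (le_lt_trans n2)// mulrA.
  by have := ler_distD z.2 s.2 zbar.2; rewrite (distrC s.2 z.2); lra.
case: Us => bs.
  by exists s, true; split => //; exact: (Hd true) bs.
by exists s, false; split => //; exact: (Hd false) bs.
Qed.

End boxes.

Lemma residual_bound (R : realType) k (N : 'rV[R]_k -> R) : is_norm N ->
  exists2 K, 0 <= K & forall u : 'rV[R]_k, \sum_i `|u 0 i| <= K * N u.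
Proof.
move=> NN; have [c c0 Nc] := is_norm_ge NN.
exists (k%:R / c); first by rewrite divr_ge0// ltW.
move=> u; apply: (@le_trans _ _ (k%:R * `|u|)).
  have -> : k%:R * `|u| = \sum_(i < k) `|u| by rewrite sumr_const card_ord mulr_natl.
  apply: ler_sum => i _.
  exact: ler_coord_norm.
by rewrite -mulrA ler_wpM2l// mulrC ler_pdivlMr// mulrC.
Qed.
Theorem theorem5p1 (R : realType) (d n m p : nat)
    (a1 b1 a2 b2 : \bar R * \bar R)
    (hab1 : (a1.1 <= b1.1)%E /\ (a1.2 <= b1.2)%E)
    (hab2 : (a2.1 <= b2.1)%E /\ (a2.2 <= b2.2)%E)
    (g : 'rV[R]_d -> 'rV[R]_n) (h : 'rV[R]_d -> 'rV[R]_m)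
    (G H : 'I_p -> 'rV[R]_d -> R)
    (g_lip : locally_lipschitz g)
    (g_reg : forall i, subdiff_regular (component g i))
    (h_smooth : smooth h)
    (G_smooth : forall i, smooth (G i))
    (H_smooth : forall i, smooth (H i))
    (normX : 'rV[R]_d -> R) (normX_norm : is_norm normX)
    (normg : 'rV[R]_n -> R) (normg_norm : is_norm normg)
    (normh : 'rV[R]_m -> R) (normh_norm : is_norm normh)
    (normC : (R * R)%type -> R) (normC_norm : is_norm normC)
    (xbar : 'rV[R]_d)
    (xbar_feasible : feasible g h G H (box a1 b1 `|` box a2 b2) xbar)
    (prcpld : MPODC_PRCPLD g h G H (box a1 b1) (box a2 b2) xbar) :
  exists alpha eps : R,
    [/\ 0 <= alpha, 0 < eps
      & forall x : 'rV[R]_d, normX (x - xbar) < eps ->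
          dist normX (feasible g h G H (box a1 b1 `|` box a2 b2)) x <=
          alpha * (normg (pos_part (g x)) + normh (h x)
                   + \sum_(i < p) dist normC (box a1 b1 `|` box a2 b2)
                                       (G i x, H i x))].
Proof.
have g_nice i := regular_lipschitz_nice g_lip (g_reg i).
have [gx hx zx] := xbar_feasible.
have [I1 I1b] := exists_basis (fun i => grad (component h i) xbar).
(* A branch is a map [r] from indices to boxes; there are finitely many, so one constant and one
   radius serve them all. *)
pose A (r : {ffun 'I_p -> bool}) i := if r i then a1 else a2.
pose B (r : {ffun 'I_p -> bool}) i := if r i then b1 else b2.
pose valid r := forall i, box (A r i) (B r i) (G i xbar, H i xbar).
have /choice [q Hq] : forall r, exists q : R * R, [/\ 0 <= q.1, 0 < q.2 & valid r ->
  forall x, `|x - xbar| < q.2 -> exists y : 'rV[R]_d,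
    [/\ forall i, g y 0 i <= 0, h y = 0, forall i, box (A r i) (B r i) (G i y, H i y)
     & forall s, (forall i, box (A r i) (B r i) (s i)) ->
       `|x - y| <= q.1 * (\sum_i pos (g x 0 i) + \sum_j `|h x 0 j|
                        + \sum_i (`|G i x - (s i).1| + `|H i x - (s i).2|))]].
  (* An invalid branch gets the default constant 0 and radius 1; only valid ones are selected
     below. *)
  move=> r; have [vr|nv] := pselect (valid r); last by exists (0, 1).
  have boxAB i : box (A r i) (B r i) = box a1 b1 \/ box (A r i) (B r i) = box a2 b2.
    by rewrite /A /B; case: (r i); [left|right].
  have [C [e [C0 e0 EB]]] :=
    branch_error_bound g_nice h_smooth G_smooth H_smooth gx hx vr boxAB I1b prcpld.
  by exists (C, e).
have /choice [w Hw] : forall i, exists w : R * R, [/\ 0 < w.1, 0 < w.2 &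
    forall z t, `|z.1 - G i xbar| < w.1 -> `|z.2 - H i xbar| < w.1 -> 0 < t -> t <= w.2 ->
    exists s (r : bool), let a := if r then a1 else a2 in let b := if r then b1 else b2 in
      [/\ box a b s, box a b (G i xbar, H i xbar)
        & normC (z - s) < dist normC (box a1 b1 `|` box a2 b2) z + t]].
  by move=> i; have [e [k [? ? ?]]] := nearby_box_selection normC_norm (zx i); exists (e, k).
have [Kg Kg0 HKg] := residual_bound normg_norm.
have [Kh Kh0 HKh] := residual_bound normh_norm.
have [c c0 Hc] := is_norm_pair_ge normC_norm.
have [Cx Cx0 HCx] := is_norm_le normX_norm.
have [cx cx0 Hcx] := is_norm_ge normX_norm.
pose K := Kg + Kh + 2 / c.
have c20 : 0 <= 2 / c by rewrite divr_ge0// ltW.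
have K0 : 0 <= K by rewrite !addr_ge0.
pose Q := \sum_r (q r).1.
have Q0 : 0 <= Q by apply: sumr_ge0 => r _; have [] := Hq r.
have qQ r : (q r).1 <= Q.
  by rewrite /Q (bigD1 r)//= lerDl sumr_ge0// => r' _; have [] := Hq r'.
have near_q : \forall x \near xbar, forall r, `|x - xbar| < (q r).2.
  apply: (@filter_forall _ _ _ (nbhs xbar)) => r; apply/near_rVP; exists (q r).2 => //.
  by have [] := Hq r.
have near_w : \forall x \near xbar, forall i,
    `|G i x - G i xbar| < (w i).1 /\ `|H i x - H i xbar| < (w i).1.
  apply: (@filter_forall _ _ _ (nbhs xbar)) => i; have [w0 _ _] := Hw i.
  have cG : continuous (G i) := has_gradient_continuous (smooth_has_gradient (G_smooth i)).
  have cH : continuous (H i) := has_gradient_continuous (smooth_has_gradient (H_smooth i)).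
  have /near_rVP [e1 e10 H1] : \forall x \near xbar, `|G i xbar - G i x| < (w i).1.
    exact: (@cvgr_dist_lt _ _ _ (nbhs xbar) _ _ _ (cG xbar)).
  have /near_rVP [e2 e20 H2] : \forall x \near xbar, `|H i xbar - H i x| < (w i).1.
    exact: (@cvgr_dist_lt _ _ _ (nbhs xbar) _ _ _ (cH xbar)).
  apply/near_rVP; exists (Num.min e1 e2); first by rewrite lt_min e10.
  by move=> x; rewrite lt_min => /andP[/H1 h1 /H2 h2]; split; rewrite distrC.
have /near_rVP [e1 e10 H1] := near_q; have /near_rVP [e2 e20 H2] := near_w.
have m0 : 0 < Num.min e1 e2 by rewrite lt_min e10.
pose alpha := Cx * (Q * K).
have a0 : 0 <= alpha by rewrite mulr_ge0 ?mulr_ge0// ltW.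
exists alpha, (cx * Num.min e1 e2); split => //; first by rewrite mulr_gt0.
move=> x xX.
have : `|x - xbar| < Num.min e1 e2 by rewrite -(ltr_pM2l cx0) (le_lt_trans _ xX).
rewrite lt_min => /andP[/H1 xq /H2 xw].
set U := box a1 b1 `|` box a2 b2.
set E := (X in _ <= _ * X).
apply/ler_addgt0Pr => e e_gt0.
(* Distances are approached only up to [t], and the excess [alpha * (p%:R * t)] must stay below [e];
   adding 1 covers a zero denominator. *)
pose t := e / (alpha * p%:R + 1).
have den : 0 < alpha * p%:R + 1 by rewrite ltr_wpDl// mulr_ge0.
have t0 : 0 < t by rewrite divr_gt0.
have te : alpha * (p%:R * t) <= e.
  by rewrite mulrA /t mulrA ler_pdivrMr// mulrC ler_wpM2l ?ltW// ltrDl.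
have /choice [s Hs] : forall i, exists s : (R * R) * bool,
    [/\ box (if s.2 then a1 else a2) (if s.2 then b1 else b2) s.1,
      box (if s.2 then a1 else a2) (if s.2 then b1 else b2) (G i xbar, H i xbar)
    & normC ((G i x, H i x) - s.1) < dist normC U (G i x, H i x) + t].
  move=> i; have [_ w20 sel] := Hw i; have [w1 w2] := xw i.
  have [||s [r /= [h1 h2 h3]]] := sel (G i x, H i x) (Num.min (w i).2 t) w1 w2.
  - by rewrite lt_min w20.
  - by rewrite ge_min lexx.
  exists (s, r); split => //; apply: lt_le_trans h3 _.
  by rewrite lerD2l ge_min lexx orbT.
(* The branch depends on [x]: each index uses the box of an almost nearest point to
   [(G i x, H i x)]. *)
pose r : {ffun 'I_p -> bool} := [ffun i => (s i).2].
have rE i : r i = (s i).2 by rewrite ffunE.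
have vr : valid r by move=> i; rewrite /A /B rE; have [] := Hs i.
have [q0 _ /(_ vr x (xq r)) [y [gy hy By xy]]] := Hq r.
have yF : feasible g h G H U y.
  split=> // i; have := By i; rewrite /A /B; case: (r i); [left|right]; exact.
apply: le_trans (dist_le x normX_norm yF) _.
apply: le_trans (HCx _) _.
have sB i : box (A r i) (B r i) ((s i).1) by rewrite /A /B rE; have [] := Hs i.
have sum_dist : \sum_i (`|G i x - (s i).1.1| + `|H i x - (s i).1.2|) <=
    2 / c * (\sum_i dist normC U (G i x, H i x) + p%:R * t).
  have -> : p%:R * t = \sum_(i < p) t by rewrite sumr_const card_ord mulr_natl.
  rewrite -big_split /= mulr_sumr.
  apply: ler_sum => i _; have [_ _ /ltW hs] := Hs i; have [n1 n2] := Hc ((G i x, H i x) - (s i).1).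
  rewrite mulrAC ler_pdivlMr//; move: hs n1 n2 => /=.
  move: (normC _) `|_ - _| `|_ - _| => v1 v2 v3; lra.
have pg : \sum_i pos (g x 0 i) <= Kg * normg (pos_part (g x)).
  apply: le_trans (HKg _); apply: ler_sum => i _; rewrite mxE; exact: ler_norm.
have total : \sum_i pos (g x 0 i) + \sum_j `|h x 0 j|
    + \sum_i (`|G i x - (s i).1.1| + `|H i x - (s i).1.2|) <= K * (E + p%:R * t).
  have := HKh (h x); have gn := is_norm_ge0 (pos_part (g x)) normg_norm.
  have hn := is_norm_ge0 (h x) normh_norm.
  have dn : 0 <= \sum_i dist normC U (G i x, H i x) + p%:R * t.
    apply: addr_ge0; last by rewrite mulr_ge0// ltW.
    by apply: sumr_ge0 => i _; apply: dist_ge0 => //; exists (G i xbar, H i xbar); exact: zx.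
  move=> hh; apply: le_trans (lerD (lerD pg hh) sum_dist) _.
  rewrite /E -[X in _ <= _ * X]addrA /K; move: gn hn dn c20.
  move: (normg _) (normh _) (2 / c) (_ + _ * t) => v1 v2 v3 v4 v10 v20 v40 v30.
  have := mulr_ge0 Kg0 v20; have := mulr_ge0 Kg0 v40; have := mulr_ge0 Kh0 v10.
  have := mulr_ge0 Kh0 v40; have := mulr_ge0 v30 v10; have := mulr_ge0 v30 v20; lra.
apply: (@le_trans _ _ (Cx * (Q * (K * (E + p%:R * t))))).
  rewrite ler_wpM2l ?(ltW Cx0)//; apply: le_trans (xy _ sB) _.
  apply: ler_pM => //; apply: addr_ge0; last by apply: sumr_ge0 => i _; exact: addr_ge0.
  by apply: addr_ge0; apply: sumr_ge0 => i _ //; exact: pos_ge0.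
by rewrite (_ : Cx * _ = alpha * E + alpha * (p%:R * t)) ?lerD2l// /alpha; ring.
Qed.
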